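(* Let $X$ be a nearest neighbor $\mathbb{Z}^2$-SFT with alphabet $\mathcal{A}$ containing a subset $\mathcal{A}'$ of safe symbols for which $\frac{|\mathcal{A}'|}{|\mathcal{A}|}>1-p_c$. Then $X$ has a unique measure of maximal entropy $\mu$, and $\mu$ is an MRF associated to a translation-invariant $\mathbb{Z}^2$-specification $\Lambda$ satisfying $q(\Lambda)<p_c$. Moreover, the topological entropy of $X$ is $\{J^n\}$-computable for some $J$.
   Context: An alphabet is a finite set $\mathcal{A}$ with at least two elements. A nearest neighbor (n.n.) $\mathbb{Z}^2$-SFT is given by $\mathcal{E}_1,\mathcal{E}_2\subseteq\mathcal{A}^2$: $X$ is the set of $x\in\mathcal{A}^{\mathbb{Z}^2}$ with $(x(u),x(u+e_i))\in\mathcal{E}_i$ for all $u\in\mathbb{Z}^2$, $i=1,2$ ($e_i$ the standard basis vectors). A letter $a\in\mathcal{A}$ is a safe symbol if $(a,c),(c,a)\in\mathcal{E}_i$ for all $c\in\mathcal{A}$ and $i=1,2$. Entropy: for a translation-invariant Borel probability measure $\mu$ on $\mathcal{A}^{\mathbb{Z}^2}$, $h(\mu)=\lim_{j_1,j_2\to\infty}\frac{-1}{j_1j_2}\sum_{w\in\mathcal{A}^{[1,j_1]\times[1,j_2]}}\mu(w)\log\mu(w)$ (terms with $\mu(w)=0$ omitted; finite configurations stand for their cylinder sets). The topological entropy is $h(X)=\sup_\mu h(\mu)$ over translation-invariant measures supported on $X$; a measure of maximal entropy is a translation-invariant measure supported on $X$ achieving the supremum. MRFs: $\mathbb{Z}^2$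 is regarded as a graph with edges between points at $\ell^1$-distance 1; $\partial S$ is the set of sites outside $S$ adjacent to $S$. A measure $\mu$ on $\mathcal{A}^{\mathbb{Z}^2}$ is a ($\mathbb{Z}^2$-)MRF if for every finite $S$, $\eta\in\mathcal{A}^S$, finite $T$ with $\partial S\subseteq T\subseteq\mathbb{Z}^2\setminus S$ and $\delta\in\mathcal{A}^T$ with $\mu(\delta)\ne0$, $\mu(\eta\mid\delta|_{\partial S})=\mu(\eta\mid\delta)$. A $\mathbb{Z}^2$-specification $\Lambda$ is a family of probability measures $\Lambda^\delta$ on $\mathcal{A}^S$, one for every finite $S\subset\mathbb{Z}^2$ and $\delta\in\mathcal{A}^{\partial S}$; it is translation-invariant if $\Lambda^{\sigma_v\delta}=\sigma_v\Lambda^\delta$ for all $\delta,v$, where $(\sigma_vx)(u)=x(u+v)$. An MRF $\mu$ is associated to $\Lambda$ if $\mu(\cdot\mid\delta)=\Lambda^\delta$ on $\mathcal{A}^S$ for all finite $S$ and all $\delta\in\mathcal{A}^{\partial S}$ with $\mu(\delta)>0$. $q(\Lambda)=\sup_{g\in\mathbb{Z}^2}\max_{\delta,\delta'\in\mathcal{A}^{\partial\{g\}}}d(\Lambda^\delta,\Lambda^{\delta'})$ with $d(\alpha,\beta)=\frac12\sum_s|\alpha(s)-\beta(s)|$. $p_c$ is the critical probability for site percolation on $\mathbb{Z}^2$. Computability: $\alpha\in\mathbb{R}$ is $\{r_n\}$-computable if there is a Turing machine which on input $n$ outputs a rational within $2^{-n}$ of $\alpha$, in fewer than $r_n$ steps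 for all sufficiently large $n$. *)

(* Defs.v *)
From HB Require Import structures.
From mathcomp Require Import all_boot all_order all_algebra.
From mathcomp Require Import finmap.
From mathcomp Require Import all_classical all_reals all_analysis.

Set Implicit Arguments.
Unset Strict Implicit.
Unset Printing Implicit Defensive.

Import Order.TTheory GRing.Theory Num.Theory.
Import numFieldNormedType.Exports.

Local Open Scope classical_set_scope.
Local Open Scope fset_scope.
Local Open Scope ring_scope.

Notation Z2 := (int * int)%type.

Definition e1 : Z2 := (1, 0).
Definition e2 : Z2 := (0, 1).

Definition adj : rel Z2 :=
  fun u v => `|u.1 - v.1| + `|u.2 - v.2| == 1 :> int.

Definition boundary (S : {fset Z2}) : {fset Z2} :=
  [fset u + e | u in S, e in [fset e1; - e1; e2; - e2]] `\` S.

Lemma in_boundary (S : {fset Z2}) (w : Z2) :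
  (w \in boundary S) <-> (w \notin S /\ exists2 u, u \in S & adj u w).
Proof.
rewrite /boundary in_fsetD; split.
  case/andP=> wS /imfset2P[/= u uS [e eN wE]]; split=> //; exists u => //.
  rewrite wE /adj /= !opprD !addrA !subrr !add0r; move: eN.
  by rewrite !inE => /orP[/orP[/orP[]|]|] /eqP ->.
case=> wS [u uS]; rewrite wS /= -[w](subrK u) addrC; move: (w - u) => e uw.
apply/imfset2P; exists u => //=; exists e => //.
move: uw; rewrite /adj /= !opprD !addrA !subrr !add0r !inE.
by case: e => -[[|[|m]]|[|m]] [[|[|n]]|[|n]].
Qed.

Record alphabet := Alphabet {
  letter :> finType;
  card_letter : (1 < #|letter|)%N }.

Lemma alphabet_inh (A : alphabet) : A.
Proof. exact: enum_val (Ordinal (ltnW (card_letter A))). Qed.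

Lemma card_bool_gt1 : (1 < #|{: bool}|)%N. Proof. by rewrite card_bool. Qed.
Definition bool_alphabet : alphabet := Alphabet card_bool_gt1.

Definition config (A : alphabet) : Type := {ptws Z2 -> discrete_topology A}.

HB.instance Definition _ (A : alphabet) :=
  Topological.copy (config A) {ptws Z2 -> discrete_topology A}.
HB.instance Definition _ (A : alphabet) :=
  isPointed.Build (config A) (fun=> alphabet_inh A).

Definition borel_config (A : alphabet) : Type :=
  g_sigma_algebraType (@open (config A)).
HB.instance Definition _ (A : alphabet) :=
  Measurable.on (borel_config A).

Definition shift (A : Type) (v : Z2) (x : Z2 -> A) : Z2 -> A :=
  fun u => x (u + v).

(** Elements of $A^S$, for [S] finite, are represented in [{ffun S -> A}]. *)
Definition cylinder (A : Type) (S : {fset Z2}) (w : {ffun S -> A}) :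
  set (Z2 -> A) := [set x | forall u : S, x (val u) = w u].

Definition restr (A : Type) (S : {fset Z2}) (x : Z2 -> A) : {ffun S -> A} :=
  [ffun u : S => x (val u)].

Definition subpattern (A : Type) (S T : {fset Z2}) (ST : S `<=` T)
  (w : {ffun T -> A}) : {ffun S -> A} := [ffun u : S => w (fincl ST u)].

Definition sft (A : finType) (E1 E2 : {set A * A}) : set (Z2 -> A) :=
  [set x | forall u, (x u, x (u + e1)) \in E1 /\ (x u, x (u + e2)) \in E2].

Definition safe_symbol (A : finType) (E1 E2 : {set A * A}) (a : A) : Prop :=
  forall c, [/\ (a, c) \in E1, (c, a) \in E1, (a, c) \in E2 & (c, a) \in E2].

Section Measures.
Context {R : realType} {A : alphabet}.
Implicit Types mu : probability (borel_config A) R.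

Definition shift_invariant mu : Prop :=
  forall (v : Z2) (B : set (borel_config A)),
    measurable B -> mu (shift v @^-1` B) = mu B.

(** To be used with [X] closed only: then [mu X] makes sense and
   [mu X = 1] says that [X] contains the support of [mu]. *)
Definition supported_on (X : set (borel_config A)) mu : Prop := mu X = 1%E.

Definition mass mu (S : {fset Z2}) (w : {ffun S -> A}) : R :=
  fine (mu (cylinder w)).

Definition box (j1 j2 : nat) : {fset Z2} :=
  [fset (i.+1%:Z, k.+1%:Z) | i in iota 0 j1, k in iota 0 j2].

Lemma in_box (j1 j2 : nat) (u : Z2) :
  (u \in box j1 j2) = (1 <= u.1 <= j1%:Z) && (1 <= u.2 <= j2%:Z).
Proof.
apply/imfset2P/idP => /=.
  move=> [i hi [k hk ->]]; move: hi hk; rewrite !mem_iota /= !add0n.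
  by rewrite !lez_nat /= => -> ->.
case: u => -[[|a]|a] [[|b]|b] //=; rewrite ?andbF // !lez_nat => /andP[ha hb].
by exists a; rewrite ?mem_iota //; exists b; rewrite ?mem_iota.
Qed.

(** The terms of mass zero contribute [0 * ln 0 = 0]. *)
Definition entropy mu : R :=
  lim ((fun j : nat * nat => - (j.1 * j.2)%:R^-1 *
          \sum_(w : {ffun box j.1 j.2 -> A}) mass mu w * ln (mass mu w))
       @ filter_prod \oo \oo).

End Measures.

Definition topological_entropy (R : realType) (A : alphabet)
    (X : set (borel_config A)) : R :=
  sup [set h | exists mu : probability (borel_config A) R,
                 [/\ shift_invariant mu, supported_on X mu & h = entropy mu]].

Definition max_entropy (R : realType) (A : alphabet)
    (X : set (borel_config A)) (mu : probability (borel_config A) R) : Prop :=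
  [/\ shift_invariant mu, supported_on X mu
    & entropy mu = topological_entropy R X].

Definition cond_prob (R : realType) (A : alphabet)
    (mu : probability (borel_config A) R) (B C : set (borel_config A)) : R :=
  fine (mu (B `&` C)%classic) / fine (mu C).

Definition is_MRF (R : realType) (A : alphabet)
    (mu : probability (borel_config A) R) : Prop :=
  forall (S : {fset Z2}) (eta : {ffun S -> A}) (T : {fset Z2})
         (bT : boundary S `<=` T), [disjoint T & S]%fset ->
  forall delta : {ffun T -> A}, mu (cylinder delta) != 0%E ->
    cond_prob mu (cylinder eta) (cylinder (subpattern bT delta)) =
    cond_prob mu (cylinder eta) (cylinder delta).

Record specification (R : realType) (A : finType) := Specification {
  spec :> forall S : {fset Z2},
    {ffun boundary S -> A} -> {ffun S -> A} -> R;
  spec_ge0 : forall S delta eta, 0 <= spec (S := S) delta eta;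
  spec_sum1 : forall (S : {fset Z2}) (delta : {ffun boundary S -> A}),
    \sum_eta spec delta eta = 1 }.

(** Every pattern is the restriction of a configuration, so [restr _ x] and
   [restr _ y] are arbitrary patterns on [boundary S] and [S]; the translate by
   [shift v] of a pattern on [S] is a pattern on [S - v]. *)
Definition spec_invariant (R : realType) (A : finType)
    (L : specification R A) : Prop :=
  forall (S : {fset Z2}) (v : Z2) (x y : Z2 -> A),
    let S' := [fset u - v | u in S] in
    L S' (restr (boundary S') (shift v x)) (restr S' (shift v y)) =
    L S (restr (boundary S) x) (restr S y).

Definition associated (R : realType) (A : alphabet)
    (mu : probability (borel_config A) R) (L : specification R A) : Prop :=
  forall (S : {fset Z2}) (delta : {ffun boundary S -> A}),
    (0 < mu (cylinder delta))%E ->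
    forall eta : {ffun S -> A},
      cond_prob mu (cylinder eta) (cylinder delta) = L S delta eta.

Definition tv_dist (R : realType) (T : finType) (a b : T -> R) : R :=
  2^-1 * \sum_s `|a s - b s|.

(** The distances are nonnegative, so starting the maximum at 0 is harmless. *)
Definition spec_q (R : realType) (A : finType) (L : specification R A) : R :=
  sup [set \big[Num.max/0]_(d : {ffun boundary [fset g] -> A} *
                                {ffun boundary [fset g] -> A})
             tv_dist (L [fset g] d.1) (L [fset g] d.2)
      | g in [set: Z2]].

(** [true] stands for an open site. The product measure is characterized by its
   values on cylinders, which determine it. *)
Definition bernoulli_percolation (R : realType) (p : R)
    (P : probability (borel_config bool_alphabet) R) : Prop :=
  forall (S : {fset Z2}) (w : {ffun S -> bool}),
    P (cylinder w) = (\prod_(u : S) (if w u then p else 1 - p))%:E.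

Definition open_cluster (x : Z2 -> bool) : set Z2 :=
  [set u | exists s : seq Z2,
     [/\ path adj 0 s, all x (0 :: s) & last 0 s = u]].

Definition percolates : set (borel_config bool_alphabet) :=
  [set x | infinite_set (open_cluster x)].

Definition p_c (R : realType) : R :=
  sup [set p : R | 0 <= p <= 1 /\
        exists2 P : probability (borel_config bool_alphabet) R,
          bernoulli_percolation p P & P percolates = 0%E].

Inductive io_symbol := Bit of bool | Minus | Slash.

Inductive move := Left | Stay | Right.

Definition displacement (m : move) : int :=
  match m with Left => -1 | Stay => 0 | Right => 1 end.

(** Deterministic machines with finitely many two-way infinite tapes; [None]
   is the blank and [tm_work] the set of additional tape symbols. *)
Definition tape_symbol (G : Type) := option (io_symbol + G).

Record turing_machine := TuringMachine {
  tm_tapes : nat; (* number of tapes minus one *)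
  tm_state : finType;
  tm_work : finType;
  tm_start : tm_state;
  tm_halt : pred tm_state;
  tm_trans : tm_state -> ('I_tm_tapes.+1 -> tape_symbol tm_work) ->
    tm_state * ('I_tm_tapes.+1 -> tape_symbol tm_work * move) }.

Record tm_config (M : turing_machine) := TMConfig {
  cf_state : tm_state M;
  cf_head : 'I_(tm_tapes M).+1 -> int;
  cf_tape : 'I_(tm_tapes M).+1 -> int -> tape_symbol (tm_work M) }.

Definition tm_step (M : turing_machine) (c : tm_config M) : tm_config M :=
  if tm_halt (cf_state c) then c else
  let r := tm_trans (cf_state c) (fun i => cf_tape c i (cf_head c i)) in
  TMConfig r.1
    (fun i => cf_head c i + displacement (r.2 i).2)
    (fun i z => if z == cf_head c i then (r.2 i).1 else cf_tape c i z).

Definition word_tape {G : Type} (w : seq io_symbol) (z : int) :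
    tape_symbol G :=
  match z with
  | Posz i => nth None [seq Some (inl c) | c <- w] i
  | Negz _ => None
  end.

Definition tm_init (M : turing_machine) (w : seq io_symbol) : tm_config M :=
  TMConfig (tm_start M) (fun=> 0)
    (fun i => if i == ord0 then word_tape w else fun=> None).

(** The machine has halted after at most [t] steps on input [w], with the word
   [w'] as the content of its first tape. *)
Definition tm_outputs (M : turing_machine) (w : seq io_symbol) (t : nat)
    (w' : seq io_symbol) : Prop :=
  let c := iter t (@tm_step M) (tm_init M w) in
  tm_halt (cf_state c) /\ cf_tape c ord0 =1 word_tape w'.

(** Binary expansion, most significant digit first; [0] is written "0". *)
Definition nat_word (n : nat) : seq io_symbol :=
  [seq Bit (odd (n %/ 2 ^ i)) | i <- rev (iota 0 (trunc_log 2 n).+1)].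

Definition frac_word (p : int) (d : nat) : seq io_symbol :=
  (if p < 0 then [:: Minus] else [::]) ++ nat_word `|p|%N ++
  Slash :: nat_word d.

Definition computable_in_time (R : realType) (r : nat -> R) (alpha : R) :
    Prop :=
  exists (M : turing_machine) (t : nat -> nat),
    (forall n, exists (p : int) (d : nat),
       [/\ (0 < d)%N, tm_outputs M (nat_word n) (t n) (frac_word p d) &
           `|p%:~R / d%:R - alpha| <= 2 ^- n]) /\
    (\forall n \near \oo, (t n)%:R < r n).

(* Main.v *)
(** Placing letters one at a time, a site carries a prescribed safe symbol with
   conditional probability at least 1/|A|, and two boundary conditions can be
   coupled so that they disagree at a site with probability at most
   1 - |A'|/|A| < p_c.  So disagreement is dominated by a subcritical site
   percolation, whose connection probabilities decay exponentially (the argument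
   of Duminil-Copin and Tassion: if the expected number of open boundary sites
   reached from inside every finite set were at least 1, the probability to reach
   a far set would be bounded below for all larger parameters).
   Hence uniform measures on admissible patterns mix exponentially fast.  Their
   limit is a measure [mu] with the finite volume Gibbs property, and any measure
   with this property equals [mu].  With N(B) the number of admissible fillings of
   a box B surrounded by the safe symbol, ln N(B) / |B| tends to a limit h, since
   the ratio of the numbers of fillings before and after adding a site to a region
   in lexicographic order depends little on the region.  An entropy deficit bounded
   below in one block would, by strong subadditivity, accumulate over disjoint
   translates of the block; so a measure of entropy h has the Gibbs property.
   For a strip of width w = O(n), these ratios give h up to an error 2^-n.
   They are computed by a transfer matrix iteration on the b^w words of length w
   with rounding: all words have continuation numbers within a factor b^w of
   each other, so that rounding costs little as long as the vector has a total of
   order b^(6w).  All quantities are polynomial in b^w, so the iteration runs on a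
   multi-tape machine in time J^n. *)
Require Import Defs.
From HB Require Import structures.
From mathcomp Require Import all_boot all_order all_algebra.
From mathcomp Require Import finmap.
From mathcomp Require Import all_classical all_reals all_analysis.
From mathcomp Require Import zify ring lra.

Set Implicit Arguments.
Unset Strict Implicit.
Unset Printing Implicit Defensive.

Import Order.TTheory GRing.Theory Num.Theory.
Import numFieldNormedType.Exports.

Local Open Scope classical_set_scope.
Local Open Scope fset_scope.
Local Open Scope ring_scope.

Local Notation shift := Defs.shift.

(** * Sums over finite configurations *)

Section Wsum.
Context {R : realType} {T : finType}.
Implicit Types (V U W : {fset Z2}) (x y z : Z2 -> T) (v u : Z2).

Definition upd y v (a : T) : Z2 -> T := fun u => if u == v then a else y u.

Definition glue V (w : {ffun V -> T}) y : Z2 -> T :=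
  fun u => if insub u is Some u' then w u' else y u.

Definition agree V x y := forall u, u \in V -> x u = y u.

Definition agree_off V x y := forall u, u \notin V -> x u = y u.

Lemma glueE V (w : {ffun V -> T}) y (u : V) : glue w y (val u) = w u.
Proof. by rewrite /glue valK. Qed.

Lemma glue_off V (w : {ffun V -> T}) y : agree_off V (glue w y) y.
Proof. by move=> u uV; rewrite /glue insubF // (negbTE uV). Qed.

Lemma glue_restr V x y : agree_off V x y -> glue (restr V x) y = x.
Proof.
move=> xy; apply/funext => u; case: (boolP (u \in V)) => uV.
  by rewrite -[u]/(val [` uV]) glueE ffunE.
by rewrite glue_off // xy.
Qed.

Lemma restr_glue V (w : {ffun V -> T}) y : restr V (glue w y) = w.
Proof. by apply/ffunP => u; rewrite ffunE glueE. Qed.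

Lemma updE y v a : upd y v a v = a.
Proof. by rewrite /upd eqxx. Qed.

Lemma upd_neq y v a u : u != v -> upd y v a u = y u.
Proof. by rewrite /upd => /negbTE ->. Qed.

Lemma upd_id x v : upd x v (x v) = x.
Proof. by apply/funext => u; rewrite /upd; case: eqP => [->|]. Qed.

(** Sum of [f] over all ways to refill [V] in [y], weighted by the product over
   [V] of the weights [rho] of the letters. *)
Definition wsum (rho : T -> R) V (f : (Z2 -> T) -> R) y : R :=
  \sum_(w : {ffun V -> T}) (\prod_(u <- V) rho (glue w y u)) * f (glue w y).

Lemma eq_wsum rho V f1 f2 y :
  (forall x, agree_off V x y -> f1 x = f2 x) -> wsum rho V f1 y = wsum rho V f2 y.
Proof. by move=> f12; apply: eq_bigr => w _; rewrite f12 //; apply: glue_off. Qed.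

Lemma le_wsum rho V f1 f2 y : (forall a, 0 <= rho a) ->
  (forall x, agree_off V x y -> f1 x <= f2 x) -> wsum rho V f1 y <= wsum rho V f2 y.
Proof.
move=> rho0 f12; apply: ler_sum => w _; apply: ler_wpM2l.
  by apply: prodr_ge0.
by apply: f12; apply: glue_off.
Qed.

Lemma wsum_ge0 rho V f y : (forall a, 0 <= rho a) ->
  (forall x, agree_off V x y -> 0 <= f x) -> 0 <= wsum rho V f y.
Proof.
move=> rho0 f0; apply: sumr_ge0 => w _; apply: mulr_ge0; first exact: prodr_ge0.
by apply: f0; apply: glue_off.
Qed.

Lemma wsumD rho V f1 f2 y :
  wsum rho V (fun x => f1 x + f2 x) y = wsum rho V f1 y + wsum rho V f2 y.
Proof. by rewrite -big_split; apply: eq_bigr => w _; rewrite mulrDr. Qed.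

Lemma wsumZ rho V f c y :
  wsum rho V (fun x => c * f x) y = c * wsum rho V f y.
Proof. by rewrite mulr_sumr; apply: eq_bigr => w _; rewrite mulrCA. Qed.

Lemma wsumZr rho V f c y :
  wsum rho V (fun x => f x * c) y = wsum rho V f y * c.
Proof. by rewrite mulr_suml; apply: eq_bigr => w _; rewrite mulrA. Qed.

Lemma wsumB rho V f1 f2 y :
  wsum rho V (fun x => f1 x - f2 x) y = wsum rho V f1 y - wsum rho V f2 y.
Proof. by rewrite -sumrB; apply: eq_bigr => w _; rewrite mulrBr. Qed.

Lemma wsum_sum rho V (I : Type) (r : seq I) (P : pred I) (F : I -> (Z2 -> T) -> R) y :
  wsum rho V (fun x => \sum_(i <- r | P i) F i x) y = \sum_(i <- r | P i) wsum rho V (F i) y.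
Proof. by rewrite exchange_big; apply: eq_bigr => w _; rewrite mulr_sumr. Qed.

Lemma wsum0 rho f y : wsum rho fset0 f y = f y.
Proof.
have e (w : {ffun fset0 -> T}) : glue w y = y.
  by apply/funext => u; rewrite glue_off.
rewrite /wsum (bigD1 (restr fset0 y)) //= e big_seq_fset0 mul1r big1 ?addr0 //.
by move=> w; rewrite -(restr_glue w y) e eqxx.
Qed.

Lemma wsum_step rho V v f y : v \notin V ->
  wsum rho (v |` V) f y = \sum_a rho a * wsum rho V f (upd y v a).
Proof.
move=> vV; under eq_bigr do rewrite mulr_sumr.
rewrite pair_bigA /=.
pose h (p : T * {ffun V -> T}) := restr (v |` V) (glue p.2 (upd y v p.1)).
pose k (w : {ffun v |` V -> T}) := (glue w y v, restr V (glue w y)).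
have gh p : glue (h p) y = glue p.2 (upd y v p.1).
  rewrite /h glue_restr // => u; rewrite in_fset1U negb_or => /andP[uv uV].
  by rewrite glue_off // upd_neq.
have hk : cancel k h.
  move=> w; rewrite /h /k /= -[RHS](restr_glue w y); congr restr.
  apply/glue_restr => u uV; rewrite /upd; case: eqP => [->//|/eqP uv].
  by rewrite glue_off // in_fset1U negb_or uv.
have kh : cancel h k.
  move=> [a w]; rewrite /k gh /= glue_off // updE; congr pair.
  exact: restr_glue.
rewrite /wsum (reindex h) /=; last by exists k => p _; [apply: kh | apply: hk].
apply: eq_bigr => -[a w] _; rewrite gh /= mulrA; congr (_ * _).
by rewrite big_fsetU1 //= glue_off // updE.
Qed.

Lemma fset_ind (P : {fset Z2} -> Prop) : P fset0 ->
  (forall v V, v \notin V -> P V -> P (v |` V)) -> forall V, P V.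
Proof.
move=> P0 PS V; move: {2}#|`V| (erefl #|`V|) => n; elim: n V => [|n IH] V.
  by move=> /cardfs0_eq ->.
move=> Vn; have /fset0Pn[v vV] : V != fset0 by rewrite -cardfs_eq0 Vn.
rewrite -(fsetD1K vV); apply: PS; first by rewrite !inE eqxx.
by apply: IH; apply/eqP; rewrite -eqSS -Vn (cardfsD1 v V) vV.
Qed.

Lemma wsumU rho U V f y : [disjoint U & V] ->
  wsum rho (U `|` V) f y = wsum rho U (fun x => wsum rho V f x) y.
Proof.
elim/fset_ind: U y => [|v U vU IH] y; first by rewrite fset0U wsum0.
rewrite fdisjointU1X => /andP[vV UV].
rewrite -fsetUA !wsum_step //; last by rewrite in_fsetU negb_or vU.
by apply: eq_bigr => a _; rewrite IH.
Qed.

Lemma wsum_sub rho U V f y : U `<=` V ->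
  wsum rho V f y = wsum rho (V `\` U) (fun x => wsum rho U f x) y.
Proof.
move=> UV; rewrite -wsumU; first by rewrite fsetUC fsetUDl fsetDv fsetD0 (fsetUidPr _ _ UV).
by apply/fdisjointP => u; rewrite inE => /andP[].
Qed.

Lemma wsumD1 rho V v f y : v \in V ->
  wsum rho V f y = \sum_a rho a * wsum rho (V `\ v) f (upd y v a).
Proof. by move=> vV; rewrite -wsum_step ?fsetD1K // !inE eqxx. Qed.

Lemma wsum1 rho v f y : wsum rho [fset v] f y = \sum_a rho a * f (upd y v a).
Proof.
by rewrite -[[fset v]]fsetU0 wsum_step //; apply: eq_bigr => a _; rewrite wsum0.
Qed.

Lemma wsum_const rho V c y : \sum_a rho a = 1 -> wsum rho V (fun=> c) y = c.
Proof.
move=> r1; elim/fset_ind: V y => [|v V vV IH] y; first by rewrite wsum0.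
rewrite wsum_step //; under eq_bigr do rewrite IH.
by rewrite -mulr_suml r1 mul1r.
Qed.

Lemma eq_wsum2 rho V f1 f2 y1 y2 :
  (forall w : {ffun V -> T}, f1 (glue w y1) = f2 (glue w y2)) ->
  wsum rho V f1 y1 = wsum rho V f2 y2.
Proof.
move=> f12; apply: eq_bigr => w _; rewrite f12; congr (_ * _).
rewrite big_seq_cond [RHS]big_seq_cond; apply: eq_bigr => u; rewrite andbT => uV.
by rewrite -[u]/(val [` uV]) !glueE.
Qed.

Lemma wsum_restrict rho U V f y : \sum_a rho a = 1 -> U `<=` V ->
  (forall x x', agree U x x' -> f x = f x') -> wsum rho V f y = wsum rho U f y.
Proof.
move=> r1 UV fU; rewrite (wsum_sub _ _ _ UV).
rewrite -[RHS](@wsum_const rho (V `\` U) _ y r1); apply: eq_wsum => x _.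
apply: eq_wsum2 => w; apply: fU => u uU.
by rewrite -[u]/(val [` uU]) !glueE.
Qed.

Definition trans (v : Z2) V : {fset Z2} := [fset u + v | u in V].

Lemma in_trans v V u : (u \in trans v V) = (u - v \in V).
Proof.
apply/imfsetP/idP => [[w wV ->]|uV]; first by rewrite addrK.
by exists (u - v) => //; rewrite subrK.
Qed.

Lemma wsum_trans rho V f v y :
  wsum rho (trans v V) f y = wsum rho V (fun x => f (shift (- v) x)) (shift v y).
Proof.
elim/fset_ind: V y => [|u V uV IH] y.
  rewrite (_ : trans v fset0 = fset0); last by apply/fsetP => u; rewrite in_trans !inE.
  by rewrite !wsum0; congr f; apply/funext => u; rewrite /shift subrK.
have -> : trans v (u |` V) = (u + v) |` trans v V.
  by apply/fsetP => w; rewrite in_trans !inE subr_eq in_trans.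
rewrite !wsum_step // ?in_trans ?addrK //; apply: eq_bigr => a _.
rewrite IH; congr (_ * wsum _ _ _ _); apply/funext => w.
by rewrite /shift /upd (inj_eq (addIr v)).
Qed.

End Wsum.

(** * Site percolation in finite volume *)

Lemma adj_sym : symmetric adj.
Proof. by move=> u v; rewrite /adj distrC [X in _ + X]distrC. Qed.

Definition addp (v : Z2) (D : pred Z2) : pred Z2 := fun z => (z == v) || D z.

Definition hit (x : Z2 -> bool) (V : {fset Z2}) (D T : pred Z2) : bool :=
  `[< exists u s, [/\ D u, path adj u s,
        all (fun z => x z && (z \in V)) s & T (last u s)] >].

Lemma hitP x V (D T : pred Z2) : reflect (exists u s, [/\ D u, path adj u s,
  all (fun z => x z && (z \in V)) s & T (last u s)]) (hit x V D T).
Proof. exact: asboolP. Qed.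

Lemma hit_mono x (V V' : {fset Z2}) (D D' T T' : pred Z2) : V `<=` V' ->
  (forall u, D u -> D' u) -> (forall u, T u -> T' u) ->
  hit x V D T -> hit x V' D' T'.
Proof.
move=> /fsubsetP VV' DD' TT' /hitP[u [s [Du p a Tu]]]; apply/hitP.
exists u, s; split=> //; [exact: DD' | | exact: TT'].
by apply: sub_all a => z /andP[-> /VV' ->].
Qed.

Lemma hit_agree x x' V D T : agree V x x' -> hit x V D T = hit x' V D T.
Proof.
move=> xx'; apply/hitP/hitP => -[u [s [Du p a Tu]]]; exists u, s; split=> //;
  by apply: sub_all a => z /andP[xz zV]; rewrite zV andbT ?xx' // -xx'.
Qed.

Lemma hit_explore x V (D T : pred Z2) v u : v \in V -> D u -> adj u v ->
  hit x V D T = hit x (V `\ v) (if x v then addp v D else D) T.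
Proof.
move=> vV Du uv; apply/hitP/hitP => -[u0 [s [Du0 p a Tu]]]; last first.
  move: Du0; case: ifPn => xv /=; last first.
    exists u0, s; split=> //; apply: sub_all a => z.
    by rewrite !inE => /and3P[-> _ ->].
  case/orP => [/eqP eu|Du0]; last first.
    exists u0, s; split=> //; apply: sub_all a => z.
    by rewrite !inE => /and3P[-> _ ->].
  exists u, (v :: s); rewrite -eu /= eu uv xv vV -eu; split=> //.
  by apply: sub_all a => z; rewrite !inE => /and3P[-> _ ->].
move: p a Tu; case/shortenP => s' p'; rewrite cons_uniq => /andP[_ us'] s's a Tl.
have {}a z : z \in s' -> x z && (z \in V) by move/s's => /(allP a).
case: (boolP (v \in s')) => vs'.
  case/splitPr: vs' p' us' a Tl {s's} => p1 p2; rewrite cat_path last_cat /=.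
  move=> /and3P[_ _ p2p]; rewrite cat_uniq /= => /and4P[_ _ vp2 _] a Tl.
  have /andP[xv _] : x v && (v \in V) by apply: a; rewrite mem_cat mem_head orbT.
  exists v, p2; split=> //; first by rewrite xv /addp eqxx.
  apply/allP => z zp2; have: x z && (z \in V).
    by apply: a; rewrite mem_cat (mem_behead (s := v :: p2)) ?orbT.
  by rewrite !inE => /andP[-> ->]; rewrite andbT; apply: contraNneq vp2 => <-.
exists u0, s'; split=> //; first by case: ifP => // _; rewrite /addp Du0 orbT.
apply/allP => z zs'; move: (a _ zs') => /andP[xz zV].
by rewrite !inE xz zV !andbT; apply: contraNneq vs' => <-.
Qed.

Lemma hit_stuck x V (D T : pred Z2) :
  (forall u v, D u -> adj u v -> v \notin V) ->
  hit x V D T = `[< exists2 u, D u & T u >].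
Proof.
move=> st; apply/hitP/asboolP => [[u [[|v s] [Du /= p a Tu]]]|[u Du Tu]].
- by exists u.
- by case/andP: p => uv _; case/andP: a => /andP[_ vV]; rewrite (negbTE (st _ _ Du uv)) in vV.
- by exists u, [::].
Qed.

Section Percolation.
Context {R : realType}.
Implicit Types (p : R) (V K S : {fset Z2}) (D T : pred Z2).

Definition bern p (b : bool) : R := if b then p else 1 - p.

Lemma bern_ge0 p b : 0 <= p <= 1 -> 0 <= bern p b.
Proof. by case: b => /=; lra. Qed.

Lemma bern_sum p : \sum_b bern p b = 1.
Proof. by rewrite big_bool /= addrC subrK. Qed.

Definition perc p V D T : R :=
  wsum (bern p) V (fun x => (hit x V D T)%:R) (fun=> false).

Lemma wsum_base p V (f : (Z2 -> bool) -> R) y y' :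
  (forall x x', agree V x x' -> f x = f x') ->
  wsum (bern p) V f y = wsum (bern p) V f y'.
Proof.
move=> fV; apply: eq_wsum2 => w; apply: fV => u uV.
by rewrite -[u]/(val [` uV]) !glueE.
Qed.

Lemma perc_base p V D T y :
  wsum (bern p) V (fun x => (hit x V D T)%:R) y = perc p V D T.
Proof. by apply: wsum_base => x x' /hit_agree ->. Qed.

Lemma perc_ge0 p V D T : 0 <= p <= 1 -> 0 <= perc p V D T.
Proof. by move=> p01; apply: wsum_ge0 => // a; apply: bern_ge0. Qed.

Lemma perc_le1 p V D T : 0 <= p <= 1 -> perc p V D T <= 1.
Proof.
move=> p01; rewrite -[leRHS](@wsum_const R _ (bern p) V 1 (fun=> false) (bern_sum p)).
by apply: le_wsum => [a|x _]; [exact: bern_ge0 | rewrite lern1 leq_b1].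
Qed.

Lemma perc_explore p V D T v u : v \in V -> D u -> adj u v ->
  perc p V D T = (1 - p) * perc p (V `\ v) D T + p * perc p (V `\ v) (addp v D) T.
Proof.
move=> vV Du uv; rewrite {1}/perc (wsumD1 _ _ _ vV) big_bool /= addrC.
by congr (_ * _ + _ * _);
  [rewrite -[RHS](perc_base _ _ _ _ (upd (fun=> false) v false))
  |rewrite -[RHS](perc_base _ _ _ _ (upd (fun=> false) v true))];
  apply: eq_wsum => x xy; rewrite (hit_explore _ _ vV Du uv) xy ?inE ?eqxx // updE.
Qed.

Lemma perc_stuck p V D T : (forall u v, D u -> adj u v -> v \notin V) ->
  perc p V D T = `[< exists2 u, D u & T u >]%:R.
Proof.
move=> st; rewrite -[RHS](@wsum_const R _ (bern p) V _ (fun=> false) (bern_sum p)).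
by apply: eq_wsum => x _; rewrite hit_stuck.
Qed.

Lemma perc_trivial p V D T u : D u -> T u -> perc p V D T = 1.
Proof.
move=> Du Tu; rewrite -[RHS](@wsum_const R _ (bern p) V _ (fun=> false) (bern_sum p)).
apply: eq_wsum => x _; suff -> : hit x V D T by [].
by apply/hitP; exists u, [::].
Qed.

Lemma perc_mono p V V' D D' T T' : 0 <= p <= 1 -> V `<=` V' ->
  (forall u, D u -> D' u) -> (forall u, T u -> T' u) ->
  perc p V D T <= perc p V' D' T'.
Proof.
move=> p01 VV' DD' TT'.
rewrite /perc -(wsum_restrict _ (bern_sum p) VV') => [|x x' /hit_agree -> //].
apply: le_wsum => [a|x _]; first exact: bern_ge0.
by rewrite ler_nat; case: (boolP (hit x V D T)) => // /(hit_mono VV' DD' TT') ->.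
Qed.

Lemma sum_fset_mono (A B : {fset Z2}) (F : Z2 -> R) : A `<=` B ->
  (forall u, u \in B -> 0 <= F u) -> \sum_(u <- A) F u <= \sum_(u <- B) F u.
Proof.
move=> AB F0; rewrite [leRHS](big_fsetID _ (mem A)) /=.
rewrite (_ : [fset x in B | x \in A] = A); last first.
  apply/fsetP => u; rewrite !inE /=; apply/andP/idP => [[]//|uA]; split=> //.
  exact: (fsubsetP AB).
rewrite lerDl big_seq; apply: sumr_ge0 => u; rewrite !inE => /andP[uB _].
exact: F0.
Qed.

(** The expected number of sites of the outer boundary of [S] that are open and
   adjacent to the cluster of the origin in [S]. *)
Definition phi p S : R :=
  \sum_(y <- boundary S) p * perc p (S `\ (0 : Z2)) (pred1 (0 : Z2)) (adj y).

Lemma phi_ge0 p S : 0 <= p <= 1 -> 0 <= phi p S.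
Proof.
move=> p01; apply: sumr_ge0 => y _; apply: mulr_ge0; last exact: perc_ge0.
by case/andP: p01.
Qed.

Lemma mem_addp D v : addp v D v.
Proof. by rewrite /addp eqxx. Qed.

Lemma addp_sub D v u : D u -> addp v D u.
Proof. by rewrite /addp => ->; rewrite orbT. Qed.

Lemma addpC D v u : addp u (addp v D) = addp v (addp u D).
Proof. by apply/funext => z; rewrite /addp orbCA. Qed.

Lemma path_rev_adj (u : Z2) s : path adj u s -> path adj (last u s) (rev (belast u s)).
Proof. by rewrite rev_path; apply: sub_path => a b; rewrite adj_sym. Qed.

Lemma hit_reverse (x : Z2 -> bool) V (y z : Z2) : z \in V -> x z ->
  hit x (V `\ z) (pred1 z) (adj y) -> hit x V (pred1 y) (pred1 z).
Proof.
move=> zV xz /hitP[_ [s [/eqP -> p a l]]]; apply/hitP.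
exists y, (rev (z :: s)); split=> //=.
- by rewrite lastI rev_rcons /= l path_rev_adj.
- rewrite all_rev /= xz zV /=; apply: sub_all a => w.
  by rewrite !inE => /and3P[-> _ ->].
- by rewrite rev_cons last_rcons.
Qed.

Lemma perc_reverse p V y z : 0 <= p <= 1 -> z \in V ->
  p * perc p (V `\ z) (pred1 z) (adj y) <= perc p V (pred1 y) (pred1 z).
Proof.
move=> p01 zV; rewrite -(perc_base _ _ _ _ (upd (fun=> false) z true)).
rewrite [leRHS]/perc (wsumD1 _ _ _ zV) big_bool /= -[leLHS]addr0; apply: lerD.
  apply: ler_wpM2l; first by case/andP: p01.
  apply: le_wsum => [a|x xy]; first exact: bern_ge0.
  have xz : x z by rewrite xy ?updE // !inE eqxx.
  by rewrite ler_nat; case: (boolP (hit x (V `\ z) _ _)) => // /(hit_reverse zV xz) ->.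
apply: mulr_ge0; first by lra.
by apply: wsum_ge0 => [a|x _]; first exact: bern_ge0.
Qed.

Lemma perc_mono_start p V D D' T : 0 <= p <= 1 ->
  (forall u, D u -> D' u) -> perc p V D T <= perc p V D' T.
Proof. by move=> p01 DD'; apply: perc_mono. Qed.

(** Explore the complement of [V] inwards: [D] is the explored open part and [K]
   the explored closed sites. The closed pivotal sites of [K] are carried along
   because Russo's formula for [V] only accounts for the unexplored sites. *)
Lemma russo_exploration p V K D : 0 < p < 1 ->
  (forall S, (0 : Z2) \in S -> 1 <= phi p S) -> [disjoint K & V] ->
  (forall z y, z \in V -> adj z y -> [|| y \in V, y \in K | D y]) ->
  [|| (0 : Z2) \in V, (0 : Z2) \in K | D 0] ->
  let g D := perc p V D (pred1 0) in
  exists2 d, is_derive p 1 (fun p => perc p V D (pred1 0)) d &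
    1 - g D <= d + (1 - p)^-1 * \sum_(y <- K) (g (addp y D) - g D).
Proof.
move=> p01 phi1; have p01' : 0 <= p <= 1 by lra.
have q0 : 0 < 1 - p by lra.
have [n] := ubnP #|`V|; elim: n V K D => // n IH V K D; rewrite ltnS => Vn.
move=> KV VK z0 /=; have [D0|D0] := boolP (D 0).
  have g1 p' D' : D' (0 : Z2) -> perc p' V D' (pred1 (0 : Z2)) = 1.
    by move=> D'0; apply: (perc_trivial _ _ D'0) => /=.
  exists 0.
    rewrite (_ : (fun p' : R => perc p' V D (pred1 (0 : Z2))) = cst 1) ; first exact: is_derive_cst.
    by apply/funext => p'; exact: g1.
  rewrite g1 // subrr big1 ?mulr0 ?addr0 // => y _; rewrite g1 ?subrr //.
  exact: addp_sub.
have [[v vV [u Du uv]]|st] := pselect (exists2 v, v \in V & exists2 u, D u & adj u v).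
  have vV' : v \notin V `\ v by rewrite !inE eqxx.
  have V'n : (#|` V `\ v| < n)%N.
    by apply: leq_trans Vn; rewrite (cardfsD1 v V) vV.
  have vK : v \notin K by apply: contraL vV => /(fdisjointP KV).
  have [|||d0 dd0 le0] := IH (V `\ v) (v |` K) D V'n.
  - rewrite fdisjointU1X vV' /=; apply: fdisjointWr KV; exact: fsubD1set.
  - move=> z y; rewrite !inE => /andP[_ zV] zy.
    by case: (y =P v) => //= _; rewrite (VK z y).
  - by move: z0; rewrite !inE; case: (_ =P v).
  have [|||d1 dd1 le1] := IH (V `\ v) K (addp v D) V'n.
  - apply: fdisjointWr KV; exact: fsubD1set.
  - move=> z y; rewrite !inE /addp => /andP[_ zV] zy.
    by case: (y =P v) => //= _; rewrite ?orbT // (VK z y).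
  - by move: z0; rewrite !inE /addp; case: (_ =P v); rewrite ?orbT.
  have gE p' D' : D' u -> perc p' V D' (pred1 (0 : Z2)) = (1 - p') * perc p' (V `\ v) D' (pred1 (0 : Z2)) +
      p' * perc p' (V `\ v) (addp v D') (pred1 (0 : Z2)).
    by move=> D'u; apply: perc_explore uv.
  set g0 := perc p (V `\ v) D (pred1 (0 : Z2)) in le0 *.
  set g1 := perc p (V `\ v) (addp v D) (pred1 (0 : Z2)) in le0 le1 *.
  exists (g1 - g0 + (1 - p) * d0 + p * d1).
    under [X in is_derive _ _ X]boolp.funext do rewrite gE //.
    apply: is_derive_eq; rewrite /GRing.scale /= -/g0 -/g1; ring.
  have -> : \sum_(y <- K) (perc p V (addp y D) (pred1 (0 : Z2)) - perc p V D (pred1 (0 : Z2))) =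
    (1 - p) * (\sum_(y <- K) (perc p (V `\ v) (addp y D) (pred1 (0 : Z2)) - g0)) +
    p * (\sum_(y <- K) (perc p (V `\ v) (addp y (addp v D)) (pred1 (0 : Z2)) - g1)).
    rewrite !mulr_sumr -big_split /=; apply: eq_bigr => y _.
    rewrite !gE //; last exact: addp_sub.
    by rewrite addpC -/g0 -/g1; ring.
  move: le0 le1; rewrite big_fsetU1 //= -/g0 -/g1 gE // -/g0 -/g1.
  set s0 := \sum_(y <- K) _; set s1 := \sum_(y <- K) _ => le0 le1.
  have -> : g1 - g0 + (1 - p) * d0 + p * d1 + (1 - p)^-1 * ((1 - p) * s0 + p * s1) =
    (1 - p) * (d0 + (1 - p)^-1 * (g1 - g0 + s0)) + p * (d1 + (1 - p)^-1 * s1).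
    by field; lra.
  apply: le_trans (_ : (1 - p) * (1 - g0) + p * (1 - g1) <= _); first by lra.
  by apply: lerD; apply: ler_wpM2l => //; lra.
have {}st u v : D u -> adj u v -> v \notin V.
  by move=> Du uv; apply/negP => vV; apply: st; exists v => //; exists u.
have g0 p' : perc p' V D (pred1 (0 : Z2)) = 0.
  rewrite perc_stuck // asboolF // => -[u Du /eqP u0].
  by rewrite -u0 Du in D0.
exists 0.
  rewrite (_ : (fun p' : R => perc p' V D (pred1 (0 : Z2))) = cst 0) ; first exact: is_derive_cst.
  by apply/funext => p'; exact: g0.
under eq_bigr do rewrite g0 subr0.
rewrite g0 subr0 add0r mulrC ler_pdivlMr // mul1r.
have [zV|zV] := boolP ((0 : Z2) \in V); last first.
  have zK : (0 : Z2) \in K by move: z0; rewrite (negbTE zV) (negbTE D0) orbF.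
  rewrite (big_fsetD1 _ zK) /= (@perc_trivial _ _ _ _ 0) ?mem_addp //=.
  rewrite -[leLHS]addr0 lerD //; first by lra.
  by apply: sumr_ge0 => y _; apply: perc_ge0.
apply: le_trans (_ : 1 <= _); first by lra.
apply: le_trans (phi1 _ zV) _; rewrite /phi.
apply: le_trans (_ : \sum_(y <- boundary V) perc p V (addp y D) (pred1 (0 : Z2)) <= _).
  rewrite big_seq [leRHS]big_seq; apply: ler_sum => y /in_boundary[yV _].
  apply: le_trans (perc_reverse _ p01' zV) (perc_mono_start _ _ p01' _) => u /eqP ->.
  exact: mem_addp.
apply: sum_fset_mono => [|y _]; last exact: perc_ge0.
apply/fsubsetP => y /in_boundary[yV [z zV' zy]].
case/or3P: (VK z y zV' zy) => // [|Dy]; first by rewrite (negbTE yV).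
by have := st y z Dy; rewrite adj_sym zV' => /(_ zy).
Qed.

Definition ball (u : Z2) (n : nat) : {fset Z2} :=
  trans (u - (n.+1%:Z, n.+1%:Z)) (box (2 * n).+1 (2 * n).+1).

Lemma in_ball u n v : (v \in ball u n) = (`|v.1 - u.1| <= n%:Z) && (`|v.2 - u.2| <= n%:Z).
Proof.
rewrite in_trans in_box; case: u v => u1 u2 [v1 v2] /=.
by rewrite !ler_norml; congr (_ && _); lia.
Qed.

Lemma ball_center u n : u \in ball u n.
Proof. by rewrite in_ball !subrr normr0. Qed.

Lemma ball_triangle u v w m n : v \in ball u m -> w \in ball v n -> w \in ball u (m + n).
Proof.
rewrite !in_ball !ler_norml; case: u v w => ? ? [? ?] [? ?] /=.
by move=> /andP[? ?] /andP[? ?]; apply/andP; split; lia.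
Qed.

Lemma ball_adj u v n : u \in ball v n -> forall w, adj u w -> w \in ball v n.+1.
Proof.
rewrite !in_ball !ler_norml; case: u v => ? ? [? ?] /= /andP[? ?] [? ?] /eqP /=.
by rewrite !in_ball !ler_norml => ?; apply/andP; split => /=; lia.
Qed.

Lemma fset_in_ball (S : {fset Z2}) u : exists n, S `<=` ball u n.
Proof.
elim/fset_ind: S => [|v S _ [n Sn]]; first by exists 0%N; apply: fsub0set.
exists (n + `|v.1 - u.1|%N + `|v.2 - u.2|%N)%N; apply/fsubsetP => w.
rewrite in_fset1U => /orP[/eqP ->|/(fsubsetP Sn)]; rewrite !in_ball -!abszE !lez_nat.
  by rewrite leq_addl -addnA addnCA leq_addr.
by move=> /andP[wu1 wu2]; rewrite -addnA !(leq_trans _ (leq_addr _ _)).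
Qed.

Definition far (u : Z2) (n : nat) : pred Z2 := fun z => z \notin ball u n.

Lemma adjD (u a b : Z2) : adj (a + u) (b + u) = adj a b.
Proof.
have h (x y z : int) : x + z - (y + z) = x - y by ring.
by rewrite /adj /= !h.
Qed.

Lemma adjBr (u a b : Z2) : adj a (b - u) = adj (a + u) b.
Proof. by rewrite -(adjD u) subrK. Qed.

Lemma boundary_trans u S : boundary (trans u S) = trans u (boundary S).
Proof.
apply/fsetP => v; rewrite in_trans; apply/idP/idP => /in_boundary[vS [w wS wv]].
  move: vS wS; rewrite !in_trans => vS wS; apply/in_boundary; split=> //.
  by exists (w - u) => //; rewrite -(adjD u) !subrK.
apply/in_boundary; split; first by rewrite in_trans.
exists (w + u); first by rewrite in_trans addrK.
by rewrite -adjBr.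
Qed.

Lemma hit_trans x u V D T :
  hit x (trans u V) D T = hit (shift u x) V (fun z => D (z + u)) (fun z => T (z + u)).
Proof.
apply/hitP/hitP => -[v [s [Dv p a Tv]]].
  exists (v - u), [seq z - u | z <- s]; rewrite subrK; split=> //.
  - by apply: (homo_path (f := fun z => z - u)) p => a' b'; rewrite -(adjD u (_ - _)) !subrK.
  - rewrite all_map; apply: sub_all a => z /=; rewrite in_trans /shift subrK //.
  - by rewrite (last_map (fun z => z - u)) subrK.
exists (v + u), [seq z + u | z <- s]; split=> //.
- apply: (@homo_path _ _ (fun z => z + u) adj adj v s _ p) => a' b'.
  by rewrite adjD.
- by rewrite all_map; apply: sub_all a => z /=; rewrite in_trans addrK /shift.
- by rewrite (last_map (fun z => z + u)).
Qed.

Lemma perc_trans p u V D T : perc p (trans u V) D T =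
  perc p V (fun z => D (z + u)) (fun z => T (z + u)).
Proof.
rewrite /perc wsum_trans; apply: eq_wsum => x _; rewrite hit_trans.
rewrite (_ : shift u (shift (- u) x) = x) //.
by apply/funext => z; rewrite /shift addrK.
Qed.

Lemma phi_trans p u S :
  \sum_(y <- boundary (trans u S)) p * perc p (trans u S `\ u) (pred1 u) (adj y) = phi p S.
Proof.
rewrite boundary_trans /trans big_imfset /=; last by move=> ? ? _ _ /addIr.
apply: eq_bigr => y _; congr (_ * _).
have -> : [fset u0 + u | u0 in S] `\ u = trans u (S `\ (0 : Z2)).
  apply/fsetP => z; rewrite in_trans !inE -in_trans; congr (_ && _).
  by rewrite subr_eq add0r.
rewrite perc_trans; congr perc; apply/funext => z /=.
  by rewrite -[X in _ == X]add0r (inj_eq (addIr u)).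
exact: adjD.
Qed.

Lemma perc_far_step p S L : 0 <= p <= 1 -> S `|` boundary S `<=` ball 0 L ->
  (0 : Z2) \in S -> forall k V u, u \notin V ->
  perc p V (pred1 u) (far u (k * L)) <= phi p S ^+ k.
Proof.
move=> p01 SL S0; have p0 : 0 <= p by case/andP: p01.
elim=> [|k IHk] V u uV; first by rewrite expr0; apply: perc_le1.
have SuL y : y \in trans u S -> y \in ball u L.
  rewrite in_trans => yS; have /(fsubsetP SL) : y - u \in S `|` boundary S by rewrite inE yS.
  by rewrite !in_ball /= !subr0.
have dSuL y : y \in boundary (trans u S) -> y \in ball u L.
  rewrite boundary_trans in_trans => yS.
  have /(fsubsetP SL) : y - u \in S `|` boundary S by rewrite in_fsetU yS orbT.
  by rewrite !in_ball /= !subr0.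
have key n : forall V D, (#|` V `&` trans u S| < n)%N ->
    (forall z, D z -> z \in trans u S) -> 
  perc p V D (far u (k.+1 * L)) <= \sum_(y <- boundary (trans u S))
     p * phi p S ^+ k * perc p (V `&` trans u S) D (adj y).
  elim: n => // n IH {uV}V D; rewrite ltnS => Vn DS.
  have [[v vV [w Dw wv]]|st] := pselect (exists2 v, v \in V `&` trans u S & exists2 w, D w & adj w v).
    have := vV; rewrite inE => /andP[vV1 vV2].
    have VE : (V `&` trans u S) `\ v = (V `\ v) `&` trans u S.
      by apply/fsetP => z; rewrite !inE andbA.
    rewrite (perc_explore _ _ vV1 Dw wv).
    under eq_bigr do rewrite (perc_explore _ _ vV Dw wv) VE mulrDr.
    rewrite big_split /=; apply: lerD; under eq_bigr do rewrite mulrCA;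
    rewrite -mulr_sumr; (apply: ler_wpM2l; first lra); apply: IH => //.
    - by rewrite -VE; apply: leq_trans Vn; rewrite [leqRHS](cardfsD1 v) vV.
    - by rewrite -VE; apply: leq_trans Vn; rewrite [leqRHS](cardfsD1 v) vV.
    - by move=> z; rewrite /addp => /orP[/eqP ->|/DS].
  have {}st z v : D z -> adj z v -> v \notin V `&` trans u S.
    by move=> Dz zv; apply/negP => vV; apply: st; exists v => //; exists z.
  apply: le_trans (_ : wsum (bern p) V (fun x => \sum_(y <- boundary (trans u S))
      `[< exists2 z, D z & adj y z >]%:R *
       ((y \in V) && x y && hit x (V `\ y) (pred1 y) (far y (k * L)))%:R) (fun=> false) <= _).
    apply: le_wsum => [a|x _]; first exact: bern_ge0.
    case: (boolP (hit x V D _)) => [|_]; last by apply: sumr_ge0 => y _; rewrite -natrM ler0n.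
    case/hitP => z [[|y s] [Dz /= pp aa tt]].
      by move: tt; rewrite /far (fsubsetP (_ : ball u L `<=` _)) ?SuL ?DS //;
         apply/fsubsetP => t; rewrite !in_ball; nia.
    case/andP: pp => zy pp; move: pp aa tt; case/shortenP => s' p' us' s's aa tt.
    case/andP: aa => /andP[xy yV] aa.
    have yS : y \notin trans u S by have := st _ _ Dz zy; rewrite inE yV.
    have yb : y \in boundary (trans u S).
      by apply/in_boundary; split=> //; exists z => //; apply: DS.
    rewrite (big_fsetD1 _ yb) /= asboolT; last by exists z => //; rewrite adj_sym.
    rewrite yV xy /= mul1r; suff -> : hit x (V `\ y) (pred1 y) (far y (k * L)).
      by rewrite lerDl; apply: sumr_ge0 => t _; rewrite -natrM ler0n.
    apply/hitP; exists y, s'; split=> //=.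
      move: us'; rewrite cons_uniq => /andP[ys' _]; apply/allP => t ts'.
      have /andP[xt tV] := allP aa _ (s's _ ts').
      by rewrite xt !inE tV andbT /=; apply: contraNneq ys' => <-.
    move: tt; rewrite /far; apply: contra => /(ball_triangle (dSuL _ yb)).
    by rewrite mulSn.
  rewrite wsum_sum; rewrite big_seq [leRHS]big_seq; apply: ler_sum => y yb.
  rewrite perc_stuck // wsumZ.
  rewrite mulrC ler_wpM2r ?ler0n //.
  have [yV|yV] := boolP (y \in V); last first.
    rewrite [leLHS](@wsum_const R _ (bern p) V 0 (fun=> false) (bern_sum p)).
    by apply: mulr_ge0 => //; apply: exprn_ge0; apply: phi_ge0.
  rewrite (wsumD1 _ _ _ yV) big_bool /= -[leRHS]addr0; apply: lerD.
    apply: ler_wpM2l => //; apply: le_trans (IHk (V `\ y) y _); last by rewrite !inE eqxx.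
    rewrite -(perc_base p _ _ _ (upd (fun=> false) y true)).
    apply: le_wsum => [a|x _]; first exact: bern_ge0.
    by rewrite ler_nat; case: (hit _ _ _ _); rewrite ?andbF ?leq_b1.
  rewrite [X in _ * X](_ : _ = 0) ?mulr0 //.
  rewrite -[RHS](@wsum_const R _ (bern p) (V `\ y) _ (upd (fun=> false) y false) (bern_sum p)).
  by apply: eq_wsum => x xy; rewrite xy ?updE ?andbF // !inE eqxx.
apply: le_trans (key _ V (pred1 u) (ltnSn _) _) _.
  by move=> z /eqP ->; rewrite in_trans subrr.
rewrite exprSr -[X in _ <= _ * X](phi_trans p u S) mulr_sumr; apply: ler_sum => y _.
rewrite [p * _ ^+ _]mulrC -mulrA; apply: ler_wpM2l; first by apply: exprn_ge0; apply: phi_ge0.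
apply: ler_wpM2l => //; apply: perc_mono => //; apply/fsubsetP => z.
by rewrite !inE => /andP[zV ->]; rewrite andbT; apply: contraNneq uV => <-.
Qed.

Lemma perc_far_decay p S : 0 <= p <= 1 -> (0 : Z2) \in S -> phi p S < 1 ->
  exists2 rho : R, 0 < rho < 1 & exists C : R, 1 <= C /\
    forall V u r, u \notin V -> perc p V (pred1 u) (far u r) <= C * rho ^+ r.
Proof.
move=> p01 S0 phi1; have [L0 SL0] := fset_in_ball (S `|` boundary S) 0.
have [L [L1 SL]] : exists L, (0 < L)%N /\ S `|` boundary S `<=` ball 0 L.
  exists L0.+1; split=> //; apply: fsubset_trans SL0 _.
  by apply/fsubsetP => z; rewrite !in_ball => /andP[? ?]; apply/andP; split; lia.
have ph0 : 0 <= phi p S by apply: phi_ge0.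
pose rho := 1 - (1 - phi p S) / (2 * L)%:R.
have L0' : (0 : R) < L%:R by rewrite ltr0n.
have L1' : (1 : R) <= L%:R by rewrite ler1n.
have rho01 : 0 < rho < 1.
  rewrite /rho natrM; apply/andP; split.
    by rewrite subr_gt0 ltr_pdivrMr; nra.
  by rewrite ltrBlDr ltrDl divr_gt0; nra.
have phiL : phi p S <= rho ^+ L.
  apply: le_trans (_ : 1 - L%:R * (1 - rho) <= _).
    rewrite /rho natrM; have -> : 1 - L%:R * (1 - (1 - (1 - phi p S) / (2 * L%:R))) = 1 - (1 - phi p S) / 2.
      by field; lra.
    lra.
  elim: (L) => [|l IHl]; first by rewrite mul0r subr0 expr0.
  rewrite exprS; have : 0 <= rho ^+ l <= 1.
    by rewrite exprn_ge0 ?exprn_ile1 //; lra.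
  by rewrite -natr1; move: IHl; set X := rho ^+ l; set Y := l%:R; nra.
exists rho => //; exists (rho ^- L); split.
  rewrite invf_ge1 ?exprn_gt0 ?exprn_ile1 //; lra.
move=> V u r uV; rewrite {2}(divn_eq r L); set k := (r %/ L)%N.
apply: le_trans (perc_mono (T' := far u (k * L)) p01 (fsubset_refl V) (fun _ h => h) _) _.
  have kr : (k * L)%:Z <= r%:Z by rewrite lez_nat leq_trunc_div.
  move=> z; apply: contra; rewrite !in_ball => /andP[z1 z2].
  by rewrite (le_trans z1) // (le_trans z2).
apply: le_trans (perc_far_step p01 SL S0 _ uV) _.
apply: le_trans (_ : rho ^+ (k * L) <= _).
  by rewrite mulnC exprM; apply: lerXn2r => //; rewrite nnegrE ?exprn_ge0 //; lra.
rewrite exprD mulrCA -[leLHS]mulr1; apply: ler_wpM2l; first by apply: exprn_ge0; lra.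
have r0 : 0 < rho by lra.
have rL : (r %% L <= L)%N by apply: ltnW; rewrite ltn_mod.
rewrite ler_pdivlMl ?exprn_gt0 // mulr1; apply: ler_wiXn2l rL; lra.
Qed.

Lemma perc_continuous V D T : continuous (fun p => perc p V D T).
Proof.
rewrite /perc; move: (fun=> false) (fun x => _%:R) => y f.
elim/fset_ind: V y => [|v V vV IH] y p /=.
  by under eq_fun do rewrite wsum0; apply: cvg_cst.
under eq_fun do rewrite wsum_step // big_bool /=.
apply: cvgD; apply: cvgM; try exact: IH.
  exact: cvg_id.
by apply: cvgB; [exact: cvg_cst | exact: cvg_id].
Qed.

Lemma perc_sharp p0 p1 : 0 < p0 -> p0 < p1 -> p1 <= 1 ->
  (forall e, 0 < e -> exists n, perc p1 (ball 0 n) (far 0 n) (pred1 0) < e) ->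
  exists2 p, p0 < p < p1 & exists2 S, (0 : Z2) \in S & phi p S < 1.
Proof.
move=> p0_gt0 p01 p1_le1 small; apply: contrapT => nop.
have phi1 p S : p0 < p < p1 -> (0 : Z2) \in S -> 1 <= phi p S.
  by move=> pp S0; rewrite leNgt; apply/negP => ph; apply: nop; exists p => //; exists S.
have [|n] := small ((p1 - p0) / 2); first by lra.
set f := fun p => perc p (ball 0 n) (far 0 n) (pred1 (0 : Z2)); rewrite -/(f p1) => fp1.
have df p : p \in `]p0, p1[ -> is_derive p 1 f ('D_1 f p) /\ 1 - f p <= 'D_1 f p.
  rewrite in_itv /= => pp; have p01' : 0 < p < 1 by lra.
  have [|||d [dd dE] le_d] := russo_exploration (V := ball 0 n) (K := fset0) (D := far 0 n) p01' (fun S => phi1 p S pp).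
  - exact: fdisjoint0X.
  - by move=> z y _ _; rewrite /far; case: (y \in ball 0 n).
  - by rewrite ball_center.
  rewrite big_seq_fset0 mulr0 addr0 in le_d.
  by split; [split | rewrite /f -dE in le_d *].
have cf a b : {within `[a, b], continuous f}.
  by apply: continuous_subspaceT; exact: perc_continuous.
have f01 p : 0 <= p <= 1 -> 0 <= f p <= 1 by move=> pp; rewrite perc_ge0 // perc_le1.
have [c cin fc] := MVT p01 (fun p pp => (df p pp).1) (cf p0 p1).
have [_ dc] := df _ cin; move: cin; rewrite in_itv /= => /andP[c0 c1].
have dfc p : p \in `]c, p1[ -> is_derive p 1 f ('D_1 f p).
  by rewrite in_itv /= => pp; apply: (df _ _).1; rewrite in_itv /=; lra.
have [t + ft] := MVT c1 dfc (cf c p1).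
rewrite in_itv /= => /andP[ct tp1].
have [_ dt] : is_derive t 1 f ('D_1 f t) /\ 1 - f t <= 'D_1 f t.
  by apply: df; rewrite in_itv /=; lra.
have := f01 t; have := f01 c; have := f01 p0; have := f01 p1; nra.
Qed.

Lemma hit_far (x : Z2 -> bool) (U : {fset Z2}) (D : pred Z2) (W : {fset Z2}) r :
  (forall w d, w \in W -> D d -> d \notin ball w r.+1) ->
  hit x U D (fun z => z \in W) ->
  exists2 w, w \in W & hit x (U `\ w) (pred1 w) (far w r).
Proof.
move=> DW /hitP[d [s [Dd p a Ww]]]; move: p a Ww.
case/shortenP => s' p' us' s's a Ww.
have {}a z : z \in s' -> x z && (z \in U) by move/s's => /(allP a).
case/lastP: s' p' us' a Ww {s's} => [|s' w] p' us' a Ww.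
  by have := DW _ _ Ww Dd; rewrite ball_center.
rewrite last_rcons in Ww; exists w => //; move: p' us'.
rewrite cons_uniq rcons_uniq rcons_path => /andP[p' lw] /and3P[_ ws' _].
have far_adj z : adj d z -> z \notin ball w r.
  by move=> dz; apply: contra (DW _ _ Ww Dd) => /ball_adj; apply; rewrite adj_sym.
case: s' p' lw ws' a => [|z s'] /= p' lw ws' a.
  by apply/hitP; exists w, [::]; split=> //=; apply: far_adj.
case/andP: p' => dz p'; apply/hitP; exists w, (rev (z :: s')); split=> //=.
- by rewrite lastI rev_rcons /= adj_sym lw path_rev_adj.
- rewrite all_rev; apply/allP => t ts.
  have /andP[xt tU] : x t && (t \in U) by apply: a; rewrite -rcons_cons mem_rcons inE ts orbT.
  by rewrite xt !inE tU andbT /=; apply: contraNneq ws' => <-.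
- by rewrite rev_cons last_rcons; apply: far_adj.
Qed.

Lemma perc_far_union p U D (W : {fset Z2}) r (c : R) : 0 <= p <= 1 ->
  (forall w d, w \in W -> D d -> d \notin ball w r.+1) ->
  (forall w, w \in W -> perc p (U `\ w) (pred1 w) (far w r) <= c) ->
  perc p U D (fun z => z \in W) <= #|` W|%:R * c.
Proof.
move=> p01 DW farc.
apply: le_trans (_ : \sum_(w <- W) perc p (U `\ w) (pred1 w) (far w r) <= _); last first.
  rewrite big_seq; apply: le_trans (ler_sum _ farc) _.
  by rewrite -big_seq big_const_seq count_predT iter_addr_0 mulr_natl.
apply: le_trans (_ : wsum (bern p) U (fun x => \sum_(w <- W)
  (hit x (U `\ w) (pred1 w) (far w r))%:R) (fun=> false) <= _).
  apply: le_wsum => [a|x _]; first exact: bern_ge0.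
  case: (boolP (hit x U D _)) => [/(hit_far DW)[w wW hw]|_]; last exact: sumr_ge0.
  by rewrite (big_fsetD1 _ wW) /= hw lerDl; apply: sumr_ge0.
rewrite wsum_sum; apply: ler_sum => w _.
by rewrite (wsum_restrict _ (bern_sum p) (fsubD1set U w)) // => x x' /hit_agree ->.
Qed.

End Percolation.

(** * Uniform measures on admissible patterns *)

Section Counting.
Context {R : realType} {A : finType} (E1 E2 : {set A * A}).
Implicit Types (V U W S T : {fset Z2}) (x y z : Z2 -> A) (u v : Z2) (a b : A).

Definition okat x u : bool :=
  [&& (x u, x (u + e1)) \in E1, (x (u - e1), x u) \in E1,
      (x u, x (u + e2)) \in E2 & (x (u - e2), x u) \in E2].

Definition adm V x : bool := all (okat x) V.

Lemma adj_e1 u : adj u (u + e1). Proof. by rewrite /adj /= ?opprD ?addrA ?subrr ?sub0r. Qed.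
Lemma adj_e2 u : adj u (u + e2). Proof. by rewrite /adj /= ?opprD ?addrA ?subrr ?sub0r. Qed.
Lemma adj_e1N u : adj u (u - e1). Proof. by rewrite adj_sym -{2}[u](subrK e1) adj_e1. Qed.
Lemma adj_e2N u : adj u (u - e2). Proof. by rewrite adj_sym -{2}[u](subrK e2) adj_e2. Qed.

Lemma okat_agree x x' u : x u = x' u -> (forall w, adj u w -> x w = x' w) ->
  okat x u = okat x' u.
Proof.
by move=> xu xw; rewrite /okat xu !xw ?adj_e1 ?adj_e2 ?adj_e1N ?adj_e2N.
Qed.

Lemma adm_agree V x x' : agree V x x' -> agree (boundary V) x x' -> adm V x = adm V x'.
Proof.
move=> xV xB; apply: eq_in_all => u uV; apply: okat_agree => [|w uw]; first exact: xV.
have [wV|wV] := boolP (w \in V); first exact: xV.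
by apply: xB; apply/in_boundary; split=> //; exists u.
Qed.

Lemma admP V x : reflect (forall u, u \in V -> okat x u) (adm V x).
Proof. exact: allP. Qed.

Definition resat U x u : bool :=
  [&& (u + e1 \in U) || ((x u, x (u + e1)) \in E1),
      (u - e1 \in U) || ((x (u - e1), x u) \in E1),
      (u + e2 \in U) || ((x u, x (u + e2)) \in E2) &
      (u - e2 \in U) || ((x (u - e2), x u) \in E2)].

(** The constraints of the edges that touch [V] but not [U]. *)
Definition rest V U x : bool := all (resat U x) (V `\` U).

Lemma adm_split U V x : U `<=` V -> adm V x = adm U x && rest V U x.
Proof.
move=> UV; apply/idP/andP => [/admP xV|[/admP xU /allP xr]].
  split; first by apply/admP => u /(fsubsetP UV); apply: xV.
  apply/allP => u; rewrite inE => /andP[_ /xV /and4P[h1 h2 h3 h4]].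
  by rewrite /resat h1 h2 h3 h4 !orbT.
apply/admP => u uV; have [uU|uU] := boolP (u \in U); first exact: xU.
have : u \in V `\` U by rewrite inE uU uV.
case/xr/and4P => h1 h2 h3 h4; apply/and4P; split.
- by case/orP: h1 => // /xU /and4P[_]; rewrite addrK.
- by case/orP: h2 => // /xU /and4P[]; rewrite subrK.
- by case/orP: h3 => // /xU /and4P[_ _ _]; rewrite addrK.
- by case/orP: h4 => // /xU /and4P[_ _]; rewrite subrK.
Qed.

Lemma rest_agree V U x x' : agree_off U x x' -> rest V U x = rest V U x'.
Proof.
move=> xx'; apply: eq_in_all => u; rewrite inE => /andP[uU uV].
rewrite /resat (xx' u uU).
by congr [&& _, _, _ & _]; case: (boolP (_ \in U)) => //= h; rewrite (xx' _ h).
Qed.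

Definition one : A -> R := fun=> 1.

Definition Zc V (f : (Z2 -> A) -> R) y : R :=
  wsum one V (fun x => (adm V x)%:R * f x) y.

Definition Zn V y : R := Zc V (fun=> 1) y.

Definition Ex V y (f : (Z2 -> A) -> R) : R := Zc V f y / Zn V y.

Lemma ExE V y f : Ex V y f = Zc V f y / Zn V y. Proof. by []. Qed.

Lemma one_ge0 a : 0 <= one a. Proof. exact: ler01. Qed.

Lemma Zc_split U V f y : U `<=` V ->
  Zc V f y = wsum one (V `\` U) (fun x => (rest V U x)%:R * Zc U f x) y.
Proof.
move=> UV; rewrite /Zc (wsum_sub _ _ _ UV); apply: eq_wsum => x _.
rewrite -wsumZ; apply: eq_wsum => z zx; rewrite (adm_split _ UV).
by rewrite (rest_agree _ zx) -mulnb natrM; ring.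
Qed.

Lemma wsum_one_ge V f y x : (forall z, 0 <= f z) -> agree_off V x y -> f x <= wsum one V f y.
Proof.
move=> f0 xy; rewrite /wsum (bigD1 (restr V x)) //= glue_restr // big1 // mul1r lerDl.
by apply: sumr_ge0 => w _; apply: mulr_ge0 => //; apply: prodr_ge0.
Qed.

Lemma Zn_ge0 V y : 0 <= Zn V y.
Proof. by apply: wsum_ge0 => // x _; rewrite mulr1. Qed.

Context (A' : {set A}) (safeA' : forall a, a \in A' -> safe_symbol E1 E2 a).

Lemma okat_safe x u : x u \in A' -> okat x u.
Proof.
move=> /safeA' sx; apply/and4P.
have [? _ ? _] := sx (x (u + e1)); have [_ ? _ ?] := sx (x (u - e1)).
have [_ _ ? _] := sx (x (u + e2)); have [_ _ _ ?] := sx (x (u - e2)).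
by split.
Qed.

Context (a0 : A) (a0A' : a0 \in A').

Definition fillS V y : Z2 -> A := fun u => if u \in V then a0 else y u.

Lemma fillS_off V y : agree_off V (fillS V y) y.
Proof. by move=> u uV; rewrite /fillS (negbTE uV). Qed.

Lemma Zn_ge1 V y : 1 <= Zn V y.
Proof.
have := wsum_one_ge (f := fun x => (adm V x)%:R * 1) _ (@fillS_off V y).
rewrite (_ : adm V (fillS V y)) ?mulr1; first by apply=> z; rewrite mulr1.
by apply/admP => u uV; apply: okat_safe; rewrite /fillS uV.
Qed.

Lemma Zn_gt0 V y : 0 < Zn V y. Proof. exact: lt_le_trans (Zn_ge1 V y). Qed.

Lemma Zc_Ex V y f : Zc V f y = Zn V y * Ex V y f.
Proof. by rewrite /Ex mulrCA mulfV ?mulr1 // gt_eqF // Zn_gt0. Qed.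

Lemma Ex_le U V y f c : U `<=` V ->
  (forall x, agree_off (V `\` U) x y -> Ex U x f <= c) -> Ex V y f <= c.
Proof.
move=> UV h; rewrite ler_pdivrMr ?Zn_gt0 // /Zn !(Zc_split _ _ UV) -wsumZ.
apply: le_wsum => [a|x xy]; first exact: one_ge0.
rewrite Zc_Ex -/(Zn U x) [leRHS]mulrCA; apply: ler_wpM2l; first exact: ler0n.
by rewrite mulrC ler_wpM2r ?Zn_ge0 // h.
Qed.

Lemma ExN V y f : Ex V y (fun x => - f x) = - Ex V y f.
Proof.
rewrite /Ex -mulNr; congr (_ / _); rewrite /Zc -mulN1r -wsumZ.
by apply: eq_wsum => x _; rewrite mulN1r mulrN.
Qed.

Lemma Ex_ge U V y f c : U `<=` V ->
  (forall x, agree_off (V `\` U) x y -> c <= Ex U x f) -> c <= Ex V y f.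
Proof.
move=> UV h; rewrite -lerN2 -ExN; apply: (Ex_le UV) => x xy.
by rewrite ExN lerN2 h.
Qed.

Lemma Ex_dist U V y f c e : U `<=` V ->
  (forall x, agree_off (V `\` U) x y -> `|Ex U x f - c| <= e) -> `|Ex V y f - c| <= e.
Proof.
move=> UV h; rewrite ler_distl; apply/andP; split.
  by apply: (Ex_ge UV) => x /h; rewrite ler_distl => /andP[].
by apply: (Ex_le UV) => x /h; rewrite ler_distl => /andP[].
Qed.

Definition letter_at v a : (Z2 -> A) -> R := fun x => (x v == a)%:R.

Lemma Ex_cond V y f v : v \in V ->
  Ex V y f = \sum_a Ex V y (letter_at v a) * Ex (V `\ v) (upd y v a) f.
Proof.
move=> vV; have VV : V `\ v `<=` V by exact: fsubD1set.
have Vv : V `\` (V `\ v) = [fset v] by rewrite fsetDDr fsetDv fset0U (fsetIidPr _) // fsub1set.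
have ZE g : Zc V g y = \sum_a (rest V (V `\ v) (upd y v a))%:R * Zc (V `\ v) g (upd y v a).
  by rewrite (Zc_split _ _ VV) Vv wsum1; apply: eq_bigr => a _; rewrite mul1r.
rewrite {1}/Ex ZE mulr_suml; apply: eq_bigr => a _.
rewrite {1}/Ex ZE (bigD1 a) //= [X in _ + X]big1 ?addr0 => [|b ba].
  have -> : Zc (V `\ v) (letter_at v a) (upd y v a) = Zn (V `\ v) (upd y v a).
    apply: eq_wsum => x xy; congr (_ * _).
    by rewrite /letter_at xy ?updE ?eqxx // !inE eqxx.
  by rewrite Zc_Ex; ring.
rewrite (_ : Zc _ _ _ = 0) ?mulr0 // -[RHS](mul0r (Zc (V `\ v) (letter_at v a) (upd y v b))).
rewrite -wsumZ; apply: eq_wsum => x xy.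
by rewrite /letter_at xy ?updE ?(negbTE ba) ?mulr0 ?mul0r // !inE eqxx.
Qed.

Lemma Ex_bound V y f l h : (forall x, l <= f x <= h) -> l <= Ex V y f <= h.
Proof.
move=> lh; rewrite /Ex ler_pdivlMr ?Zn_gt0 // ler_pdivrMr ?Zn_gt0 // /Zn -!wsumZ.
apply/andP; split; apply: le_wsum => [a|x _]; rewrite ?one_ge0 // mulr1.
  by rewrite [leLHS]mulrC; apply: ler_wpM2l => //; have /andP[] := lh x.
by rewrite [leRHS]mulrC; apply: ler_wpM2l => //; have /andP[] := lh x.
Qed.

Lemma Ex_sum V y (I : Type) (r : seq I) (P : pred I) (F : I -> (Z2 -> A) -> R) :
  Ex V y (fun x => \sum_(i <- r | P i) F i x) = \sum_(i <- r | P i) Ex V y (F i).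
Proof.
rewrite /Ex -mulr_suml -wsum_sum; congr (_ / _); apply: eq_wsum => x _.
by rewrite mulr_sumr.
Qed.

Lemma eq_Ex V y f g : (forall x, agree_off V x y -> f x = g x) -> Ex V y f = Ex V y g.
Proof. by move=> fg; congr (_ / _); apply: eq_wsum => x /fg ->. Qed.

Lemma Ex_const V y (c : R) : Ex V y (fun=> c) = c.
Proof.
have /andP[? ?] : c <= Ex V y (fun=> c) <= c by apply: Ex_bound => x; rewrite lexx.
by apply/eqP; rewrite eq_le; apply/andP.
Qed.

Lemma sum_letter_at V y v : \sum_a Ex V y (letter_at v a) = 1.
Proof.
rewrite -Ex_sum -[RHS](Ex_const V y); apply: eq_Ex => x _.
rewrite (bigD1 (x v)) //= big1 => [|a ax]; first by rewrite /letter_at eqxx addr0.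
by rewrite /letter_at eq_sym (negbTE ax).
Qed.

Lemma wsum_one_card V y : wsum one V (fun=> 1) y = #|A|%:R ^+ #|` V|.
Proof.
rewrite /wsum; under eq_bigr do rewrite mulr1 big1 //.
by rewrite sumr_const card_ffun -cardfE natrX.
Qed.

Lemma Zn_le V y : Zn V y <= #|A|%:R ^+ #|` V|.
Proof.
rewrite -(wsum_one_card V y); apply: le_wsum => [a|x _]; first exact: one_ge0.
by rewrite mulr1 lern1 leq_b1.
Qed.

Lemma letter_at_ge V y v a : a \in A' -> v \in V -> #|A|%:R^-1 <= Ex V y (letter_at v a).
Proof.
move=> aA' vV; apply: (@Ex_ge [fset v]) => [|x _]; first by rewrite fsub1set.
have q0 : (0 : R) < #|A|%:R by rewrite ltr0n; apply/card_gt0P; exists a.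
have := Zn_le [fset v] x; rewrite cardfs1 expr1 => Zq.
rewrite ler_pdivlMr ?Zn_gt0 // ler_pdivrMl // mulrC mulrC.
apply: le_trans Zq _; rewrite -[leLHS]mulr1; apply: ler_wpM2l; first exact: ltW.
pose F z : R := (adm [fset v] z)%:R * letter_at v a z.
have F0 z : 0 <= F z by rewrite mulr_ge0.
have ux : agree_off [fset v] (upd x v a) x by move=> u; rewrite inE => uv; rewrite upd_neq.
apply: le_trans (wsum_one_ge F0 ux); rewrite /F /letter_at updE eqxx mulr1.
rewrite (_ : adm [fset v] _) //; apply/admP => u; rewrite inE => /eqP ->.
by apply: okat_safe; rewrite updE.
Qed.

End Counting.

Lemma coupling_bound (R : realType) (I : finType) (al be e e' : I -> R) (G0 G1 p : R) :
  (forall i, 0 <= al i) -> (forall i, 0 <= be i) ->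
  \sum_i al i = 1 -> \sum_i be i = 1 ->
  (forall i, `|e i - e' i| <= G0) -> (forall i j, `|e i - e' j| <= G1) -> G0 <= G1 ->
  1 - \sum_i Num.min (al i) (be i) <= p ->
  `|\sum_i al i * e i - \sum_i be i * e' i| <= (1 - p) * G0 + p * G1.
Proof.
move=> al0 be0 al1 be1 h0 h1 G01.
pose m i := Num.min (al i) (be i); rewrite -/m; set t := 1 - _ => tp.
have ma i : 0 <= al i - m i by rewrite subr_ge0 /m ge_min lexx.
have mb i : 0 <= be i - m i by rewrite subr_ge0 /m ge_min lexx orbT.
have m0 i : 0 <= m i by rewrite /m le_min al0 be0.
have sa : \sum_i (al i - m i) = t by rewrite sumrB al1.
have sb : \sum_i (be i - m i) = t by rewrite sumrB be1.
have t0 : 0 <= t by rewrite -sa; apply: sumr_ge0.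
pose X := \sum_i (al i - m i) * e i - \sum_i (be i - m i) * e' i.
have -> : \sum_i al i * e i - \sum_i be i * e' i = \sum_i m i * (e i - e' i) + X.
  rewrite /X -!sumrB -big_split /=; apply: eq_bigr => i _; ring.
have tX : `|t * X| <= t * (t * G1).
  have -> : t * X = \sum_i \sum_j (al i - m i) * ((be j - m j) * (e i - e' j)).
    under eq_bigr do rewrite -mulr_sumr.
    under eq_bigr => i _.
      under eq_bigr do rewrite mulrBr.
      rewrite sumrB -mulr_suml sb mulrBr; over.
    rewrite sumrB -mulr_suml sa mulrBr; congr (_ - _).
    by rewrite mulr_sumr; apply: eq_bigr => i _; ring.
  apply: le_trans (ler_norm_sum _ _ _) _.
  rewrite -{1}sa mulr_suml; apply: ler_sum => i _.
  apply: le_trans (ler_norm_sum _ _ _) _.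
  rewrite -sb mulr_suml mulr_sumr; apply: ler_sum => j _.
  rewrite !normrM (ger0_norm (ma i)) (ger0_norm (mb j)).
  by apply: ler_wpM2l => //; apply: ler_wpM2l.
have Xt : `|X| <= t * G1.
  have [t_eq0|t_neq0] := eqVneq t 0; last first.
    have tgt0 : 0 < t by rewrite lt_def t_neq0.
    by rewrite normrM ger0_norm // ler_pM2l in tX.
  have z (c : I -> R) (g : I -> R) : (forall i, 0 <= c i) -> \sum_i c i = t -> \sum_i c i * g i = 0.
    move=> c0; rewrite t_eq0 => /eqP; rewrite psumr_eq0 // => /allP c00.
    by apply: big1 => i _; rewrite (eqP (c00 i (mem_index_enum i))) mul0r.
  by rewrite /X !z // subrr normr0 t_eq0 mul0r.
apply: le_trans (ler_normD _ _) _.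
apply: le_trans (_ : (1 - t) * G0 + t * G1 <= _); last by nra.
apply: lerD => //; apply: le_trans (ler_norm_sum _ _ _) _.
have -> : 1 - t = \sum_i m i by rewrite /t; lra.
rewrite mulr_suml; apply: ler_sum => i _.
by rewrite normrM (ger0_norm (m0 i)); apply: ler_wpM2l.
Qed.

Section Mixing.
Context {R : realType} {A : finType} (E1 E2 : {set A * A}).
Context (A' : {set A}) (safeA' : forall a, a \in A' -> safe_symbol E1 E2 a).
Context (a0 : A) (a0A' : a0 \in A').
Implicit Types (V U W S T : {fset Z2}) (x y z : Z2 -> A) (u v : Z2) (a b : A).
Local Notation Ex := (@Ex R A E1 E2).

Definition depends_on (W : pred Z2) (f : (Z2 -> A) -> R) :=
  forall x x', (forall u, W u -> x u = x' u) -> f x = f x'.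

(** Disagreement percolation: explore the sites next to the disagreement set
   one at a time, coupling the two conditional laws of each letter optimally. *)
Lemma disagreement (p : R) V y y' (D W : pred Z2) (f : (Z2 -> A) -> R) :
  0 <= p <= 1 -> 1 - #|A'|%:R / #|A|%:R <= p ->
  (forall u, u \notin V -> y u != y' u -> D u) ->
  depends_on W f -> (forall x, 0 <= f x <= 1) ->
  `|Ex V y f - Ex V y' f| <= perc p V D W.
Proof.
move=> p01 qp yD fW f01.
have [n] := ubnP #|`V|; elim: n V y y' D yD => // n IH V y y' D yD; rewrite ltnS => Vn.
have [[d Dd Wd]|DW] := pselect (exists2 d, D d & W d).
  rewrite (perc_trivial _ _ Dd Wd) ler_distl.
  have /andP[l1 h1] := Ex_bound safeA' a0A' V y f01.
  have /andP[l2 h2] := Ex_bound safeA' a0A' V y' f01.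
  by rewrite lerBlDr; apply/andP; split; lra.
have [[v vV [u Du uv]]|st] := pselect (exists2 v, v \in V & exists2 u, D u & adj u v).
  rewrite (perc_explore _ _ vV Du uv) !(Ex_cond safeA' a0A' _ _ vV).
  have V'n : (#|` V `\ v| < n)%N by apply: leq_trans Vn; rewrite (cardfsD1 v V) vV.
  have Vv u0 : (u0 \notin V `\ v) -> u0 != v -> u0 \notin V.
    by rewrite !inE negb_and negbK => /orP[->|].
  have l01 x0 a : 0 <= (letter_at v a x0 : R) <= 1 by rewrite /letter_at ler0n lern1 leq_b1.
  apply: coupling_bound.
  - by move=> a; have /andP[] := Ex_bound safeA' a0A' V y (fun x => l01 x a).
  - by move=> a; have /andP[] := Ex_bound safeA' a0A' V y' (fun x => l01 x a).
  - exact: (sum_letter_at safeA' a0A').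
  - exact: (sum_letter_at safeA' a0A').
  - move=> a; apply: IH => // u0 uV; have [->|uv0] := eqVneq u0 v; first by rewrite !updE eqxx.
    by rewrite !upd_neq //; apply: yD; apply: Vv.
  - move=> a b; apply: IH => // u0 uV; rewrite /addp; have [->//|uv0] := eqVneq u0 v.
    by rewrite !upd_neq //= => /yD -> //; apply: Vv.
  - by apply: perc_mono_start => // u0; apply: addp_sub.
  apply: le_trans qp; rewrite lerD2l lerN2.
  apply: le_trans (_ : \sum_(a in A') #|A|%:R^-1 <= _).
    by rewrite sumr_const -[X in _ <= X]mulr_natl.
  rewrite big_mkcond; apply: ler_sum => a _; case: ifP => aA'.
    by rewrite le_min !(letter_at_ge safeA' a0A').
  by rewrite le_min; have /andP[-> _] := Ex_bound safeA' a0A' V y (fun x => l01 x a);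
     have /andP[-> _] := Ex_bound safeA' a0A' V y' (fun x => l01 x a).
have {}st u v : D u -> adj u v -> v \notin V.
  by move=> Du uv; apply/negP => vV; apply: st; exists v => //; exists u.
have {}yD u : ~~ D u -> u \notin V -> y u = y' u.
  by move=> nD uV; apply/eqP; apply: contraNT nD; apply: yD.
rewrite (_ : Ex V y f = Ex V y' f) ?subrr ?normr0 ?perc_ge0 //.
have E (w : {ffun V -> A}) u : u \in V -> glue w y u = glue w y' u.
  by move=> uV; rewrite -[u]/(val [` uV]) !glueE.
have aE (w : {ffun V -> A}) : adm E1 E2 V (glue w y) = adm E1 E2 V (glue w y').
  apply: adm_agree => u; first exact: E.
  move=> /in_boundary[uV [v vV vu]]; rewrite !glue_off //; apply: yD => //.
  by apply/negP => Du; have := st u v Du; rewrite adj_sym vV => /(_ vu).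
have fE (w : {ffun V -> A}) : f (glue w y) = f (glue w y').
  apply: fW => u Wu; have [uV|uV] := boolP (u \in V); first exact: E.
  by rewrite !glue_off //; apply: yD => //; apply/negP => Du; apply: DW; exists u.
by congr (_ / _); apply: eq_wsum2 => w; rewrite aE ?fE.
Qed.

(** Both sides are mixtures of conditional laws in [U]; the two boundary
   conditions can only differ outside [B]. *)
Lemma mixing (p : R) U V V' y y' (B W : pred Z2) (f : (Z2 -> A) -> R) :
  0 <= p <= 1 -> 1 - #|A'|%:R / #|A|%:R <= p ->
  U `<=` V -> U `<=` V' ->
  (forall u, B u -> u \in V -> u \in U) -> (forall u, B u -> u \in V' -> u \in U) ->
  (forall u, B u -> u \notin U -> y u = y' u) ->
  depends_on W f -> (forall x, 0 <= f x <= 1) ->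
  `|Ex V y f - Ex V' y' f| <= perc p U (fun u => ~~ B u) W.
Proof.
move=> p01 qp UV UV' BV BV' yy' fW f01.
apply: (Ex_dist safeA' a0A' UV) => x xy; rewrite distrC.
apply: (Ex_dist safeA' a0A' UV') => x' xy'.
apply: disagreement => // u uU; apply: contra => Bu.
rewrite xy'; last by rewrite inE negb_and; apply/orP; right; apply: contra uU; apply: BV'.
rewrite xy; last by rewrite inE negb_and; apply/orP; right; apply: contra uU; apply: BV.
by rewrite yy'.
Qed.

End Mixing.

(** * Growth rate *)

Section Translation.
Context {R : realType} {A : finType} (E1 E2 : {set A * A}).

Lemma okat_shift (v u : Z2) (x : Z2 -> A) :
  okat E1 E2 (shift v x) u = okat E1 E2 x (u + v).
Proof. by rewrite /okat /shift ![u + _ + v]addrAC. Qed.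

Lemma adm_shift (v : Z2) (V : {fset Z2}) (x : Z2 -> A) :
  adm E1 E2 (trans v V) x = adm E1 E2 V (shift v x).
Proof.
apply/admP/admP => h u uV; first by rewrite okat_shift h // in_trans addrK.
by rewrite -[u](subrK v) -okat_shift h // -in_trans.
Qed.

Lemma shiftK (v : Z2) (x : Z2 -> A) : shift v (shift (- v) x) = x.
Proof. by apply/funext => u; rewrite /shift addrK. Qed.

Lemma Zc_trans (v : Z2) (V : {fset Z2}) f (y : Z2 -> A) :
  Zc E1 E2 (trans v V) f y = Zc E1 E2 V (fun x => f (shift (- v) x) : R) (shift v y).
Proof. by rewrite /Zc wsum_trans; apply: eq_wsum => x _; rewrite adm_shift shiftK. Qed.

End Translation.

Definition site (w s : nat) : Z2 := ((s %% w)%:Z, (s %/ w)%:Z).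

Definition reg (w t : nat) : {fset Z2} := [fset site w s | s in iota 0 t].

Lemma regP w t u : reflect (exists2 s, (s < t)%N & u = site w s) (u \in reg w t).
Proof.
apply: (iffP (imfsetP _ _ _ _)) => -[s /= st ->]; exists s => //;
  by move: st; rewrite mem_iota.
Qed.

Lemma in_reg w t (u : Z2) : (0 < w)%N ->
  (u \in reg w t) = [&& 0 <= u.1, u.1 < w%:Z, 0 <= u.2 & u.2 * w%:Z + u.1 < t%:Z].
Proof.
move=> w0; apply/regP/idP => [[s st ->]|].
  rewrite /site; apply/and4P; split=> //=.
    by rewrite ltz_nat ltn_mod.
  by rewrite -PoszM -PoszD -divn_eq ltz_nat.
case: u => -[i|i] [j|j] /and4P[//= _ iw // _ jt].
  rewrite -PoszM -PoszD ltz_nat in jt; rewrite ltz_nat in iw.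
  exists (j * w + i)%N => //; rewrite /site.
  by rewrite modnMDl modn_small // divnMDl // divn_small // addn0.
Qed.

Lemma site_notin w t : (0 < w)%N -> site w t \notin reg w t.
Proof.
by move=> w0; rewrite in_reg // /site /= -PoszM -PoszD -divn_eq ltxx !andbF.
Qed.

Lemma regS w t : reg w t.+1 = site w t |` reg w t.
Proof.
apply/fsetP => u; rewrite in_fset1U; apply/regP/orP => [[s + ->]|].
  rewrite ltnS leq_eqVlt => /orP[/eqP ->|st]; first by left.
  by right; apply/regP; exists s.
case=> [/eqP ->|/regP[s st ->]]; first by exists t.
by exists s => //; apply: ltnW.
Qed.

Lemma reg0 w : reg w 0 = fset0.
Proof. by apply/fsetP => u; rewrite inE; apply/imfsetP => -[]. Qed.

Lemma box_reg j1 j2 : (0 < j1)%N -> box j1 j2 = trans (1, 1) (reg j1 (j1 * j2)).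
Proof.
move=> j0; apply/fsetP => u; rewrite in_trans in_reg // in_box; case: u => a b /=.
rewrite PoszM; apply/idP/idP => [/andP[/andP[? ?] /andP[? ?]]|/and4P[? ? ? ?]].
  by apply/and4P; split; nia.
by apply/andP; split; nia.
Qed.

Lemma lex_int (a b : int) (n : nat) : - n%:Z < a < n%:Z ->
  (b * n%:Z + a <= 0) = (b < 0) || ((b == 0) && (a <= 0)).
Proof.
move=> /andP[an na]; have [b0|b0|->] := ltgtP b 0; last by rewrite mul0r add0r.
  have h : b * n%:Z <= - n%:Z by rewrite -mulN1r ler_wpM2r //; lia.
  by rewrite -(addNr n%:Z) lerD // ltW.
have h : n%:Z <= b * n%:Z by rewrite -{1}[n%:Z]mul1r ler_wpM2r //; lia.
by rewrite leNgt -(addrN n%:Z) ler_ltD.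
Qed.

Lemma real_limit (R : realType) (s e : nat -> R) :
  (forall m n, (m <= n)%N -> `|s n - s m| <= e m) ->
  exists l, forall m, `|s m - l| <= e m.
Proof.
move=> se.
have key m n : s m - e m <= s n + e n.
  have [mn|/ltnW nm] := leqP m n.
    by have := se _ _ mn; have := se n n (leqnn n); rewrite !ler_norml subrr; lra.
  by have := se _ _ nm; have := se m m (leqnn m); rewrite !ler_norml subrr; lra.
pose S := [set s m - e m | m in [set: nat]].
have S0 : S !=set0 by exists (s 0%N - e 0%N); exists 0%N.
have ubS n : ubound S (s n + e n) by move=> _ [m _ <-]; apply: key.
exists (sup S) => m; rewrite distrC ler_distl; apply/andP; split.
  by apply: ub_le_sup; [exists (s 0%N + e 0%N) | exists m].
exact: ge_sup.
Qed.

Lemma geometric_small (R : realType) (r e : R) : 0 <= r < 1 -> 0 < e ->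
  exists m, forall n, (m <= n)%N -> r ^+ n <= e.
Proof.
move=> /andP[r0 r1] e0.
have : (fun n => r ^+ n) @ \oo --> (0 : R) by apply: cvg_expr; rewrite ger0_norm.
move/cvgrPdist_le => /(_ e e0) [m _ mP]; exists m => n mn.
by have := mP n mn; rewrite /= sub0r normrN ger0_norm // exprn_ge0.
Qed.

Section Growth.
Context {R : realType} {A : finType} (E1 E2 : {set A * A}).
Context (A' : {set A}) (safeA' : forall a, a \in A' -> safe_symbol E1 E2 a).
Context (a0 : A) (a0A' : a0 \in A').
Context (p rho C : R) (p01 : 0 <= p <= 1) (qp : 1 - #|A'|%:R / #|A|%:R <= p).
Context (rho01 : 0 < rho < 1) (C1 : 1 <= C).
Context (decay : forall (V : {fset Z2}) u r, u \notin V ->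
  perc p V (pred1 u) (far u r) <= C * rho ^+ r).
Implicit Types (V U W S T : {fset Z2}) (x y z : Z2 -> A) (u v : Z2).
Local Notation Ex := (@Ex R A E1 E2).

Lemma mixing_decay V V' y y' (B W : {fset Z2}) r (f : (Z2 -> A) -> R) :
  (forall w, w \in W -> ball w r.+1 `<=` B) ->
  (forall u, u \in B -> (u \in V) = (u \in V')) ->
  (forall u, u \in B -> u \notin V -> y u = y' u) ->
  depends_on (fun u => u \in W) f -> (forall x, 0 <= f x <= 1) ->
  `|Ex V y f - Ex V' y' f| <= #|` W|%:R * (C * rho ^+ r).
Proof.
move=> WB BV yy' fW f01.
have VB u : u \in B -> (u \in V `&` B) = (u \in V) by rewrite inE => ->; rewrite andbT.
apply: (le_trans (mixing (U := V `&` B) (B := fun u => u \in B) safeA' a0A' p01 qp _ _ _ _ _ fW f01)).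
- exact: fsubsetIl.
- by apply/fsubsetP => u; rewrite inE => /andP[uV uB]; rewrite -BV.
- by move=> u uB uV; rewrite VB.
- by move=> u uB uV; rewrite VB // BV.
- by move=> u uB; rewrite VB //; apply: yy'.
apply: perc_far_union => // [w d wW|w _]; last by apply: decay; rewrite !inE eqxx.
by apply: contra; apply/fsubsetP/WB.
Qed.

Definition free : Z2 -> A := fun=> a0.

Definition Nf V : R := Zn E1 E2 V free.

Lemma Nf_trans v V : Nf (trans v V) = Nf V.
Proof. exact: Zc_trans. Qed.

Lemma Nf_ge1 V : 1 <= Nf V. Proof. exact: (Zn_ge1 safeA' a0A'). Qed.
Lemma Nf_gt0 V : 0 < Nf V. Proof. exact: lt_le_trans (Nf_ge1 V). Qed.

Lemma Nf_ratio V v : v \in V -> Nf (V `\ v) / Nf V = Ex V free (letter_at v a0).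
Proof.
move=> vV; rewrite !ExE; congr (_ / _).
have VV : V `\ v `<=` V by exact: fsubD1set.
have Vv : V `\` (V `\ v) = [fset v] by rewrite fsetDDr fsetDv fset0U (fsetIidPr _) // fsub1set.
rewrite (Zc_split _ _ _ _ VV) Vv wsum1 (bigD1 a0) //= big1 ?addr0 => [|b ba]; last first.
  rewrite (_ : Zc _ _ _ _ _ = 0) ?mulr0 // -[RHS](mul0r (Zc E1 E2 (V `\ v) (letter_at v a0) (upd free v b))).
  rewrite -wsumZ; apply: eq_wsum => x xy.
  by rewrite /letter_at xy ?updE ?(negbTE ba) ?mulr0 ?mul0r // !inE eqxx.
have -> : upd free v a0 = free by exact: upd_id.
rewrite mul1r (_ : rest _ _ _ _ _) ?mul1r.
  apply: eq_wsum => x xy; congr (_ * _).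
  by rewrite /letter_at xy ?eqxx // !inE eqxx.
apply/allP => u _; rewrite /resat /free.
by have [-> _ -> _] := safeA' a0A' a0; rewrite !orbT.
Qed.

Lemma ratio_local V V' v m : v \in V ->
  (forall u, u \in ball v m.+1 -> (u \in V) = (u \in V')) ->
  `|Nf (V `\ v) / Nf V - Nf (V' `\ v) / Nf V'| <= C * rho ^+ m.
Proof.
move=> vV VV'; have vV' : v \in V' by rewrite -VV' // ball_center.
rewrite !Nf_ratio //; have := @mixing_decay V V' free free (ball v m.+1) [fset v] m (letter_at v a0).
rewrite cardfs1 mul1r; apply=> // [w|x x' xx'|x].
- by rewrite inE => /eqP ->.
- by rewrite /letter_at xx' // inE.
- by rewrite /letter_at ler0n lern1 leq_b1.
Qed.

Definition ratio w t : R := Nf (reg w t) / Nf (reg w t.+1).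

Let q : R := #|A|%:R.

Lemma q_ge1 : 1 <= q.
Proof. by rewrite ler1n; apply/card_gt0P; exists a0. Qed.

Lemma ratioE w t : (0 < w)%N -> ratio w t = Nf (reg w t.+1 `\ site w t) / Nf (reg w t.+1).
Proof. by move=> w0; rewrite /ratio {2}regS fsetU1K // site_notin. Qed.

Lemma ratio_bounds w t : (0 < w)%N -> q^-1 <= ratio w t <= 1.
Proof.
move=> w0; have st : site w t \in reg w t.+1 by rewrite regS !inE eqxx.
rewrite ratioE // Nf_ratio // (letter_at_ge safeA' a0A') //=.
have l01 x : 0 <= (letter_at (site w t) a0 x : R) <= 1 by rewrite /letter_at ler0n lern1 leq_b1.
by have /andP[] := Ex_bound safeA' a0A' (reg w t.+1) free l01.
Qed.

Definition pi_ (m : nat) : R := ratio (2 * m.+1).+1 (m.+1 * (2 * m.+1).+1 + m.+1).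

Lemma ratio_pi w i j m : (m < i)%N -> (i + m.+1 < w)%N -> (m < j)%N ->
  `|ratio w (j * w + i) - pi_ m| <= C * rho ^+ m.
Proof.
move=> mi iw mj; have w0 : (0 < w)%N by lia.
set w' := (2 * m.+1).+1; set t' := (m.+1 * w' + m.+1)%N.
have si : site w (j * w + i) = (i%:Z, j%:Z).
  rewrite /site modnMDl modn_small; last lia.
  by rewrite divnMDl // divn_small ?addn0 //; lia.
have si' : site w' t' = (m.+1%:Z, m.+1%:Z).
  rewrite /site /t' modnMDl modn_small; last by rewrite /w'; lia.
  by rewrite divnMDl // divn_small ?addn0 // /w'; lia.
pose v : Z2 := (i%:Z - m.+1%:Z, j%:Z - m.+1%:Z).
have -> : pi_ m = Nf (trans v (reg w' t'.+1) `\ site w (j * w + i)) / Nf (trans v (reg w' t'.+1)).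
  rewrite /pi_ -/w' -/t' ratioE // Nf_trans -(Nf_trans v); congr (Nf _ / _).
  apply/fsetP => u; rewrite !(in_trans, inE); congr (~~ _ && _).
  by rewrite si si' subr_eq /v; congr (_ == (_, _)); rewrite addrC subrK.
rewrite ratioE //; apply: ratio_local; first by rewrite regS !inE eqxx.
move=> u; rewrite in_trans !in_reg // si in_ball /= !ler_norml => /andP[/andP[? ?] /andP[? ?]].
have E (x2 x1 : int) (y2 y1 : nat) (n : nat) :
    (x2 * n%:Z + x1 < (y2 * n + y1).+1%:Z) = ((x2 - y2%:Z) * n%:Z + (x1 - y1%:Z) <= 0).
  by rewrite mulrBl -addn1 !PoszD PoszM; apply/idP/idP => ?; lia.
rewrite !E !lex_int; [|rewrite /w'; apply/andP; split; lia|apply/andP; split; lia].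
have -> : u.2 - (j%:Z - m.+1%:Z) - m.+1%:Z = u.2 - j%:Z by lia.
have -> : u.1 - (i%:Z - m.+1%:Z) - m.+1%:Z = u.1 - i%:Z by lia.
by congr [&& _, _, _ & _]; rewrite /w'; apply/idP/idP => ?; lia.
Qed.

Lemma q_gt0 : 0 < q. Proof. exact: lt_le_trans q_ge1. Qed.

Lemma pi_bounds m : q^-1 <= pi_ m <= 1.
Proof. exact: ratio_bounds. Qed.

Lemma ln_lipschitz (x y : R) : q^-1 <= x -> q^-1 <= y -> `|ln x - ln y| <= q * `|x - y|.
Proof.
have key a b : q^-1 <= a -> q^-1 <= b -> ln a - ln b <= q * `|a - b|.
  move=> qa qb; have q0 : 0 < q^-1 by rewrite invr_gt0 q_gt0.
  have a0' : 0 < a by exact: lt_le_trans qa.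
  have b0 : 0 < b by exact: lt_le_trans qb.
  rewrite -ln_div ?posrE // (_ : a / b = 1 + (a - b) / b); last by field; lra.
  apply: le_trans (le_ln1Dx _) _.
    by rewrite -subr_gt0 opprK addrC (_ : 1 + _ = a / b) ?divr_gt0 //; field; lra.
  apply: le_trans (_ : `|a - b| / b <= _).
    by rewrite ler_pM2r ?invr_gt0 // ler_norm.
  by rewrite mulrC ler_wpM2r // -(invrK q) lef_pV2 ?posrE.
move=> qx qy; rewrite ler_norml; apply/andP; split; last exact: key.
by rewrite lerNl opprB distrC key.
Qed.

Lemma growth_exists : exists h : R, forall m, `|- ln (pi_ m) - h| <= q * C * rho ^+ m.
Proof.
apply: real_limit => m n mn; rewrite opprK addrC.
have /andP[q1 _] := pi_bounds m; have /andP[q2 _] := pi_bounds n.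
apply: le_trans (ln_lipschitz q1 q2) _; rewrite -mulrA ler_wpM2l ?(ltW q_gt0) // distrC.
by rewrite {1}/pi_; apply: ratio_pi; lia.
Qed.

Context (h : R) (hP : forall m, `|- ln (pi_ m) - h| <= q * C * rho ^+ m).

Lemma ln_ratio w i j m : (m < i)%N -> (i + m.+1 < w)%N -> (m < j)%N ->
  `|- ln (ratio w (j * w + i)) - h| <= 2 * (q * C * rho ^+ m).
Proof.
move=> mi iw mj; have w0 : (0 < w)%N by lia.
have /andP[q1 _] := pi_bounds m; have /andP[q2 _] := ratio_bounds (j * w + i) w0.
have -> : - ln (ratio w (j * w + i)) - h =
  (- ln (ratio w (j * w + i)) + ln (pi_ m)) + (- ln (pi_ m) - h) by ring.
apply: le_trans (ler_normD _ _) _.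
rewrite (_ : 2 * (q * C * rho ^+ m) = q * C * rho ^+ m + q * C * rho ^+ m); last ring.
apply: lerD; last exact: hP.
rewrite addrC; apply: le_trans (ln_lipschitz q1 q2) _.
by rewrite -mulrA ler_wpM2l ?(ltW q_gt0) // distrC ratio_pi.
Qed.

Lemma ln_ratio_crude w t : (0 < w)%N -> `|- ln (ratio w t) - h| <= ln q + `|h|.
Proof.
move=> w0; apply: le_trans (ler_normB _ _) _; rewrite lerD2r normrN.
have /andP[q1 q2] := ratio_bounds t w0.
have q0 : 0 < q^-1 by rewrite invr_gt0 q_gt0.
have r0 := lt_le_trans q0 q1.
have lq : ln q = - ln q^-1 by rewrite lnV ?posrE ?q_gt0 // opprK.
by rewrite ler0_norm ?ln_le0 // lq lerN2 ler_ln ?posrE.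
Qed.

Lemma ln_Nf_sum w (T : nat) : (0 < w)%N -> ln (Nf (reg w T)) = \sum_(t < T) - ln (ratio w t).
Proof.
move=> w0; elim: T => [|T IH]; last first.
  rewrite big_ord_recr /= -IH /ratio ln_div ?posrE ?Nf_gt0 //; ring.
by rewrite big_ord0 reg0 /Nf /Zn /Zc wsum0 mulr1 ln1.
Qed.

Lemma ln_Nf_rect m w l : (0 < w)%N ->
  `|ln (Nf (reg w (l * w))) - (l * w)%:R * h| <=
  (l * w)%:R * (2 * (q * C * rho ^+ m)) + (ln q + `|h|) * (m.+1 * w + 2 * m.+1 * l)%:R.
Proof.
move=> w0; rewrite ln_Nf_sum //.
have -> : \sum_(t < l * w) - ln (ratio w t) = \sum_(j < l) \sum_(i < w) - ln (ratio w (j * w + i)).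
  elim: l => [|l IHl]; first by rewrite !big_ord0.
  by rewrite big_ord_recr /= mulSn addnC big_split_ord /= IHl.
have -> : (l * w)%:R * h = \sum_(j < l) \sum_(i < w) h.
  by rewrite !sumr_const !card_ord -mulrnA mulr_natl mulnC.
rewrite -sumrB; under eq_bigr do rewrite -sumrB.
apply: le_trans (ler_norm_sum _ _ _) _.
pose b (i j : nat) : R := (j < m.+1)%:R + ((i < m.+1)%:R + (w <= i + m.+1)%:R).
have K0 : 0 <= ln q + `|h| by rewrite addr_ge0 // ln_ge0 // q_ge1.
have e0 : 0 <= 2 * (q * C * rho ^+ m).
  have /andP[r0 _] := rho01; have C0 : 0 <= C := le_trans ler01 C1.
  by rewrite !mulr_ge0 ?exprn_ge0 // ltW // q_gt0.
apply: le_trans (_ : \sum_(j < l) \sum_(i < w) (2 * (q * C * rho ^+ m) + (ln q + `|h|) * b i j) <= _).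
  apply: ler_sum => j _; apply: le_trans (ler_norm_sum _ _ _) _; apply: ler_sum => i _.
  have [/and3P[mi iw mj]|bad] := boolP [&& (m < i)%N, (i + m.+1 < w)%N & (m < j)%N].
    apply: le_trans (ln_ratio mi iw mj) _; rewrite lerDl; apply: mulr_ge0 => //.
    by rewrite /b !addr_ge0.
  apply: le_trans (ln_ratio_crude _ w0) _; rewrite -[leLHS]add0r; apply: lerD => //.
  rewrite -[leLHS]mulr1; apply: ler_wpM2l => //; rewrite /b -!natrD ler1n.
  by move: bad; rewrite !negb_and -!leqNgt !ltnS; case: (leqP j m); case: (leqP i m); case: (leqP w).
under eq_bigr do rewrite big_split -mulr_sumr /=.
rewrite big_split -mulr_sumr /= !sumr_const !card_ord; apply: lerD.
  by rewrite -mulrnA -[_ *+ (w * l)]mulr_natl mulrCA mulnC.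
under eq_bigr do rewrite -mulr_sumr.
rewrite -mulr_sumr; apply: ler_wpM2l => //; rewrite /b.
have c1 n M : (\sum_(i < n) (i < M) <= M)%N.
  suff : (\sum_(i < n) (i < M) <= minn n M)%N by move=> /leq_trans; apply; apply: geq_minr.
  elim: n => [|n IHn]; first by rewrite big_ord0.
  rewrite big_ord_recr /=; move: IHn; rewrite !leq_min.
  move: (\sum_(i < n) (i < M))%N => s /andP[? ?].
  by case: (ltnP n M) => /= ?; apply/andP; split; lia.
have c2 n M : (\sum_(i < n) (n <= i + M) <= M)%N.
  rewrite (reindex_inj rev_ord_inj) /=; apply: leq_trans (c1 n M); apply: leq_sum => i _.
  have := ltn_ord i; case: (leqP n _) => //= ?; case: (ltnP i M) => //= ?; lia.
under eq_bigr => j _ do under eq_bigr => i _ do rewrite -!natrD.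
under eq_bigr do rewrite -natr_sum.
rewrite -natr_sum ler_nat.
under eq_bigr do rewrite !big_split /= sum_nat_const card_ord.
rewrite big_split /= -big_distrr /= sum_nat_const card_ord [(m.+1 * w)%N]mulnC.
apply: leq_add; first by rewrite leq_mul ?c1.
by rewrite [leqRHS]mulnC leq_mul // mul2n -addnn leq_add ?c1 ?c2.
Qed.

Lemma ln_Nf_growth e : 0 < e -> exists L, forall w l, (L <= w)%N -> (L <= l)%N ->
  `|ln (Nf (reg w (w * l))) - (w * l)%:R * h| <= e * (w * l)%:R.
Proof.
move=> e0; have qC : 0 < q * C by rewrite mulr_gt0 ?q_gt0 // (lt_le_trans ltr01).
have [||m0 /(_ m0 (leqnn _))] := @geometric_small R rho (e / (4 * (q * C))).
  by case/andP: rho01 => /ltW -> ->.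
  by apply: divr_gt0 => //; lra.
rewrite ler_pdivlMr; last by lra.
move=> me; have {}me : 2 * (q * C * rho ^+ m0) <= e / 2 by lra.
pose K := ln q + `|h|.
have K0 : 0 <= K by rewrite addr_ge0 // ln_ge0 // q_ge1.
have M0 : (0 : R) < m0.+1%:R by rewrite ltr0n.
exists (Num.truncn (6 * K * m0.+1%:R / e)).+1 => w l Lw Ll.
have w0 : (0 < w)%N by apply: leq_trans Lw.
have KL n : ((Num.truncn (6 * K * m0.+1%:R / e)).+1 <= n)%N -> 6 * K * m0.+1%:R <= e * n%:R.
  move=> nL; rewrite [leRHS]mulrC -ler_pdivrMr //; apply: le_trans (ltW (truncnS_gt _)) _.
  by rewrite ler_nat.
have := KL _ Lw; have := KL _ Ll => Kl Kw.
rewrite mulnC; apply: le_trans (ln_Nf_rect m0 l w0) _; rewrite -/K natrD !natrM.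
have lR : (0 : R) <= l%:R by []. have wR : (0 : R) <= w%:R by [].
have h1 : l%:R * w%:R * (2 * (q * C * rho ^+ m0)) <= l%:R * w%:R * (e / 2).
  by apply: ler_wpM2l => //; apply: mulr_ge0.
have h2 : 6 * K * m0.+1%:R * w%:R <= e * l%:R * w%:R by apply: ler_wpM2r.
have h3 : 6 * K * m0.+1%:R * l%:R <= e * w%:R * l%:R by apply: ler_wpM2r.
lra.
Qed.

Lemma ln_Nf_box e : 0 < e -> exists L, forall j1 j2, (L <= j1)%N -> (L <= j2)%N ->
  `|ln (Nf (box j1 j2)) - (j1 * j2)%:R * h| <= e * (j1 * j2)%:R.
Proof.
move=> /ln_Nf_growth[L HL]; exists L.+1 => j1 j2 l1 l2.
rewrite box_reg; last exact: leq_trans l1.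
by rewrite Nf_trans; apply: HL; apply: ltnW.
Qed.

End Growth.

(** * Measures on configurations *)

Section Cylinders.
Context {A : alphabet}.
Implicit Types (x y z : Z2 -> A) (F V W : {fset Z2}) (B : set (Z2 -> A)).

Definition cyl F x : set (Z2 -> A) := [set z | agree F z x].

Definition local_on W B := forall x x', agree W x x' -> B x -> B x'.

Definition local_set : set (set (Z2 -> A)) := [set B | exists W, local_on W B].

Lemma agree_sym W x x' : agree W x x' -> agree W x' x.
Proof. by move=> h u /h ->. Qed.

Lemma agree_sub W W' x x' : W `<=` W' -> agree W' x x' -> agree W x x'.
Proof. by move=> /fsubsetP WW' h u /WW' /h. Qed.

Lemma local_on_sub W W' B : W `<=` W' -> local_on W B -> local_on W' B.
Proof. by move=> WW' BW x x' /(agree_sub WW'); apply: BW. Qed.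

Lemma local_cyl F x : local_set (cyl F x).
Proof. by exists F => z z' zz' zx u uF; rewrite -zz' // zx. Qed.

Lemma local_setC B : local_set B -> local_set (~` B).
Proof. by move=> [W BW]; exists W => x x' xx' Bx Bx'; apply: Bx; apply: BW Bx'; apply: agree_sym. Qed.

Lemma local_setU B B' : local_set B -> local_set B' -> local_set (B `|` B')%classic.
Proof.
move=> [W BW] [W' BW']; exists (W `|` W') => x x' xx' [Bx|Bx]; [left|right].
  by apply: BW Bx; apply: agree_sub xx'; apply: fsubsetUl.
by apply: BW' Bx; apply: agree_sub xx'; apply: fsubsetUr.
Qed.

Lemma local_setI B B' : local_set B -> local_set B' -> local_set (B `&` B')%classic.
Proof.
move=> BW BW'; rewrite -[X in local_set X]setCK setCI.
by apply/local_setC/local_setU; apply: local_setC.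
Qed.

Lemma local_set0 : local_set set0.
Proof. by exists fset0. Qed.

Lemma cylinderE (S : {fset Z2}) x : cylinder (restr S x) = cyl S x.
Proof.
apply/seteqP; split => z zx u; last by rewrite ffunE; apply: zx; apply: valP.
by move=> uS; have := zx [` uS]; rewrite ffunE.
Qed.

Lemma cyl_glue (S : {fset Z2}) (w : {ffun S -> A}) x : cyl S (glue w x) = cylinder w.
Proof. by rewrite -cylinderE restr_glue. Qed.

Lemma open_letter u (a : A) : open ([set z | z u = a] : set (config A)).
Proof.
have -> : [set z | z u = a] = (fun f : config A => (f u : discrete_topology A)) @^-1` [set a] by [].
apply: open_comp; last exact: discrete_open.
by move=> f _; exact: (@proj_continuous Z2 (fun=> discrete_topology A) u f).
Qed.

Lemma open_cyl F x : open (cyl F x : set (config A)).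
Proof.
elim/fset_ind: F => [|v F vF IH].
  by rewrite (_ : cyl _ _ = setT); [exact: openT|apply/seteqP; split=> // z _ u; rewrite inE].
rewrite (_ : cyl _ _ = (cyl F x `&` [set z | z v = x v])%classic).
  by apply: openI IH _; apply: open_letter.
apply/seteqP; split => [z zx|z [zx zv] u]; last by rewrite !inE => /orP[/eqP ->|/zx].
by split=> [u uF|]; apply: zx; rewrite !inE ?eqxx // uF orbT.
Qed.

Lemma open_local B : local_set B -> open (B : set (config A)).
Proof.
move=> [W BW]; rewrite (_ : B = (\bigcup_(x in B) cyl W x)%classic).
  by apply: bigcup_open => x _; apply: open_cyl.
apply/seteqP; split => [x Bx|x [z Bz xz]]; first by exists x.
by apply: BW Bz; apply: agree_sym.
Qed.

Lemma open_approx (U : set (config A)) x : open U -> U x ->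
  exists n, (cyl (ball 0 n) x `<=` U)%classic.
Proof.
move=> oU Ux; apply: contrapT => nn.
have /choice[z zP] n : exists z, cyl (ball 0 n) x z /\ ~ U z.
  apply: contrapT => h; apply: nn; exists n => z zx; apply: contrapT => Uz.
  by apply: h; exists z.
have : z @ \oo --> (x : config A).
  apply/(@pointwise_cvgP (discrete_topology Z2) (discrete_topology A)) => u.
  have [n un] := fset_in_ball [fset u] 0.
  apply: cvg_near_cst; exists n => // m nm; apply: (zP m).1.
  have : u \in ball 0 n by apply: (fsubsetP un); rewrite inE.
  rewrite !in_ball => /andP[u1 u2].
  by apply/andP; split; [apply: le_trans u1 _ | apply: le_trans u2 _]; rewrite lez_nat.
move=> /(_ U) h; have : nbhs (x : config A) U by exact: open_nbhs_nbhs.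
by move=> /h [m _ /(_ m (leqnn m))]; apply: (zP m).2.
Qed.

Lemma borel_local : (@open (config A)).-sigma.-measurable = <<s local_set >>.
Proof.
apply/seteqP; split; last first.
  apply: smallest_sub; first exact: (@sigma_algebra_measurable _ (borel_config A)).
  by move=> B /open_local oB; apply: sub_sigma_algebra.
apply: smallest_sub; first exact: smallest_sigma_algebra.
move=> U oU; pose Un n : set (Z2 -> A) := [set x | (cyl (ball 0 n) x `<=` U)%classic].
rewrite (_ : U = \bigcup_n Un n).
  apply: sigma_algebra_bigcup => n; apply: sub_sigma_algebra; exists (ball 0 n) => x x' xx' xU z zx'.
  by apply: xU => u un; rewrite zx' // xx'.
apply/seteqP; split => [x Ux|x [n _]]; last by apply.
by have [n xn] := open_approx oU Ux; exists n.
Qed.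

Lemma compact_config : compact [set: config A].
Proof.
have := @tychonoff Z2 (fun=> discrete_topology A) (fun=> setT)
  (fun=> @finite_compact (discrete_topology A) setT (@finite_finset A setT)).
by rewrite (_ : [set f | _] = setT) //; apply/seteqP; split.
Qed.

Lemma local_disjoint_finite (B : (set (Z2 -> A))^nat) :
  (forall n, local_set (B n)) -> trivIset setT B -> local_set (\bigcup_n B n) ->
  exists N, forall n, (N <= n)%N -> B n = set0.
Proof.
move=> lB tB lU; pose G (n : nat) : set (config A) := if n is m.+1 then B m else ~` \bigcup_n B n.
have := compact_config; rewrite compact_cover => /(_ nat setT G) [].
- by move=> [|n] _; apply: open_local; [exact: local_setC | exact: lB].
- move=> x _; have [[n _ Bx]|nB] := pselect ((\bigcup_n B n)%classic x); first by exists n.+1.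
  by exists 0%N.
move=> D _ cD; pose N := (\max_(n <- D) n)%N; exists N => n Nn.
apply/seteqP; split => // x Bx; have [m /= mD] := cD x I.
have mN : (m <= N)%N by apply: (leq_bigmax_seq (F := id)).
case: m mD mN => [|m] mD mN /= Gx; first by apply: Gx; exists n.
have mn : m = n by apply: (tB m n I I); exists x.
by move: Nn; rewrite leqNgt -mn mN.
Qed.

End Cylinders.

Section CylinderMasses.
Context {R : realType} {A : alphabet}.
Implicit Types (x y z : Z2 -> A) (F V W : {fset Z2}).
Implicit Types (mu nu : probability (borel_config A) R) (B : set (borel_config A)).

Lemma measurable_local B : local_set B -> measurable B.
Proof. by move=> lB; apply: (@sub_sigma_algebra _ setT (@open (config A))) (open_local lB). Qed.

Lemma measurable_cyl F x : measurable (cyl F x : set (borel_config A)).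
Proof. by apply: measurable_local; apply: local_cyl. Qed.

Definition pmass mu F x : R := fine (mu (cyl F x)).

Lemma pmassE mu F x : mu (cyl F x) = (pmass mu F x)%:E.
Proof. by rewrite fineK // fin_num_measure //; apply: measurable_cyl. Qed.

Lemma pmass_ge0 mu F x : 0 <= pmass mu F x.
Proof. exact/fine_ge0/measure_ge0. Qed.

Lemma pmass0 mu x : pmass mu fset0 x = 1.
Proof.
rewrite /pmass (_ : cyl _ _ = setT) ?probability_setT //.
by apply/seteqP; split=> // z _ u; rewrite inE.
Qed.

Lemma mass_glue mu (S : {fset Z2}) (w : {ffun S -> A}) x : mass mu w = pmass mu S (glue w x).
Proof. by rewrite /mass /pmass cyl_glue. Qed.

Lemma pmass_agree mu F x x' : agree F x x' -> pmass mu F x = pmass mu F x'.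
Proof.
move=> xx'; rewrite /pmass; congr (fine (mu _)).
by apply/seteqP; split => z zx u uF; rewrite zx // xx'.
Qed.

Lemma cyl_upd F x v a : v \notin F ->
  cyl (v |` F) (upd x v a) = (cyl F x `&` [set z | z v = a])%classic.
Proof.
move=> vF; apply/seteqP; split => [z zx|z [zx zv] u].
  split=> [u uF|]; last by rewrite /= zx ?updE // !inE eqxx.
  by rewrite zx ?upd_neq //; [apply: contraNneq vF => <-|rewrite inE uF orbT].
by rewrite !inE /upd; case: eqP => [-> _ //|_] /=; exact: zx.
Qed.

Lemma measurable_letter v (a : A) : measurable ([set z | z v = a] : set (borel_config A)).
Proof. exact: (@sub_sigma_algebra _ setT (@open (config A))) (open_letter v a). Qed.

Lemma fine_split mu B v : measurable B ->
  fine (mu B) = \sum_(a : A) fine (mu (B `&` [set z | z v = a])%classic).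
Proof.
move=> mB; have mBa (a : A) : measurable (B `&` [set z | z v = a] : set (borel_config A))%classic.
  by apply: measurableI => //; apply: measurable_letter.
rewrite {1}(_ : B = (\bigcup_(a in [set: A]) (B `&` [set z | z v = a]))%classic); last first.
  by apply/seteqP; split => [x Bx|x [a _ []]//]; exists (x v).
rewrite measure_fin_bigcup //; last 2 first.
- exact: finite_finset.
- by apply/trivIsetP => a b _ _ /eqP ab; rewrite -subset0 => x [[_ /= xa] [_ /= xb]]; apply: ab; rewrite -xa.
have eT : [set: A] = [set` index_enum A].
  by apply/seteqP; split=> // a _; rewrite /= mem_index_enum.
rewrite eT -(fsbig_seq _ _ (index_enum_uniq A)) -sum_fine // => a _.
by rewrite fin_num_measure.
Qed.

Lemma pmass_split mu F v x : v \notin F ->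
  pmass mu F x = \sum_a pmass mu (v |` F) (upd x v a).
Proof.
move=> vF; rewrite /pmass (fine_split _ v (measurable_cyl F x)).
by apply: eq_bigr => a _; rewrite cyl_upd.
Qed.

Lemma pmass_local mu F (f : (Z2 -> A) -> bool) x : local_on F [set z | f z] ->
  fine (mu [set z | f z]) = wsum (fun=> 1) F (fun z => (f z)%:R * pmass mu F z) x.
Proof.
move=> fF; pose G W z := fine (mu ([set z | f z] `&` cyl W z)%classic).
have mf : measurable ([set z | f z] : set (borel_config A)).
  by apply: measurable_local; exists F.
have GE W y : G fset0 y = wsum (fun=> 1) W (G W) y.
  elim/fset_ind: W y => [|v W vW IH] y; first by rewrite wsum0.
  rewrite fsetUC wsumU ?fdisjointX1 // IH; apply: eq_wsum => z _.
  rewrite wsum1 fsetUC /G (fine_split _ v (measurableI _ _ mf (measurable_cyl W z))).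
  by apply: eq_bigr => a _; rewrite mul1r cyl_upd // setIA.
rewrite -[X in fine (mu X)](setIT _) -(_ : cyl fset0 x = setT); last first.
  by apply/seteqP; split=> // z _ u; rewrite inE.
rewrite -/(G fset0 x) (GE F); apply: eq_wsum => z _.
rewrite /G /pmass; case: (boolP (f z)) => fz.
  rewrite mul1r; congr (fine (mu _)); apply/seteqP; split => [t [_ //]|t tz].
  by split=> //=; apply: fF fz; apply: agree_sym.
rewrite mul0r (_ : _ `&` _ = set0)%classic ?measure0 //.
apply/seteqP; split => // t [ft tz]; have := fF _ _ tz ft.
by rewrite /= (negbTE fz).
Qed.

Lemma pmass_inj mu nu : (forall F x, pmass mu F x = pmass nu F x) ->
  forall B, measurable B -> mu B = nu B.
Proof.
move=> mn B mB; apply: (@measure_unique _ R (borel_config A) local_set (fun=> setT)) => //.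
- exact: borel_local.
- by move=> C C'; apply: local_setI.
- by move=> _; exists fset0.
- by apply/seteqP; split=> // x _; exists 0%N.
- move=> C lC; have [F FC] := lC; pose f z := `[< C z >].
  have CE : C = [set z | f z] by apply/seteqP; split => z; rewrite /f /= asboolE.
  have fF : local_on F [set z | f z] by rewrite -CE.
  transitivity (fine (mu C))%:E.
    by rewrite fineK // fin_num_measure //; apply: measurable_local.
  transitivity (fine (nu C))%:E; last first.
    by rewrite fineK // fin_num_measure //; apply: measurable_local.
  rewrite CE !(pmass_local _ (fun=> alphabet_inh A) fF); congr EFin.
  by apply: eq_wsum => z _; rewrite mn.
- by move=> _; apply: (@le_lt_trans _ _ (mu setT)) => //; rewrite probability_setT ltry.
Qed.

Lemma pmass_support mu (X : set (borel_config A)) F x : measurable X ->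
  supported_on X mu -> 0 < pmass mu F x -> exists2 z, X z & agree F z x.
Proof.
move=> mX sX; rewrite /pmass => m0; apply: contrapT => nX.
move: m0; rewrite (_ : mu _ = 0%E) ?ltxx //.
have mXC : mu (~` X) = 0%E by rewrite probability_setC // sX subee.
apply: (subset_measure0 (B := ~` X)) => //; [exact: measurable_cyl | exact: measurableC |].
by move=> z zx Xz; apply: nX; exists z.
Qed.

Lemma pmass_trans mu v F x : shift_invariant mu ->
  pmass mu (trans v F) x = pmass mu F (shift v x).
Proof.
move=> inv; rewrite /pmass -(inv v _ (measurable_cyl F (shift v x))).
congr (fine (mu _)); apply/seteqP; split => z zx u; rewrite /shift.
  by move=> uF; apply: zx; rewrite in_trans addrK.
by rewrite in_trans => uF; have := zx _ uF; rewrite /shift subrK.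
Qed.

End CylinderMasses.

Definition local_config (A : alphabet) : Type := Z2 -> A.

HB.instance Definition _ (A : alphabet) := Choice.on (local_config A).
HB.instance Definition _ (A : alphabet) :=
  isPointed.Build (local_config A) (fun=> alphabet_inh A).
HB.instance Definition _ (A : alphabet) :=
  isAlgebraOfSets.Build default_measure_display (local_config A)
    (@local_set0 A) (@local_setU A) (@local_setC A).

Section Kolmogorov.
Context {R : realType} {A : alphabet}.
Context (M : {fset Z2} -> (Z2 -> A) -> R).
Context (M_ge0 : forall F x, 0 <= M F x) (M0 : forall x, M fset0 x = 1).
Context (M_agree : forall F x x', agree F x x' -> M F x = M F x').
Context (M_split : forall F v x, v \notin F -> M F x = \sum_a M (v |` F) (upd x v a)).
Implicit Types (x y z : Z2 -> A) (F V W : {fset Z2}) (B : set (local_config A)).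

Let w1 : A -> R := fun=> 1.
Let y0 : Z2 -> A := fun=> alphabet_inh A.

Lemma marginal F V y : [disjoint V & F] -> wsum w1 V (M (F `|` V)) y = M F y.
Proof.
elim/fset_ind: V F y => [|v V vV IH] F y; first by rewrite wsum0 fsetU0.
rewrite fdisjointU1X => /andP[vF VF]; rewrite wsum_step // (M_split _ vF).
apply: eq_bigr => a _; rewrite mul1r -IH; last first.
  by rewrite fdisjoint_sym fdisjointU1X vV fdisjoint_sym.
by rewrite fsetUA [F `|` [fset v]]fsetUC.
Qed.

Definition content_on W B : R := wsum w1 W (fun z => `[< B z >]%:R * M W z) y0.

Lemma content_on_sub W W' B : W `<=` W' -> local_on W B ->
  content_on W' B = content_on W B.
Proof.
move=> WW' BW; rewrite /content_on (wsum_sub _ _ _ (fsubsetDl W' W)).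
rewrite (_ : W' `\` (W' `\` W) = W); last by rewrite fsetDDr fsetDv fset0U (fsetIidPr _).
apply: eq_wsum => x _; rewrite -(@marginal W (W' `\` W)); last first.
  by apply/fdisjointP => u; rewrite inE => /andP[].
have -> : W `|` (W' `\` W) = W' by rewrite fsetUDl fsetDv fsetD0 (fsetUidPr _ _ WW').
rewrite -wsumZ; apply: eq_wsum => z zx; congr (_%:R * _); congr nat_of_bool.
have zW : agree W z x by move=> u uW; apply: zx; rewrite inE uW.
apply/asbool_equiv_eq; split; apply: BW => //; exact: agree_sym.
Qed.

Definition content B : \bar R :=
  if pselect (local_set B) is left h then (content_on (projT1 (cid h)) B)%:E else 0%E.

Lemma contentE W B : local_on W B -> content B = (content_on W B)%:E.
Proof.
move=> BW; rewrite /content; case: pselect => [h|[]]; last by exists W.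
case: cid => W0 BW0 /=.
by rewrite -(content_on_sub (fsubsetUl W W0) BW) -(content_on_sub (fsubsetUr W W0) BW0).
Qed.

Lemma content_ge0 B : (0 <= content B)%E.
Proof.
rewrite /content; case: pselect => // h; rewrite lee_fin; apply: wsum_ge0 => // x _.
by rewrite mulr_ge0.
Qed.

Lemma content0 : content set0 = 0%E.
Proof.
rewrite (@contentE fset0) // /content_on wsum0 asboolF ?mul0r //; exact.
Qed.

Lemma contentT : content setT = 1%E.
Proof.
by rewrite (@contentE fset0) // /content_on wsum0 asboolT // mul1r M0.
Qed.

Lemma contentU B B' : local_set B -> local_set B' -> (B `&` B' = set0)%classic ->
  content (B `|` B')%classic = (content B + content B')%E.
Proof.
move=> [W BW] [W' BW'] BB'; pose V := W `|` W'.
have BV : local_on V B by apply: local_on_sub BW; apply: fsubsetUl.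
have BV' : local_on V B' by apply: local_on_sub BW'; apply: fsubsetUr.
have BUV : local_on V (B `|` B')%classic.
  by move=> x x' xx' [/(BV _ _ xx')|/(BV' _ _ xx')]; [left|right].
rewrite (contentE BV) (contentE BV') (contentE BUV) -EFinD -wsumD; congr EFin.
apply: eq_wsum => x _; rewrite -mulrDl; congr (_ * _); rewrite asbool_or -natrD.
case: asboolP => Bx; case: asboolP => B'x //=.
by have : (B `&` B')%classic x by []; rewrite BB'.
Qed.

Lemma content_sigma_additive : semi_sigma_additive content.
Proof.
move=> B lB tB lU; have [N BN] := local_disjoint_finite lB tB lU.
have fin n : local_set (\big[setU/set0]_(i < n) B i) /\
    content (\big[setU/set0]_(i < n) B i) = (\sum_(0 <= i < n) content (B i))%E.
  elim: n => [|n [l1 e1]].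
    by rewrite big_ord0 big_nil content0; split; first exact: (@local_set0 A).
  rewrite big_ord_recr /= big_nat_recr //= -e1; split; first exact: (local_setU l1 (lB n)).
  rewrite (contentU l1 (lB n)) //; apply/seteqP; split => // x [].
  rewrite -bigcup_mkord => -[i /= iN Bix] Bnx.
  by have := tB i n I I (ex_intro _ x (conj Bix Bnx)); move=> e; rewrite e ltnn in iN.
rewrite (_ : \bigcup_n B n = \big[setU/set0]_(i < N) B i); last first.
  rewrite -bigcup_mkord; apply/seteqP; split => [x [n _ Bx]|x [n _ Bx]]; last by exists n.
  exists n => //=; rewrite ltnNge; apply/negP => /BN B0; by rewrite B0 in Bx.
apply: cvg_near_cst; exists N => // n /= Nn; rewrite (fin N).2.
rewrite (big_cat_nat (n := N)) //= [X in (_ + X)%E]big1_seq ?adde0 // => i.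
by rewrite mem_index_iota => /and3P[_ Ni _]; rewrite BN // content0.
Qed.

HB.instance Definition _ := isMeasure.Build _ (local_config A) R content
  content0 content_ge0 content_sigma_additive.

Definition extension : set (borel_config A) -> \bar R := measure_extension content.

Let extension0 : extension set0 = 0%E.
Proof. exact: measure0. Qed.

Let extension_ge0 B : (0 <= extension B)%E.
Proof. exact: measure_ge0. Qed.

Let extension_sigma_additive : semi_sigma_additive extension.
Proof.
have mE (C : set (borel_config A)) : measurable C -> <<s @local_set A >> C.
  by rewrite -borel_local.
move=> B mB tB mU; apply: (measure_semi_sigma_additive (s := measure_extension content)) => //.
  by move=> i; apply: mE.
exact: mE.
Qed.

HB.instance Definition _ := isMeasure.Build _ (borel_config A) R extension
  extension0 extension_ge0 extension_sigma_additive.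

Lemma extension_local B : local_set B -> extension B = content B.
Proof. by move=> lB; rewrite /extension /measure_extension measurable_mu_extE. Qed.

Let extension_setT : extension setT = 1%E.
Proof. by rewrite extension_local ?contentT //; exists fset0. Qed.

HB.instance Definition _ :=
  Measure_isProbability.Build _ (borel_config A) R extension extension_setT.

Lemma kolmogorov : exists mu : probability (borel_config A) R,
  forall F x, pmass mu F x = M F x.
Proof.
exists (extension : probability (borel_config A) R) => F x.
rewrite /pmass /= extension_local; last exact: local_cyl.
rewrite (@contentE F) /=; last by move=> z z' zz' zx u uF; rewrite -zz' // zx.
rewrite /content_on /wsum; under eq_bigr do rewrite big1 // mul1r.
rewrite (bigD1 (restr F x)) //= big1 ?addr0 => [|w wx].
  have gx : agree F (glue (restr F x) y0) x.
    by move=> u uF; rewrite -[u]/(val [` uF]) glueE ffunE.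
  by rewrite asboolT // mul1r (M_agree gx).
rewrite asboolF ?mul0r // => gx; case/eqP: wx; apply/ffunP => u.
by have := gx (val u) (valP u); rewrite glueE ffunE.
Qed.

End Kolmogorov.

Lemma path_last_exit (x : Z2 -> bool) (V : {fset Z2}) (d : Z2) s :
  path adj d s -> all x s -> last d s \in V ->
  all (fun z => z \in V) s \/ hit x V (fun z => z \notin V) (pred1 (last d s)).
Proof.
elim: s d => [|a s IH] d /=; first by left.
move=> /andP[da p] /andP[xa xs] lV; case: (IH a p xs lV) => [sV|]; last by right.
case: (boolP (a \in V)) => aV /=; [left | right] => //.
apply/hitP; exists a, s; split=> //=; apply/allP => z zs.
by rewrite (allP xs) // (allP sV).
Qed.

Section Critical.
Context {R : realType}.
Implicit Types (P : probability (borel_config bool_alphabet) R) (p : R).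

Lemma bernoulli_event P p (V : {fset Z2}) (f : (Z2 -> bool) -> bool) y :
  bernoulli_percolation p P -> (forall x x', agree V x x' -> f x = f x') ->
  fine (P [set x | f x]) = wsum (bern p) V (fun x => (f x)%:R) y.
Proof.
move=> Pp fV; rewrite (@pmass_local R bool_alphabet P V f y); last first.
  by move=> x x' xx' /=; rewrite (fV _ _ xx').
apply: eq_bigr => w _; rewrite big1 // mul1r mulrC; congr (_ * _).
rewrite -(mass_glue P w y) /mass Pp /=.
rewrite [RHS]big_seq_fsetE /=.
by apply: eq_bigr => u _; rewrite glueE.
Qed.

Definition reach (n : nat) : set (borel_config bool_alphabet) :=
  [set x | hit x (ball 0 n) (far 0 n) (pred1 (0 : Z2))].

Lemma measurable_reach n : measurable (reach n).
Proof.
by apply: measurable_local; exists (ball 0 n) => x x' xx'; rewrite /reach /= (hit_agree _ _ xx').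
Qed.

Lemma reach_decr : nonincreasing_seq reach.
Proof.
move=> m n mn; apply/subsetPset => x /hitP[d [s [Dd p a /eqP l]]].
have /fsubsetP mnb : ball 0 m `<=` ball 0 n.
  apply/fsubsetP => z; rewrite !in_ball => /andP[z1 z2].
  by rewrite (le_trans z1) ?(le_trans z2) // lez_nat.
have xs : all x s by apply: sub_all a => z /andP[].
have [|sV|] := path_last_exit (V := ball 0 m) p xs.
- by rewrite l ball_center.
- apply/hitP; exists d, s; split=> //; last by rewrite /= l.
    by apply: contra Dd; apply: mnb.
  by apply/allP => z zs; rewrite (allP xs) // (allP sV).
- by rewrite l.
Qed.

Lemma percolates_reach : percolates = \bigcap_n reach n.
Proof.
apply/seteqP; split => x.
  move=> inf n _; have [u [s [p a l]] un] : exists2 u, open_cluster x u & u \notin ball 0 n.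
    apply: contrapT => h; apply: inf; apply: (@sub_finite_set _ _ [set` ball 0 n]) => [u xu|].
      by apply: contrapT => /negP un; apply: h; exists u.
    exact: finite_fset.
  have := @path_last_exit x (ball 0 n) u (rev (belast 0 s)).
  have lE : last u (rev (belast 0 s)) = 0.
    by case: (s) l => [<-//|b s' _]; rewrite /= rev_cons last_rcons.
  rewrite lE ball_center => -[|||sV|//] //.
  - by rewrite -l path_rev_adj.
  - rewrite all_rev; apply/allP => z zs; apply: (allP a).
    exact: mem_belast zs.
  - apply/hitP; exists u, (rev (belast 0 s)); split => //=; last by rewrite lE.
      by rewrite -l path_rev_adj.
    apply/allP => z zs; rewrite (allP sV) // andbT; apply: (allP a).
    by rewrite mem_rev in zs; apply: mem_belast zs.
move=> xr /finite_fsetP[C CE]; have [n Cn] := fset_in_ball C 0.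
have /hitP[d [[|z s] [Dd p a /eqP l]]] := xr n.+1 I.
  by move: Dd; rewrite /= in l; rewrite l /far ball_center.
case/andP: p => dz p; rewrite /= in l.
have zC : z \in C.
  have : open_cluster x z.
    exists (rev (belast z s)); split.
    - by rewrite -l path_rev_adj.
    - apply/allP => t; rewrite inE => /orP[/eqP ->|].
        have : last z s \in z :: s by exact: mem_last.
        by rewrite l => /(allP a)/andP[].
      by rewrite mem_rev => /mem_belast/(allP a)/andP[].
    - by case: (s) l => [/= ->//|b s' _]; rewrite /= rev_cons last_rcons.
  by rewrite CE.
move: Dd; rewrite /far => /negP; apply.
by apply: ball_adj (fsubsetP Cn _ zC) _ _; rewrite adj_sym.
Qed.

Lemma perc_ball_small P p : bernoulli_percolation p P -> P percolates = 0%E ->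
  forall e, 0 < e -> exists n, perc p (ball 0 n) (far 0 n) (pred1 (0 : Z2)) < e.
Proof.
move=> Pp P0 e e0.
have Pr n : P (reach n) = (perc p (ball 0 n) (far 0 n) (pred1 (0 : Z2)))%:E.
  rewrite -[LHS]fineK ?fin_num_measure //; last exact: measurable_reach.
  congr EFin; apply: bernoulli_event => // x x' xx'; exact: hit_agree.
have : P \o reach @ \oo --> P (\bigcap_n reach n).
  apply: nonincreasing_cvg_mu => [|n||].
  - by rewrite [X in (X < _)%E](_ : _ = P (reach 0%N)) // Pr ltry.
  - exact: measurable_reach.
  - by apply: bigcapT_measurable => n; apply: measurable_reach.
  - exact: reach_decr.
rewrite -percolates_reach P0 => /fine_cvgP[_] /cvgrPdist_lt /(_ e e0) [n _ /(_ n (leqnn n))].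
rewrite /= Pr /= sub0r normrN => h; exists n; exact: le_lt_trans (ler_norm _) h.
Qed.

Lemma p_c_le1 : p_c R <= 1.
Proof.
have [[p pS]|S0] := pselect (exists p : R, 0 <= p <= 1 /\
   exists2 P : probability (borel_config bool_alphabet) R,
     bernoulli_percolation p P & P percolates = 0%E).
  by apply: ge_sup; [exists p | move=> r [/andP[]]].
rewrite /p_c (_ : [set _ | _] = set0) ?sup0 ?ler01 //.
by apply/seteqP; split => // p pS; apply: S0; exists p.
Qed.

Lemma subcritical_decay (s : R) : s <= 1 -> 1 - p_c R < s ->
  exists p rho C, [/\ 0 <= p <= 1, 1 - s <= p, 0 < rho < 1, 1 <= C &
    forall (V : {fset Z2}) u r, u \notin V -> perc p V (pred1 u) (far u r) <= C * rho ^+ r].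
Proof.
move=> s1 sp; have pc0 : 1 - s < p_c R by lra.
have [p1 [p1_01 [P Pp P0]] sp1] : exists2 p1, 0 <= p1 <= 1 /\
   (exists2 P : probability (borel_config bool_alphabet) R,
     bernoulli_percolation p1 P & P percolates = 0%E) & 1 - s < p1.
  apply: contrapT => h; move: pc0; rewrite ltNge => /negP; apply.
  rewrite /p_c; set S := (X in sup X); have [S0|/set0P S0] := eqVneq S set0.
    by rewrite S0 sup0; lra.
  by apply: ge_sup => // p pS; rewrite leNgt; apply/negP => sp'; apply: h; exists p.
have [|||p pp [S S0 phi1]] := @perc_sharp R ((1 - s + p1) / 2) p1 _ _ _ (perc_ball_small Pp P0);
  try lra.
have p01 : 0 <= p <= 1 by lra.
have [rho rho01 [C [C1 dec]]] := perc_far_decay p01 S0 phi1.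
by exists p, rho, C; split=> //; lra.
Qed.

End Critical.

(** * The limit measure *)

Section Indicator.
Context {R : realType} {A : finType} (E1 E2 : {set A * A}).
Implicit Types (V U W S T : {fset Z2}) (x y z : Z2 -> A) (u v : Z2).

Definition ind W x : (Z2 -> A) -> R := fun z => `[< agree W z x >]%:R.

Lemma ind_bounds W x z : 0 <= ind W x z <= 1.
Proof. by rewrite /ind ler0n lern1 leq_b1. Qed.

Lemma ind_depends W x : depends_on (fun u => u \in W) (ind W x).
Proof.
move=> z z' zz'; congr (nat_of_bool _)%:R; apply/asbool_equiv_eq.
by split=> h u uW; [rewrite -zz' // h | rewrite zz' // h].
Qed.

Lemma eq_ind W x x' : agree W x x' -> ind W x = ind W x'.
Proof.
move=> xx'; apply/funext => z; congr (nat_of_bool _)%:R; apply/asbool_equiv_eq.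
by split=> h u uW; rewrite h // xx'.
Qed.

Lemma ind_split W v x z : v \notin W -> ind W x z = \sum_a ind (v |` W) (upd x v a) z.
Proof.
move=> vW; rewrite (bigD1 (z v)) //= big1 ?addr0 => [|a az].
  congr (nat_of_bool _)%:R; apply/asbool_equiv_eq; split=> h u.
    by rewrite in_fset1U /upd; case: eqP => [-> //|_ /h].
  move=> uW; rewrite h ?upd_neq ?in_fset1U ?uW ?orbT //.
  by apply: contraNneq vW => <-.
rewrite /ind asboolF // => h; move: az; rewrite eq_sym (h v) ?updE ?eqxx //.
by rewrite in_fset1U eqxx.
Qed.

Lemma wsum_oneE W f y : wsum one W f y = \sum_(w : {ffun W -> A}) (f (glue w y) : R).
Proof. by apply: eq_bigr => w _; rewrite big1 // mul1r. Qed.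

Lemma wsum_ind W g x y : wsum one W (fun z => g z * ind W x z) y = g (glue (restr W x) y).
Proof.
rewrite wsum_oneE (bigD1 (restr W x)) //= big1 ?addr0 => [|w wx].
  rewrite /ind asboolT ?mulr1 // => u uW.
  by rewrite -[u]/(val [` uW]) glueE ffunE.
rewrite /ind asboolF ?mulr0 // => gx; case/eqP: wx; apply/ffunP => u.
by have := gx (val u) (valP u); rewrite glueE ffunE.
Qed.

Lemma Zn_agree S y y' : agree (boundary S) y y' -> Zn E1 E2 S y = Zn E1 E2 S y' :> R.
Proof.
move=> yy'; apply: eq_wsum2 => w; rewrite !mulr1; congr (nat_of_bool _)%:R.
apply: adm_agree => u uS; first by rewrite -[u]/(val [` uS]) !glueE.
rewrite !glue_off ?yy' //; by case/in_boundary: uS.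
Qed.

Lemma Zc_dlr S T x z : boundary S `<=` T -> [disjoint T & S] ->
  Zc E1 E2 S (ind (S `|` T) x) z * Zn E1 E2 S x =
  (adm E1 E2 S x)%:R * Zc E1 E2 S (ind T x) z :> R.
Proof.
move=> /fsubsetP bT TS; have TnS u : u \in T -> u \notin S by apply: fdisjointP.
have indT z' : agree_off S z' z -> ind T x z' = ind T x z.
  move=> z'z; apply: ind_depends => u uT; exact/z'z/TnS.
have -> : Zc E1 E2 S (ind T x) z = ind T x z * Zn E1 E2 S z.
  by rewrite -wsumZ; apply: eq_wsum => z' /indT ->; rewrite mulr1 mulrC.
have -> : Zc E1 E2 S (ind (S `|` T) x) z = ind T x z * wsum one S (fun z => (adm E1 E2 S z)%:R * ind S x z) z.
  rewrite -wsumZ; apply: eq_wsum => z' /indT <-; rewrite mulrCA; congr (_ * _).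
  rewrite mulrC -natrM mulnb; congr (nat_of_bool _)%:R; rewrite -asbool_and; apply/asbool_equiv_eq; split.
    by move=> h; split=> u uW; apply: h; rewrite in_fsetU uW ?orbT.
  by move=> [h1 h2] u; rewrite in_fsetU => /orP[/h1|/h2].
rewrite wsum_ind /ind; case: asboolP => zx; last by rewrite !mul0r mulr0.
rewrite !mul1r (Zn_agree (y' := z)); last by move=> u /bT /zx.
congr ((nat_of_bool _)%:R * _); apply: adm_agree => u uS.
  by rewrite -[u]/(val [` uS]) glueE ffunE.
by rewrite glue_off ?zx //; [apply: bT | apply/TnS/bT].
Qed.

End Indicator.

Lemma cauchy_limit (R : realType) (s : nat -> R) :
  (forall e, 0 < e -> exists N, forall n, (N <= n)%N -> `|s N - s n| <= e) ->
  s @ \oo --> limn s.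
Proof.
move=> h; apply/cauchy_cvgP/cauchy_exP => e e0; have [|N HN] := h (e / 2); first by rewrite divr_gt0.
exists (s N); exists N => // n /= Nn; rewrite /ball /=.
by apply: le_lt_trans (HN _ Nn) _; lra.
Qed.

Lemma cvg_bigsum (R : realType) (I : Type) (r : seq I) (f : I -> nat -> R) (l : I -> R) :
  (forall i, f i @ \oo --> l i) -> (fun n => \sum_(i <- r) f i n) @ \oo --> \sum_(i <- r) l i.
Proof.
move=> fl; elim: r => [|i r IH].
  by rewrite big_nil; under eq_fun do rewrite big_nil; apply: cvg_cst.
by rewrite big_cons; under eq_fun do rewrite big_cons; apply: cvgD.
Qed.

Definition dlr (R : realType) (A : finType) (E1 E2 : {set A * A})
    (M : {fset Z2} -> (Z2 -> A) -> R) :=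
  forall S T x, boundary S `<=` T -> [disjoint T & S] ->
    M (S `|` T) x * Zn E1 E2 S x = (adm E1 E2 S x)%:R * M T x.

Section GibbsMeasure.
Context {R : realType} {A : alphabet} (E1 E2 : {set A * A}).
Context (A' : {set A}) (safeA' : forall a, a \in A' -> safe_symbol E1 E2 a).
Context (a0 : A) (a0A' : a0 \in A').
Context (p rho C : R) (p01 : 0 <= p <= 1) (qp : 1 - #|A'|%:R / #|A|%:R <= p).
Context (rho01 : 0 < rho < 1) (C1 : 1 <= C).
Context (decay : forall (V : {fset Z2}) u r, u \notin V ->
  perc p V (pred1 u) (far u r) <= C * rho ^+ r).
Implicit Types (V U W S T : {fset Z2}) (x y z : Z2 -> A) (u v : Z2).
Local Notation Ex := (@Ex R A E1 E2).

Lemma mixing_deep V V' y y' W r x : (forall w, w \in W -> ball w r.+1 `<=` V `&` V') ->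
  `|Ex V y (ind W x) - Ex V' y' (ind W x)| <= #|` W|%:R * (C * rho ^+ r).
Proof.
move=> WV; apply: (mixing_decay safeA' a0A' p01 qp decay (B := V `&` V')) => //.
- by move=> u; rewrite inE => /andP[-> ->].
- by move=> u; rewrite inE => /andP[uV _]; rewrite uV.
- exact: ind_depends.
- exact: ind_bounds.
Qed.

Lemma mixing_small W e : 0 < e -> exists r, #|` W|%:R * (C * rho ^+ r) <= e.
Proof.
move=> e0; have W0 : 0 < (#|` W|.+1)%:R * C by rewrite mulr_gt0 ?ltr0n // (lt_le_trans ltr01).
have [||r /(_ r (leqnn r))] := @geometric_small R rho (e / ((#|` W|.+1)%:R * C)).
- by case/andP: rho01 => /ltW -> ->.
- exact: divr_gt0.
rewrite ler_pdivlMr // => h; exists r; apply: le_trans h.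
have rC : 0 <= C * rho ^+ r.
  by apply: mulr_ge0; [exact: le_trans C1 | apply/exprn_ge0/ltW; case/andP: rho01].
by rewrite [leRHS]mulrC -[leRHS]mulrA ler_wpM2r // ler_nat.
Qed.

Lemma ball_mono u m n : (m <= n)%N -> ball u m `<=` ball u n.
Proof.
move=> mn; apply/fsubsetP => z; rewrite !in_ball => /andP[z1 z2].
by rewrite (le_trans z1) ?(le_trans z2) // lez_nat.
Qed.

Lemma deep_ball W c r : exists N, forall n, (N <= n)%N -> forall w, w \in W -> ball w r `<=` ball c n.
Proof.
have [k Wk] := fset_in_ball W c; exists (k + r)%N => n kn w wW.
apply: fsubset_trans (ball_mono c kn); apply/fsubsetP => z.
by apply: ball_triangle; apply: (fsubsetP Wk).
Qed.

Definition Mf W x : R := limn (fun n => Ex (ball 0 n) (free a0) (ind W x)).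

Lemma Mf_cvg W x : (fun n => Ex (ball 0 n) (free a0) (ind W x)) @ \oo --> Mf W x.
Proof.
apply: cauchy_limit => e /(mixing_small W)[r re]; have [N HN] := deep_ball W 0 r.+1.
exists N => n Nn; apply: le_trans re; apply: mixing_deep => w wW.
by apply/fsubsetIP; split; apply: HN.
Qed.

Lemma Mf_deep W x e : 0 < e -> exists r, forall V y,
  (forall w, w \in W -> ball w r `<=` V) -> `|Ex V y (ind W x) - Mf W x| <= e.
Proof.
move=> e0; have [|r re] := @mixing_small W (e / 2); first by rewrite divr_gt0.
have [N HN] := deep_ball W 0 r.+1.
move/cvgrPdist_le: (@Mf_cvg W x) => /(_ (e / 2)) [|n _ Hn]; first by rewrite divr_gt0.
exists r.+1 => V y WV; have := Hn (maxn n N); rewrite /= leq_maxl => /(_ isT) h1.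
have h2 : `|Ex V y (ind W x) - Ex (ball 0 (maxn n N)) (free a0) (ind W x)| <= e / 2.
  apply: le_trans re; apply: mixing_deep => w wW; apply/fsubsetIP; split; first exact: WV.
  by apply: HN => //; apply: leq_maxr.
by move: h1 h2; rewrite !ler_norml; lra.
Qed.

Lemma Mf_ge0 W x : 0 <= Mf W x.
Proof.
apply: limr_ge; first by apply/cvg_ex; exists (Mf W x); apply: Mf_cvg.
by apply: nearW => n; have /andP[] := Ex_bound safeA' a0A' (ball 0 n) (free a0) (@ind_bounds R A W x).
Qed.

Lemma Mf0 x : Mf fset0 x = 1.
Proof.
apply/cvg_lim => //; apply: cvg_near_cst; apply: nearW => n.
rewrite -(Ex_const safeA' a0A' (ball 0 n) (free a0) 1); apply: (eq_Ex) => z _.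
by rewrite /ind asboolT.
Qed.

Lemma Mf_agree W x x' : agree W x x' -> Mf W x = Mf W x'.
Proof. by move=> xx'; rewrite /Mf (eq_ind xx'). Qed.

Lemma Mf_split W v x : v \notin W -> Mf W x = \sum_a Mf (v |` W) (upd x v a).
Proof.
move=> vW; apply/cvg_lim => //.
have -> : (fun n => Ex (ball 0 n) (free a0) (ind W x)) =
    (fun n => \sum_a Ex (ball 0 n) (free a0) (ind (v |` W) (upd x v a))).
  apply/funext => n; rewrite -Ex_sum; apply: eq_Ex => z _; exact: ind_split.
by apply: cvg_bigsum => a; apply: Mf_cvg.
Qed.

Lemma Mf_dlr : dlr E1 E2 Mf.
Proof.
move=> S T x bT TS; have [N HN] := deep_ball (S `|` T) 0 0.
have h1 : (fun n => Ex (ball 0 n) (free a0) (ind (S `|` T) x) * Zn E1 E2 S x) @ \oo -->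
    Mf (S `|` T) x * Zn E1 E2 S x by apply: cvgM; [apply: Mf_cvg | apply: cvg_cst].
have h2 : (fun n => (adm E1 E2 S x)%:R * Ex (ball 0 n) (free a0) (ind T x)) @ \oo -->
    (adm E1 E2 S x)%:R * Mf T x by apply: cvgM; [apply: cvg_cst | apply: Mf_cvg].
apply: cvg_unique h1 _ => //; apply: cvg_trans h2; apply: near_eq_cvg; exists N => // n /= Nn.
have SV : S `<=` ball 0 n.
  apply/fsubsetP => u uS; apply: (fsubsetP (HN _ Nn u _)); last exact: ball_center.
  by rewrite in_fsetU uS.
rewrite !ExE mulrA [RHS]mulrAC; congr (_ / _).
rewrite !(Zc_split _ _ _ _ SV) -wsumZ -wsumZr; apply: eq_wsum => z _.
by rewrite mulrCA -(Zc_dlr E1 E2 x z bT TS) mulrA.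
Qed.

Lemma Mf_trans v W x : Mf (trans v W) x = Mf W (shift v x).
Proof.
have h1 := @Mf_cvg (trans v W) x; have h2 := @Mf_cvg W (shift v x).
have E n : Ex (ball 0 n) (free a0) (ind (trans v W) x) = Ex (ball (- v) n) (free a0) (ind W (shift v x)).
  have -> : ball 0 n = trans v (ball (- v) n).
    by apply/fsetP => u; rewrite [RHS]in_trans !in_ball /= !opprK !subr0 !subrK.
  rewrite !ExE /Zn !(Zc_trans E1 E2 v (ball (- v) n)); congr (_ / _); apply: eq_wsum => z _; congr (_ * _).
  congr (nat_of_bool _)%:R; apply/asbool_equiv_eq; split => h u uW.
    by have := h (u + v); rewrite in_trans addrK /shift addrK => ->.
  by rewrite in_trans in uW; rewrite /shift (h _ uW) /shift subrK.
apply/eqP; rewrite -subr_eq0 -normr_le0; apply/ler_addgt0Pr => e e0; rewrite add0r.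
have [|r Hr] := @Mf_deep W (shift v x) (e / 2); first by rewrite divr_gt0.
have [N HN] := deep_ball W (- v) r.
move/cvgrPdist_le: h1 => /(_ (e / 2)) [|n _ Hn]; first by rewrite divr_gt0.
have := Hn (maxn n N); rewrite /= leq_maxl => /(_ isT); rewrite E => k1.
have k2 : `|Ex (ball (- v) (maxn n N)) (free a0) (ind W (shift v x)) - Mf W (shift v x)| <= e / 2.
  by apply: Hr => w wW; apply: HN => //; apply: leq_maxr.
by move: k1 k2; rewrite !ler_norml; lra.
Qed.

End GibbsMeasure.

Section Invariance.
Context {R : realType} {A : alphabet}.
Implicit Types (mu : probability (borel_config A) R).

Lemma measurable_shift v : measurable_fun setT (shift v : borel_config A -> borel_config A).
Proof.
apply: (@measurability _ _ (borel_config A) (borel_config A) setT _ (@local_set A)).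
  exact: borel_local.
move=> _ [B [W BW] <-].
rewrite setTI; apply: measurable_local; exists (trans v W) => x x' xx'.
by apply: BW => u uW; apply: xx'; rewrite in_trans addrK.
Qed.

Definition shifted mu v : set (borel_config A) -> \bar R := fun B => mu (shift v @^-1` B).

Lemma measurable_shift_preimage v (B : set (borel_config A)) : measurable B ->
  measurable (shift v @^-1` B : set (borel_config A)).
Proof. by move=> mB; rewrite -[X in measurable X]setTI; apply: measurable_shift. Qed.

Section Shifted.
Context mu (v : Z2).

Let shifted0 : shifted mu v set0 = 0%E.
Proof. by rewrite /shifted preimage_set0 measure0. Qed.

Let shifted_ge0 B : (0 <= shifted mu v B)%E.
Proof. exact: measure_ge0. Qed.

Let shifted_sigma_additive : semi_sigma_additive (shifted mu v).
Proof.
move=> F mF tF mUF; rewrite /shifted preimage_bigcup.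
apply: measure_semi_sigma_additive => [n||]; first exact: measurable_shift_preimage.
  apply/trivIsetP => i j _ _ ij; rewrite -preimage_setI.
  by move/trivIsetP : tF => /(_ i j I I ij) ->; rewrite preimage_set0.
by rewrite -preimage_bigcup; apply: measurable_shift_preimage.
Qed.

HB.instance Definition _ := isMeasure.Build _ (borel_config A) R (shifted mu v)
  shifted0 shifted_ge0 shifted_sigma_additive.

End Shifted.

Lemma pmass_invariant mu : (forall v F x, pmass mu (trans v F) x = pmass mu F (shift v x)) ->
  shift_invariant mu.
Proof.
move=> mut v B mB; pose m1 : {measure set (borel_config A) -> \bar R} := shifted mu v.
rewrite -[LHS]/(m1 B).
apply: (@measure_unique _ R (borel_config A) (@local_set A) (fun=> setT) _ _ _ _ m1 mu) => //.
- exact: borel_local.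
- by move=> C C'; apply: local_setI.
- by move=> _; exists fset0.
- by apply/seteqP; split=> // x _; exists 0%N.
- move=> C lC; have [F FC] := lC; pose f z := `[< C z >].
  have CE : C = [set z | f z] by apply/seteqP; split => z; rewrite /f /= asboolE.
  have fF : local_on F [set z | f z] by rewrite -CE.
  have fvF : local_on (trans v F) [set z | f (shift v z)].
    by move=> x x' xx'; apply: fF => u uF; apply: xx'; rewrite in_trans addrK.
  have mC : measurable (C : set (borel_config A)) by apply: measurable_local.
  have mCv : measurable ([set z | f (shift v z)] : set (borel_config A)).
    by apply: measurable_local; exists (trans v F).
  have m1E : m1 C = mu [set z | f (shift v z)] by rewrite CE.
  rewrite m1E -[LHS]fineK ?fin_num_measure // -[RHS]fineK ?fin_num_measure //.
  rewrite CE (pmass_local _ (fun=> alphabet_inh A) fF) (pmass_local _ (fun=> alphabet_inh A) fvF).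
  rewrite wsum_trans; congr EFin; apply: eq_wsum => z _.
  by rewrite mut shiftK.
- move=> _; by rewrite [X in (X < _)%E](_ : _ = mu setT) // probability_setT ltry.
Qed.

End Invariance.

Section Gibbs.
Context {R : realType} {A : alphabet} (E1 E2 : {set A * A}).
Context (A' : {set A}) (safeA' : forall a, a \in A' -> safe_symbol E1 E2 a).
Context (a0 : A) (a0A' : a0 \in A').
Implicit Types (mu nu : probability (borel_config A) R).
Implicit Types (V U W S T : {fset Z2}) (x y z : Z2 -> A) (u v : Z2).
Local Notation Ex := (@Ex R A E1 E2).

Lemma sft_okat : sft E1 E2 = [set z | forall u, okat E1 E2 z u].
Proof.
apply/seteqP; split => z zX u.
  have [h1 h2] := zX u; have [h3 _] := zX (u - e1); have [_ h4] := zX (u - e2).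
  by rewrite !subrK in h3 h4; apply/and4P.
by have /and4P[] := zX u.
Qed.

Lemma measurable_sft : measurable (sft E1 E2 : set (borel_config A)).
Proof.
rewrite (_ : sft E1 E2 = \bigcap_n [set z | adm E1 E2 (ball 0 n) z]).
  apply: bigcapT_measurable => n; apply: measurable_local.
  exists (ball 0 n `|` boundary (ball 0 n)) => x x' xx' /=.
  by rewrite (adm_agree E1 E2 (x' := x')) // => u uB; apply: xx'; rewrite in_fsetU uB ?orbT.
rewrite sft_okat; apply/seteqP; split => z.
  by move=> h n _; apply/admP.
move=> h u; have [n un] := fset_in_ball [fset u] 0.
by have /admP := h n I; apply; apply: (fsubsetP un); rewrite inE.
Qed.

Lemma dlr_pmass_adm mu S T x : dlr E1 E2 (pmass mu) -> boundary S `<=` T ->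
  [disjoint T & S] ->
  pmass mu (S `|` T) x = (adm E1 E2 S x)%:R / Zn E1 E2 S x * pmass mu T x.
Proof.
move=> D bT TS; rewrite mulrAC -D // mulfK //.
by apply: lt0r_neq0; apply: (Zn_gt0 safeA' a0A').
Qed.

Lemma boundary_disjoint S : [disjoint boundary S & S].
Proof. by apply/fdisjointP => u /in_boundary[]. Qed.

Lemma dlr_supported mu : dlr E1 E2 (pmass mu) -> supported_on (sft E1 E2) mu.
Proof.
move=> D; pose G n : set (borel_config A) := [set z | adm E1 E2 (ball 0 n) z].
pose B n := ball 0 n `|` boundary (ball 0 n).
have lG n : local_on (B n) [set z | ~~ adm E1 E2 (ball 0 n) z].
  move=> x x' xx' /=.
  by rewrite (adm_agree E1 E2 (x' := x')) // => u uB; apply: xx'; rewrite in_fsetU uB ?orbT.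
have mG n : measurable (G n).
  rewrite -[G n]setCK; apply: measurableC; apply: measurable_local; exists (B n).
  by move=> x x' xx' /negP/(lG n _ _ xx')/negP.
have muG n : mu (G n) = 1%E.
  have <- : mu (~` [set z | ~~ adm E1 E2 (ball 0 n) z]) = mu (G n).
    congr (mu _); apply/seteqP; split => z /= h; first by apply/negPn/negP.
    by apply/negP; rewrite negbK.
  have mGn : measurable ([set z | ~~ adm E1 E2 (ball 0 n) z] : set (borel_config A)).
    by apply: measurable_local; exists (B n).
  rewrite probability_setC // -[mu _]fineK ?fin_num_measure //.
  rewrite (pmass_local _ (fun=> a0) (lG n)) (_ : wsum _ _ _ _ = 0) ?sube0 //.
  apply: big1 => w _; rewrite (dlr_pmass_adm _ D (fsubset_refl _) (boundary_disjoint _)).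
  by case: (adm _ _ _ _); rewrite ?mul0r ?mulr0.
have XE : sft E1 E2 = \bigcap_n G n.
  rewrite sft_okat; apply/seteqP; split => z; first by move=> h n _; apply/admP.
  move=> h u; have [n un] := fset_in_ball [fset u] 0.
  by have /admP := h n I; apply; apply: (fsubsetP un); rewrite inE.
rewrite /supported_on XE; have : mu \o G @ \oo --> mu (\bigcap_n G n).
  apply: nonincreasing_cvg_mu => [|//||m n mn].
  - by rewrite [X in (X < _)%E](_ : _ = mu (G 0%N)) // muG ltry.
  - exact: bigcapT_measurable.
  - apply/subsetPset => z /admP zn; apply/admP => u um; apply: zn.
    exact: (fsubsetP (ball_mono 0 mn)).
rewrite (_ : mu \o G = cst 1%E); last by apply/funext => n; exact: muG.
by move=> h; apply: (cvg_unique _ h) => //; apply: cvg_cst.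
Qed.

Lemma dlr_average nu V W x y : dlr E1 E2 (pmass nu) -> W `<=` V ->
  pmass nu W x = wsum one (boundary V) (fun z => pmass nu (boundary V) z * Ex V z (ind W x)) y.
Proof.
move=> D WV; pose f z := `[< agree W z x >].
have fE : cyl W x = [set z | f z] by apply/seteqP; split => z; rewrite /f /= asboolE.
have fl : local_on (V `|` boundary V) [set z | f z].
  rewrite -fE => z z' zz' zx u uW; rewrite -zx // zz' // in_fsetU.
  by rewrite (fsubsetP WV _ uW).
have bV := boundary_disjoint V.
rewrite {1}/pmass fE (pmass_local _ y fl) fsetUC wsumU //; apply: eq_wsum => z _.
rewrite -[RHS]mulrC ExE mulrAC -mulrA -wsumZr; apply: eq_wsum => z' z'z.
rewrite fsetUC (dlr_pmass_adm _ D (fsubset_refl _) bV).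
have zb : agree (boundary V) z' z by move=> u /in_boundary[uV _]; apply: z'z.
rewrite (pmass_agree _ zb) (Zn_agree E1 E2 zb) /ind -/(f z'); ring.
Qed.

Lemma wsum_pmass nu F y : wsum one F (pmass nu F) y = 1.
Proof.
have h : local_on F [set z : Z2 -> A | xpredT z] by [].
have := pmass_local nu y h; rewrite (_ : [set _ | _] = setT); last by apply/seteqP; split.
rewrite probability_setT /= => ->; apply: eq_wsum => z _; by rewrite mul1r.
Qed.

Lemma dlr_mrf mu : dlr E1 E2 (pmass mu) -> is_MRF mu.
Proof.
move=> D S eta T bT TS delta d0; pose x := glue eta (glue delta (fun=> a0)).
have TnS u : u \in T -> u \notin S by apply: (fdisjointP TS).
have etaE : cylinder eta = cyl S x by rewrite -(cyl_glue _ (glue delta (fun=> a0))).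
have xT (u : T) : x (val u) = delta u by rewrite /x glue_off ?glueE //; apply/TnS/valP.
have dE : cylinder delta = cyl T x.
  by rewrite -cylinderE; congr cylinder; apply/ffunP => u; rewrite ffunE xT.
have sE : cylinder (subpattern bT delta) = cyl (boundary S) x.
  rewrite -cylinderE; congr cylinder; apply/ffunP => u; rewrite !ffunE -xT.
  by congr x.
have cond V : boundary S `<=` V -> [disjoint V & S] -> pmass mu V x != 0 ->
    cond_prob mu (cyl S x) (cyl V x) = (adm E1 E2 S x)%:R / Zn E1 E2 S x.
  move=> bV VS m0; rewrite /cond_prob -/(pmass mu V x).
  rewrite [X in fine (mu X) / _](_ : _ = cyl (S `|` V) x).
    by rewrite -/(pmass mu (S `|` V) x) (dlr_pmass_adm _ D bV VS) mulfK.
  apply/seteqP; split => z; first by move=> [h1 h2] u; rewrite in_fsetU => /orP[/h1|/h2].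
  by move=> h; split => u uV; apply: h; rewrite in_fsetU uV ?orbT.
rewrite dE in d0 *; rewrite etaE sE.
have mT0 : 0 < pmass mu T x.
  by rewrite lt0r pmass_ge0 andbT; apply: contraNneq d0 => h; rewrite pmassE h.
have mB0 : 0 < pmass mu (boundary S) x.
  apply: lt_le_trans mT0 _; rewrite -lee_fin -!pmassE; apply: le_measure.
  - by rewrite inE; apply: measurable_cyl.
  - by rewrite inE; apply: measurable_cyl.
  - by move=> z; apply: agree_sub.
by rewrite !cond ?lt0r_neq0 // boundary_disjoint.
Qed.

Definition uniform_spec_fun S (d : {ffun boundary S -> A}) (e : {ffun S -> A}) : R :=
  (adm E1 E2 S (glue e (glue d (fun=> a0))))%:R / Zn E1 E2 S (glue d (fun=> a0)).

Lemma uniform_spec_ge0 S d e : 0 <= @uniform_spec_fun S d e.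
Proof. by apply: divr_ge0 => //; apply: Zn_ge0. Qed.

Lemma uniform_spec_sum1 S (d : {ffun boundary S -> A}) : \sum_e uniform_spec_fun d e = 1.
Proof.
rewrite /uniform_spec_fun -mulr_suml -(wsum_oneE S (fun z => (adm E1 E2 S z)%:R)).
rewrite (_ : wsum _ _ _ _ = Zn E1 E2 S (glue d (fun=> a0))).
  by rewrite divff // lt0r_neq0 // (Zn_gt0 safeA' a0A').
by apply: eq_wsum => z _; rewrite mulr1.
Qed.

Definition uniform_spec : specification R A :=
  Specification uniform_spec_ge0 uniform_spec_sum1.

Lemma uniform_specE S x y : uniform_spec S (restr (boundary S) x) (restr S y) =
  (adm E1 E2 S (fun u => if u \in S then y u else x u))%:R / Zn E1 E2 S x.
Proof.
rewrite /uniform_spec /= /uniform_spec_fun; congr (_%:R / _).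
  congr nat_of_bool; apply: adm_agree => u uS.
    by rewrite uS -[u]/(val [` uS]) glueE ffunE.
  have /in_boundary[uS' _] := uS; rewrite glue_off // (negbTE uS').
  by rewrite -[u]/(val [` uS]) glueE ffunE.
by apply: Zn_agree => u uS; rewrite -[u]/(val [` uS]) glueE ffunE.
Qed.

Lemma uniform_spec_invariant : spec_invariant uniform_spec.
Proof.
move=> S v x y S'; have -> : S' = trans (- v) S by [].
rewrite !uniform_specE adm_shift /Zn Zc_trans.
have -> : shift (- v) (shift v x) = x by apply/funext => u; rewrite /shift subrK.
set z := shift (- v) _; suff -> : z = (fun u => if u \in S then y u else x u) by [].
by apply/funext => u; rewrite /z /shift in_trans opprK !subrK.
Qed.

Lemma dlr_associated mu : dlr E1 E2 (pmass mu) -> associated mu uniform_spec.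
Proof.
move=> D S d d0 e; pose x := glue e (glue d (fun=> a0)).
have eE : cylinder e = cyl S x by rewrite -(cyl_glue _ (glue d (fun=> a0))).
have dE : cylinder d = cyl (boundary S) x.
  rewrite -cylinderE; congr cylinder; apply/ffunP => u; rewrite ffunE /x glue_off ?glueE //.
  by have /in_boundary[] := valP u.
rewrite dE pmassE lte_fin in d0; rewrite eE dE /cond_prob -/(pmass mu (boundary S) x).
rewrite [X in fine (mu X) / _](_ : _ = cyl (S `|` boundary S) x).
  rewrite -/(pmass mu _ x) (dlr_pmass_adm _ D (fsubset_refl _) (boundary_disjoint S)).
  rewrite mulfK ?lt0r_neq0 // /uniform_spec /= /uniform_spec_fun; congr (_ / _).
  apply: Zn_agree => u uS; rewrite /x glue_off //.
  by have /in_boundary[] := uS.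
apply/seteqP; split => z; first by move=> [h1 h2] u; rewrite in_fsetU => /orP[/h1|/h2].
by move=> h; split => u uV; apply: h; rewrite in_fsetU uV ?orbT.
Qed.

Lemma uniform_spec_q : spec_q uniform_spec <= 1 - #|A'|%:R / #|A|%:R.
Proof.
have q0 : (0 : R) < #|A|%:R by rewrite ltr0n; apply/card_gt0P; exists a0.
have bound0 : (0 : R) <= 1 - #|A'|%:R / #|A|%:R.
  by rewrite subr_ge0 ler_pdivrMr // mul1r ler_nat max_card.
rewrite /spec_q; apply: ge_sup; first by exists (\big[Num.max/0]_d tv_dist (uniform_spec [fset 0] d.1) (uniform_spec [fset 0] d.2)); exists 0.
move=> _ [g _ <-]; apply: bigmax_le => // d _.
set a := uniform_spec [fset g] d.1; set b := uniform_spec [fset g] d.2.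
have tvE : tv_dist a b = 1 - \sum_e Num.min (a e) (b e).
  have sa : \sum_e a e = 1 by exact: spec_sum1.
  have sb : \sum_e b e = 1 by exact: spec_sum1.
  rewrite /tv_dist -[X in X - _](_ : 2^-1 * (\sum_e a e + \sum_e b e) = 1); last by rewrite sa sb; field.
  rewrite -big_split /= !mulr_sumr -sumrB; apply: eq_bigr => e _.
  by case: (leP (a e) (b e)) => h; [rewrite ler0_norm|rewrite ger0_norm]; lra.
rewrite tvE lerD2l lerN2.
have low (d' : {ffun boundary [fset g] -> A}) e y : glue e y g \in A' ->
    #|A|%:R^-1 <= uniform_spec [fset g] d' e.
  move=> eA; rewrite /uniform_spec /= /uniform_spec_fun.
  rewrite (_ : adm _ _ _ _) ?mul1r.
    have := Zn_le E1 E2 [fset g] (glue d' (fun=> a0)) (R := R); rewrite cardfs1 expr1 => h.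
    by rewrite lef_pV2 ?posrE // (Zn_gt0 safeA' a0A').
  apply/admP => u; rewrite inE => /eqP ->; apply: (okat_safe safeA').
  have gg : g \in [fset g] by rewrite inE.
  by move: eA; rewrite -[g]/(val [` gg]) !glueE.
apply: le_trans (_ : \sum_(e : {ffun [fset g] -> A}) (glue e (free a0) g \in A')%:R / #|A|%:R <= _).
  rewrite -(wsum_oneE _ (fun z : Z2 -> A => (z g \in A')%:R / #|A|%:R)) wsum1.
  under eq_bigr do rewrite updE mul1r.
  by rewrite -mulr_suml -natr_sum -big_mkcond /= sum1_card.
apply: ler_sum => e _; case: (boolP (glue e (free a0) g \in A')) => eA.
  by rewrite mul1r le_min !(low _ _ _ eA).
by rewrite mul0r le_min !spec_ge0.
Qed.

End Gibbs.

(** * Entropy *)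

Lemma gibbs_term (R : realType) (a b : R) : 0 <= a -> 0 <= b -> (0 < a -> 0 < b) ->
  a * (ln b - ln a) <= b - a ?= iff (a == b).
Proof.
move=> a0 b0 ab; have [->|an0] := eqVneq a 0.
  by rewrite mul0r subr0; split.
have ap : 0 < a by rewrite lt_def an0.
have bp := ab ap; have [->|nab] := eqVneq a b; first by rewrite !subrr mulr0; split; rewrite ?eqxx.
have lt : a * (ln b - ln a) < b - a.
  have ba : 0 < b / a by rewrite divr_gt0.
  have ln0 : ln (b / a) != 0.
    by rewrite ln_eq0 // -(inj_eq (mulIf an0)) divfK // mul1r eq_sym.
  have := expR_gt1Dx ln0; rewrite lnK ?posrE // ltr_pdivlMr // ln_div ?posrE //.
  by move=> h; lra.
by split; [apply: ltW | rewrite lt_eqF].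
Qed.

Section Entropy.
Context {R : realType} {A : alphabet} (nu : probability (borel_config A) R).
Implicit Types (F K U : {fset Z2}) (x y z : Z2 -> A).

Let y0 : Z2 -> A := fun=> alphabet_inh A.

Definition avg F (f : (Z2 -> A) -> R) : R := wsum one F (fun z => pmass nu F z * f z) y0.

Definition ent F : R := avg F (fun z => - ln (pmass nu F z)).

Lemma pmass_marginal F V y : [disjoint V & F] ->
  wsum one V (pmass nu (F `|` V)) y = pmass nu F y.
Proof. by move=> VF; apply: (marginal (fun F v x => @pmass_split R A nu F v x)). Qed.

Lemma avg_base F f y : (forall x x', agree F x x' -> f x = f x') ->
  wsum one F (fun z => pmass nu F z * f z) y = avg F f.
Proof.
move=> fF; apply: eq_wsum2 => w.
have e : agree F (glue w y) (glue w y0) by move=> u uF; rewrite -[u]/(val [` uF]) !glueE.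
by rewrite (pmass_agree _ e) (fF _ _ e).
Qed.

Lemma avg_sub K U f : K `<=` U -> (forall x x', agree K x x' -> f x = f x') ->
  avg U f = avg K f.
Proof.
move=> KU fK; rewrite /avg (wsum_sub _ _ _ (fsubsetDl U K)).
rewrite (_ : U `\` (U `\` K) = K); last by rewrite fsetDDr fsetDv fset0U (fsetIidPr _).
have UK : [disjoint U `\` K & K] by apply/fdisjointP => u; rewrite inE => /andP[].
apply: eq_wsum => z _; rewrite -(pmass_marginal _ UK).
rewrite fsetUDl fsetDv fsetD0 (fsetUidPr _ _ KU) -wsumZr; apply: eq_wsum => z' z'z.
by congr (_ * _); apply: fK => u uK; apply: z'z; rewrite inE uK.
Qed.

Lemma eq_avg F f g : (forall z, f z = g z) -> avg F f = avg F g.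
Proof. by move=> fg; apply: eq_wsum => z _; rewrite fg. Qed.

Lemma avgD F f g : avg F (fun z => f z + g z) = avg F f + avg F g.
Proof. by rewrite -wsumD; apply: eq_wsum => z _; rewrite mulrDr. Qed.

Lemma avgN F f : avg F (fun z => - f z) = - avg F f.
Proof. by rewrite -mulN1r -wsumZ; apply: eq_wsum => z _; rewrite mulN1r mulrN. Qed.

Lemma ln_pmass_local F x x' : agree F x x' -> - ln (pmass nu F x) = - ln (pmass nu F x').
Proof. by move=> /pmass_agree ->. Qed.

Lemma entE K U : K `<=` U -> ent K = avg U (fun z => - ln (pmass nu K z)).
Proof. by move=> KU; rewrite (avg_sub KU) // => x x'; apply: ln_pmass_local. Qed.

Lemma pmass_le K U x : K `<=` U -> pmass nu U x <= pmass nu K x.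
Proof.
move=> KU; rewrite -lee_fin -!pmassE; apply: le_measure.
- by rewrite inE; apply: measurable_cyl.
- by rewrite inE; apply: measurable_cyl.
- by move=> z; apply: agree_sub.
Qed.

Lemma pmass_le1 F x : pmass nu F x <= 1.
Proof. by rewrite -(pmass0 nu x); apply: pmass_le; apply: fsub0set. Qed.

Lemma ent_ge0 F : 0 <= ent F.
Proof.
apply: wsum_ge0 => [a|x _]; first exact: one_ge0.
by rewrite mulr_ge0 ?pmass_ge0 // oppr_ge0 ln_le0 // pmass_le1.
Qed.

Lemma ent_submodular I F G : [disjoint I & F] -> [disjoint I & G] -> [disjoint F & G] ->
  ent (I `|` F `|` G) + ent I <= ent (I `|` F) + ent (I `|` G).
Proof.
move=> dIF dIG dFG; set U := I `|` F `|` G.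
have IFU : I `|` F `<=` U by apply: fsubsetUl.
have IU : I `<=` U by apply: fsubset_trans IFU; apply: fsubsetUl.
have IGU : I `|` G `<=` U.
  by apply/fsubsetP => u; rewrite !in_fsetU => /orP[->|->]; rewrite ?orbT.
rewrite -subr_le0 (entE IFU) (entE IU) (entE IGU) (entE (fsubset_refl U)).
rewrite -!avgD -avgN -avgD.
pose b z := pmass nu (I `|` F) z * pmass nu (I `|` G) z / pmass nu I z.
apply: le_trans (_ : wsum one U (fun z => b z - pmass nu U z) y0 <= _).
  apply: le_wsum => [a|z _]; first exact: one_ge0.
  have m0 K : 0 <= pmass nu K z by apply: pmass_ge0.
  have b0 : 0 <= b z by rewrite /b divr_ge0 // mulr_ge0.
  have pos : 0 < pmass nu U z -> [/\ 0 < pmass nu (I `|` F) z, 0 < pmass nu (I `|` G) z & 0 < pmass nu I z].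
    by move=> h; split; apply: lt_le_trans h _; apply: pmass_le.
  apply: le_trans (gibbs_term (m0 U) b0 _).1; last by case/pos => *; rewrite /b divr_gt0 // mulr_gt0.
  have := m0 U; rewrite le_eqVlt => /orP[/eqP <-|h]; first by rewrite !mul0r.
  have [p1 p2 p3] := pos h.
  apply: ler_wpM2l => //; rewrite /b ln_div ?posrE ?mulr_gt0 // lnM ?posrE //.
  by rewrite le_eqVlt; apply/orP; left; apply/eqP; ring.
rewrite wsumB wsum_pmass subr_le0.
apply: le_trans (_ : wsum one I (pmass nu I) y0 <= _); last by rewrite wsum_pmass.
rewrite /U wsumU; last by rewrite fdisjointUX dIG.
rewrite wsumU //; apply: le_wsum => [a|z _]; first exact: one_ge0.
have -> : wsum one F (fun x => wsum one G b x) z =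
   wsum one F (fun x => pmass nu (I `|` F) x * (pmass nu I z / pmass nu I z)) z.
  apply: eq_wsum => z' z'z.
  have IGd : [disjoint G & I] by rewrite fdisjoint_sym.
  have zI : agree I z' z by move=> u uI; apply: z'z; apply: (fdisjointP dIF).
  rewrite -(pmass_agree nu zI) -{1}(pmass_marginal z' IGd) mulrA [_ * wsum _ _ _ _]mulrC.
  rewrite -!wsumZr; apply: eq_wsum => z'' z''z.
  have zIF : agree (I `|` F) z'' z'.
    by move=> u; rewrite in_fsetU => /orP[uI|uF]; apply: z''z; [apply: (fdisjointP dIG)|apply: (fdisjointP dFG)].
  have zI' : agree I z'' z' by move=> u uI; apply: z''z; apply: (fdisjointP dIG).
  by rewrite /b (pmass_agree nu zIF) (pmass_agree nu zI'); ring.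
rewrite wsumZr pmass_marginal; last by rewrite fdisjoint_sym.
have [->|p0] := eqVneq (pmass nu I z) 0; first by rewrite mul0r.
by rewrite divff // mulr1.
Qed.

Lemma ent_mono_sum I F G : I `<=` F -> I `<=` G -> [disjoint F `\` I & G `\` I] ->
  ent (F `|` G) + ent I <= ent F + ent G.
Proof.
move=> IF IG FG.
have FE : I `|` (F `\` I) = F by rewrite fsetUDl fsetDv fsetD0 (fsetUidPr _ _ IF).
have GE : I `|` (G `\` I) = G by rewrite fsetUDl fsetDv fsetD0 (fsetUidPr _ _ IG).
have dI K : [disjoint I & K `\` I] by apply/fdisjointP => u uI; rewrite inE uI.
have := ent_submodular (dI F) (dI G) FG; rewrite FE GE.
suff -> : F `|` (G `\` I) = F `|` G by [].
by rewrite -{2}GE fsetUA (fsetUidPl _ _ IF).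
Qed.

End Entropy.

Section EntropyBounds.
Context {R : realType} {A : alphabet} (E1 E2 : {set A * A}).
Context (A' : {set A}) (safeA' : forall a, a \in A' -> safe_symbol E1 E2 a).
Context (a0 : A) (a0A' : a0 \in A').
Implicit Types (mu nu : probability (borel_config A) R).
Implicit Types (V U W S T F : {fset Z2}) (x y z : Z2 -> A) (u v : Z2).
Local Notation Nf := (@Nf R A E1 E2 a0).

Lemma Zn_lower I V y : I `<=` V -> boundary I `<=` V -> Nf I <= Zn E1 E2 V y.
Proof.
move=> IV bV; rewrite /Zn (Zc_split _ _ _ _ IV).
pose x : Z2 -> A := fun u => if u \in V `\` I then a0 else y u.
have xy : agree_off (V `\` I) x y by move=> u uV; rewrite /x (negbTE uV).
apply: le_trans (wsum_one_ge _ xy); last by move=> z; rewrite mulr_ge0 ?Zn_ge0.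
rewrite (_ : rest _ _ _ _ _) ?mul1r.
  rewrite (_ : Nf I = Zn E1 E2 I x) //; apply: Zn_agree => u ub.
  have /in_boundary[uI _] := ub.
  by rewrite /free /x inE uI (fsubsetP bV _ ub).
apply/allP => u uVI; have xu : x u = a0 by rewrite /x uVI.
have : okat E1 E2 x u by apply: (okat_safe safeA'); rewrite xu.
by rewrite /resat => /and4P[-> -> -> ->]; rewrite !orbT.
Qed.

Lemma ent_lower mu I V : dlr E1 E2 (pmass mu) -> I `<=` V -> boundary I `<=` V ->
  ln (Nf I) <= ent mu V.
Proof.
move=> D IV bIV; have N0 : 0 < Nf I by apply: (Nf_gt0 safeA' a0A').
have up x : pmass mu V x <= (Nf I)^-1.
  have bd := boundary_disjoint V; rewrite -(pmass_marginal mu x bd).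
  rewrite -[leRHS]mul1r -(wsum_pmass mu (boundary V) x) -wsumZr.
  apply: le_wsum => [a|z _]; first exact: one_ge0.
  rewrite (dlr_pmass_adm safeA' a0A' z D (fsubset_refl _) bd) mulrC.
  apply: ler_wpM2l; first exact: pmass_ge0.
  have Z0 : 0 < Zn E1 E2 V z :> R by apply: (Zn_gt0 safeA' a0A').
  rewrite -[leRHS]mul1r; apply: ler_pM; rewrite ?invr_ge0 ?(ltW Z0) ?lern1 ?leq_b1 //.
  by rewrite lef_pV2 ?posrE // Zn_lower.
rewrite -[leLHS]mul1r -(wsum_pmass mu V (fun=> alphabet_inh A)) -wsumZr.
apply: le_wsum => [a|z _]; first exact: one_ge0.
have := pmass_ge0 mu V z; rewrite le_eqVlt => /orP[/eqP <-|m0]; first by rewrite !mul0r.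
apply: ler_wpM2l; first exact: pmass_ge0.
by rewrite lerNr -lnV ?posrE // ler_ln ?posrE ?invr_gt0.
Qed.

Context (nu : probability (borel_config A) R) (nuX : supported_on (sft E1 E2) nu).

Lemma pmass_adm F x : 0 < pmass nu F x -> exists2 z, (forall u, okat E1 E2 z u) & agree F z x.
Proof.
move=> m0; have [z zX zx] := pmass_support (@measurable_sft A E1 E2) nuX m0.
by exists z => //; rewrite sft_okat in zX.
Qed.

(** The left-hand side is at most the entropy of the measure obtained from [nu]
   by resampling [U] uniformly, which lives on the patterns of [Delta] and [U]. *)
Lemma pressure_bound Delta U : [disjoint Delta & U] -> boundary U `<=` Delta ->
  ent nu Delta + avg nu Delta (fun z => ln (Zn E1 E2 U z)) <= ln (Nf (Delta `|` U)).
Proof.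
move=> dDU bU; set L := Delta `|` U.
have N0 : 0 < Nf L by apply: (Nf_gt0 safeA' a0A').
have Z0 z : 0 < Zn E1 E2 U z :> R by apply: (Zn_gt0 safeA' a0A').
pose b z : R := (0 < pmass nu Delta z)%R%:R * Zn E1 E2 U z / Nf L.
have sb : wsum one Delta b (free a0) <= 1.
  rewrite /b wsumZr ler_pdivrMr // mul1r.
  have UL : U `<=` L by apply: fsubsetUr.
  rewrite [leRHS](Zc_split _ _ _ _ UL).
  rewrite (_ : L `\` U = Delta); last first.
    by rewrite fsetDUl fsetDv fsetU0; apply/fsetDidPl.
  apply: le_wsum => [a|z zf]; first exact: one_ge0.
  apply: ler_wpM2r; first exact: ltW.
  rewrite ler_nat; case: (ltP 0 (pmass nu Delta z)) => // /pmass_adm[t tX tz].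
  rewrite (_ : rest _ _ _ _ _) //; apply/allP => u; rewrite inE => /andP[uU uL].
  have uD : u \in Delta by move: uL; rewrite in_fsetU (negbTE uU) orbF.
  have zw w : z w = t w \/ z w = a0.
    by have [wD|/zf ->] := boolP (w \in Delta); [left; rewrite tz | right].
  have /and4P[t1 t2 t3 t4] := tX u; have sa := safeA' a0A'.
  rewrite /resat -(tz u uD); apply/and4P; split; apply/orP; right;
    by [case: (zw (u + e1)) => ->; [|have [] := sa (t u)]
       |case: (zw (u - e1)) => ->; [|have [] := sa (t u)]
       |case: (zw (u + e2)) => ->; [|have [] := sa (t u)]
       |case: (zw (u - e2)) => ->; [|have [] := sa (t u)]].
rewrite /ent -avgD -subr_le0.
have -> : ln (Nf L) = avg nu Delta (fun=> ln (Nf L)).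
  by rewrite /avg wsumZr wsum_pmass mul1r.
rewrite -avgN -avgD.
apply: le_trans (_ : wsum one Delta (fun z => b z - pmass nu Delta z) (free a0) <= _); last first.
  by rewrite wsumB wsum_pmass subr_le0.
rewrite -(avg_base nu (free a0)); last first.
  move=> x x' xx'; rewrite (pmass_agree nu xx') (Zn_agree E1 E2 (y' := x')) //.
  by move=> u ub; apply: xx'; apply: (fsubsetP bU).
apply: le_wsum => [a|z _]; first exact: one_ge0.
have m0 := pmass_ge0 nu Delta z.
have b0 : 0 <= b z by rewrite /b divr_ge0 ?mulr_ge0 ?(ltW (Z0 z)) ?(ltW N0).
have pos : 0 < pmass nu Delta z -> b z = Zn E1 E2 U z / Nf L by move=> h; rewrite /b h mul1r.
apply: le_trans (gibbs_term m0 b0 _).1; last by move=> h; rewrite pos // divr_gt0.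
have := m0; rewrite le_eqVlt => /orP[/eqP <-|h]; first by rewrite !mul0r.
apply: ler_wpM2l => //; rewrite pos // ln_div ?posrE //.
by rewrite le_eqVlt; apply/orP; left; apply/eqP; ring.
Qed.

Lemma ent_upper F : ent nu F <= ln (Nf F).
Proof.
have := @pressure_bound F fset0; rewrite fsetU0 fdisjointX0 => /(_ isT).
have b0 : boundary fset0 = fset0.
  by apply/fsetP => u; rewrite inE; apply/negP => /in_boundary[_ [w]]; rewrite inE.
rewrite b0 fsub0set => /(_ isT); apply: le_trans.
rewrite lerDl; apply: wsum_ge0 => [a|z _]; first exact: one_ge0.
by rewrite mulr_ge0 ?pmass_ge0 // ln_ge0 // (Zn_ge1 safeA' a0A').
Qed.

End EntropyBounds.

Definition copies (vs : seq Z2) (S : {fset Z2}) : {fset Z2} :=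
  foldr (fun v U => trans v S `|` U) fset0 vs.

Lemma in_copies vs S u : (u \in copies vs S) = has (fun v => u - v \in S) vs.
Proof.
by elim: vs => [|v vs IH] /=; [rewrite in_fset0 | rewrite in_fsetU in_trans IH].
Qed.

Section LanfordRuelle.
Context {R : realType} {A : alphabet} (E1 E2 : {set A * A}).
Context (A' : {set A}) (safeA' : forall a, a \in A' -> safe_symbol E1 E2 a).
Context (a0 : A) (a0A' : a0 \in A').
Context (nu : probability (borel_config A) R).
Context (nu_inv : shift_invariant nu) (nuX : supported_on (sft E1 E2) nu).
Implicit Types (V U W S T F : {fset Z2}) (x y z : Z2 -> A) (u v : Z2).
Local Notation Nf := (@Nf R A E1 E2 a0).

Lemma avg_trans v F f : (forall x x', agree F x x' -> f x = f x') ->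
  avg nu (trans v F) (fun z => f (shift v z)) = avg nu F f.
Proof.
move=> fF; rewrite {1}/avg wsum_trans -(avg_base nu (shift v (fun=> alphabet_inh A)) fF).
by apply: eq_wsum => z _; rewrite pmass_trans // shiftK.
Qed.

Lemma ent_trans v F : ent nu (trans v F) = ent nu F.
Proof.
rewrite /ent -[RHS](avg_trans v); last by move=> x x'; apply: ln_pmass_local.
by apply: eq_wsum => z _; rewrite pmass_trans.
Qed.

Lemma Zn_trans v V x : Zn E1 E2 (trans v V) x = Zn E1 E2 V (shift v x) :> R.
Proof. exact: Zc_trans. Qed.

Lemma ln_Zn_local S x x' : agree (boundary S) x x' ->
  ln (Zn E1 E2 S x) = ln (Zn E1 E2 S x') :> R.
Proof. by move=> h; rewrite (Zn_agree E1 E2 h). Qed.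

Lemma Zn_union S U x : [disjoint S & U] -> [disjoint boundary S & U] ->
  Zn E1 E2 (S `|` U) x = Zn E1 E2 S x * Zn E1 E2 U x :> R.
Proof.
move=> SU bSU; rewrite /Zn (Zc_split _ _ _ _ (fsubsetUl S U)).
rewrite (_ : (S `|` U) `\` S = U); last first.
  by rewrite fsetDUl fsetDv fset0U; apply/fsetDidPl; rewrite fdisjoint_sym.
rewrite -wsumZ; apply: eq_wsum => z zx; rewrite mulr1 mulrC; congr (_ * _%:R).
  apply: Zn_agree => u ub; apply: zx; exact: (fdisjointP bSU).
congr nat_of_bool; rewrite /rest (_ : (S `|` U) `\` S = U); last first.
  by rewrite fsetDUl fsetDv fset0U; apply/fsetDidPl; rewrite fdisjoint_sym.
apply: eq_in_all => u uU; have nS w : adj u w -> w \notin S.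
  move=> uw; apply/negP => wS; have : u \in boundary S.
    apply/in_boundary; split; last by exists w; rewrite // adj_sym.
    by apply: contraL uU; apply: (fdisjointP SU).
  by move=> /(fdisjointP bSU); rewrite uU.
by rewrite /resat !(negbTE (nS _ _)) ?adj_e1 ?adj_e2 ?adj_e1N ?adj_e2N.
Qed.

Section Blocks.
Context (S T Delta : {fset Z2}) (TS : [disjoint T & S]) (bT : boundary S `<=` T).

Definition separated vs := [/\ uniq vs, forall v, v \in vs -> trans v T `<=` Delta,
  forall v, v \in vs -> [disjoint trans v S & Delta] &
  forall v w, v \in vs -> w \in vs -> v != w -> [disjoint trans v S & trans w S]].

Lemma separated_cons v vs : separated (v :: vs) ->
  [/\ separated vs, trans v T `<=` Delta, [disjoint trans v S & Delta] &
      [disjoint trans v S & copies vs S]].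
Proof.
case=> /= /andP[vvs u] h1 h2 h3; split; [split=> //| | |].
- by move=> w wvs; apply: h1; rewrite inE wvs orbT.
- by move=> w wvs; apply: h2; rewrite inE wvs orbT.
- by move=> w w' wvs w'vs; apply: h3; rewrite inE ?wvs ?w'vs orbT.
- by apply: h1; rewrite inE eqxx.
- by apply: h2; rewrite inE eqxx.
apply/fdisjointP => w wv; rewrite in_copies; apply/hasP => -[v' v'vs wv'].
have vv' : v != v' by apply: contraNneq vvs => ->.
have /fdisjointP/(_ w wv) : [disjoint trans v S & trans v' S].
  by apply: h3; rewrite // inE ?eqxx ?v'vs ?orbT.
by rewrite in_trans wv'.
Qed.

Lemma separated_disjoint vs : separated vs -> [disjoint Delta & copies vs S].
Proof.
case=> _ _ h2 _; apply/fdisjointP => u uD; rewrite in_copies; apply/hasP => -[v vvs uv].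
by have /fdisjointP/(_ u) := h2 v vvs; rewrite in_trans uv uD => /(_ isT).
Qed.

Lemma ent_copies vs : separated vs ->
  ent nu (Delta `|` copies vs S) <=
  ent nu Delta + (size vs)%:R * (ent nu (S `|` T) - ent nu T).
Proof.
elim: vs => [|v vs IH] sep; first by rewrite fsetU0 mul0r addr0.
have [sep' vT dvD dvC] := separated_cons sep.
have := @ent_mono_sum R A nu (trans v T) (Delta `|` copies vs S) (trans v (S `|` T)).
rewrite !ent_trans => /(_ _ _ _) h.
have {}h : ent nu (Delta `|` copies vs S `|` trans v (S `|` T)) + ent nu T <=
    ent nu (Delta `|` copies vs S) + ent nu (S `|` T).
  apply: h; first by apply: fsubset_trans vT _; apply: fsubsetUl.
    by apply/fsubsetP => u; rewrite !in_trans in_fsetU => ->; rewrite orbT.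
  apply/fdisjointP => u; rewrite !inE !in_trans => /andP[uT uDC]; rewrite (negbTE uT) /= in_fsetU (negbTE uT) orbF.
  apply/negP => uS; have us : u \in trans v S by rewrite in_trans.
  by case/orP: uDC => h'; [have := fdisjointP dvD _ us | have := fdisjointP dvC _ us]; rewrite h'.
have E : Delta `|` copies (v :: vs) S = Delta `|` copies vs S `|` trans v (S `|` T).
  apply/fsetP => u; rewrite /= !(in_fsetU, in_trans) -in_trans; case: (boolP (u \in trans v S)) => //= _.
    by rewrite !orbT.
  case: (boolP (u - v \in T)) => uT; rewrite ?orbF ?orbT //.
  by rewrite (fsubsetP vT) // in_trans.
rewrite E /= -natr1; have := IH sep'; nra.
Qed.

Lemma ln_Zn_copies vs : separated vs ->
  avg nu Delta (fun z => ln (Zn E1 E2 (copies vs S) z)) =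
  (size vs)%:R * avg nu T (fun z => ln (Zn E1 E2 S z)).
Proof.
elim: vs => [|v vs IH] sep.
  rewrite mul0r /avg -[RHS](mul0r (wsum one Delta (pmass nu Delta) (fun=> alphabet_inh A))).
  by rewrite -wsumZ; apply: eq_wsum => z _; rewrite /Zn /Zc wsum0 mulr1 ln1 mulr0 mul0r.
have [sep' vT dvD dvC] := separated_cons sep.
have bv : boundary (trans v S) `<=` trans v T.
  rewrite boundary_trans; apply/fsubsetP => u; rewrite !in_trans; exact: (fsubsetP bT).
have bD : boundary (trans v S) `<=` Delta by apply: fsubset_trans vT.
have bC : [disjoint boundary (trans v S) & copies vs S].
  by apply: fdisjointWl bD _; apply: separated_disjoint.
have Z0 V z : 0 < Zn E1 E2 V z :> R by apply: (Zn_gt0 safeA' a0A').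
rewrite (@eq_avg _ _ _ _ _ (fun z => ln (Zn E1 E2 (trans v S) z) + ln (Zn E1 E2 (copies vs S) z))); last first.
  by move=> z; rewrite /= Zn_union // lnM ?posrE.
rewrite avgD IH //= -natr1 mulrDl mul1r addrC; congr (_ + _).
rewrite (avg_sub nu vT); last first.
  by move=> x x' xx'; apply: ln_Zn_local; apply: agree_sub xx'.
rewrite -[RHS](avg_trans v); last first.
  by move=> x x' xx'; apply: ln_Zn_local; apply: agree_sub xx'.
by apply: eq_avg => z; rewrite Zn_trans.
Qed.

Lemma boundary_copies vs : separated vs -> boundary (copies vs S) `<=` Delta.
Proof.
case=> _ h1 _ _; apply/fsubsetP => u /in_boundary[uC [w]]; rewrite in_copies => /hasP[v vvs wv] wu.
apply: (fsubsetP (h1 v vvs)); rewrite in_trans; apply: (fsubsetP bT); apply/in_boundary.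
split; last by exists (w - v) => //; rewrite -(adjD v) !subrK.
by apply: contra uC => uS; rewrite in_copies; apply/hasP; exists v.
Qed.

Lemma blocks_deficit vs : separated vs ->
  (size vs)%:R * (ent nu T + avg nu T (fun z => ln (Zn E1 E2 S z)) - ent nu (S `|` T)) <=
  ln (Nf (Delta `|` copies vs S)) - ent nu (Delta `|` copies vs S).
Proof.
move=> sep; have h1 := ent_copies sep; have h2 := ln_Zn_copies sep.
have := pressure_bound safeA' a0A' nuX (separated_disjoint sep) (boundary_copies sep).
by rewrite h2; lra.
Qed.

End Blocks.

Context (tight : forall e : R, 0 < e -> exists L, forall n, (L <= n)%N ->
  ln (Nf (box n n)) - ent nu (box n n) <= e * (n * n)%:R).

Lemma deficit_le0 S T : [disjoint T & S] -> boundary S `<=` T ->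
  ent nu T + avg nu T (fun z => ln (Zn E1 E2 S z)) - ent nu (S `|` T) <= 0.
Proof.
move=> TS bT; set c := (X in X <= 0); rewrite leNgt; apply/negP => c0.
have [r Wr] := fset_in_ball (S `|` T) 0; pose l := (2 * r).+1.
have l0 : (0 : R) < (l * l)%:R by rewrite ltr0n.
have [|L HL] := tight (e := c / (2 * (l * l)%:R)); first by rewrite divr_gt0 // mulr_gt0.
have [k kL] : exists k, k = L.+1 by exists L.+1.
pose n := (k * l)%N.
pose vs : seq Z2 := [seq ((r.+1 + i * l)%N%:Z, (r.+1 + j * l)%N%:Z) | i <- iota 0 k, j <- iota 0 k].
have sz : size vs = (k * k)%N by rewrite size_allpairs !size_iota.
have vsP v : v \in vs -> exists i j, [/\ (i < k)%N, (j < k)%N & v = ((r.+1 + i * l)%N%:Z, (r.+1 + j * l)%N%:Z)].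
  by case/allpairsP => -[i j] /= []; rewrite !mem_iota !add0n => ? ? ->; exists i, j.
have near v u : u - v \in S `|` T -> (`|u.1 - v.1| <= r%:Z) && (`|u.2 - v.2| <= r%:Z).
  by move=> /(fsubsetP Wr); rewrite in_ball /= !subr0.
have inj v w u : v \in vs -> w \in vs -> u - v \in S `|` T -> u - w \in S `|` T -> v = w.
  move=> /vsP[i [j [_ _ ->]]] /vsP[i' [j' [_ _ ->]]] /near /= /andP[n1 n2] /near /= /andP[n3 n4].
  have key (a b : nat) (t : int) : `|t - (r.+1 + a * l)%N%:Z| <= r%:Z -> `|t - (r.+1 + b * l)%N%:Z| <= r%:Z -> a = b.
    rewrite !ler_norml !PoszD !PoszM /l => /andP[? ?] /andP[? ?]; apply/eqP; rewrite eqn_leq; apply/andP.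
    by split; rewrite leqNgt; apply/negP => ?; nia.
  by rewrite (key _ _ _ n1 n3) (key _ _ _ n2 n4).
have inL v u : v \in vs -> u - v \in S `|` T -> u \in box n n.
  move=> /vsP[i [j [ik jk ->]]] /near /=; rewrite in_box !ler_norml !PoszD !PoszM /n /l => /andP[/andP[? ?] /andP[? ?]].
  by apply/andP; split; apply/andP; split; nia.
pose Delta := box n n `\` copies vs S.
have DE : Delta `|` copies vs S = box n n.
  rewrite fsetUDr fsetDv fsetD0; apply/fsetUidPl; apply/fsubsetP => u.
  by rewrite in_copies => /hasP[v vvs uv]; apply: (inL v) => //; rewrite in_fsetU uv.
have sep : separated S T Delta vs.
  split.
  - apply: allpairs_uniq; rewrite ?iota_uniq // => -[i j] [i' j'] _ _ /= [].
    by move=> /addnI/eqP; rewrite eqn_pmul2r // => /eqP -> /addnI/eqP; rewrite eqn_pmul2r // => /eqP ->.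
  - move=> v vvs; apply/fsubsetP => u; rewrite in_trans inE => uT.
    have uW : u - v \in S `|` T by rewrite in_fsetU uT orbT.
    rewrite (inL v) // andbT in_copies; apply/hasP => -[w wvs uw].
    have vw : v = w by apply: (inj v w u) => //; rewrite in_fsetU uw.
    by move: (fdisjointP TS _ uT); rewrite vw uw.
  - move=> v vvs; apply/fdisjointP => u; rewrite in_trans inE negb_and negbK => uS.
    by rewrite in_copies; apply/orP; left; apply/hasP; exists v.
  - move=> v w vvs wvs vw; apply/fdisjointP => u; rewrite !in_trans => uv; apply/negP => uw.
    by case/eqP: vw; apply: (inj v w u); rewrite // in_fsetU ?uv ?uw.
have := blocks_deficit bT sep; rewrite DE sz -/c.
have : ln (Nf (box n n)) - ent nu (box n n) <= c / (2 * (l * l)%:R) * (n * n)%:R.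
  by apply: HL; rewrite /n kL /l; nia.
have -> : c / (2 * (l * l)%:R) * (n * n)%:R = c / 2 * (k * k)%:R.
  by rewrite /n !natrM; field; rewrite pnatr_eq0.
have k0 : (0 : R) < (k * k)%:R by rewrite ltr0n kL.
nra.
Qed.

Lemma lanford_ruelle : dlr E1 E2 (pmass nu).
Proof.
move=> S T x bT TS; have c0 := deficit_le0 TS bT.
have Z0 z : 0 < Zn E1 E2 S z :> R by apply: (Zn_gt0 safeA' a0A').
pose b z : R := (adm E1 E2 S z)%:R / Zn E1 E2 S z * pmass nu T z.
have m0 z : 0 <= pmass nu (S `|` T) z by apply: pmass_ge0.
have b0 z : 0 <= b z by rewrite /b mulr_ge0 ?pmass_ge0 // divr_ge0 // ltW.
have pos z : 0 < pmass nu (S `|` T) z -> b z = pmass nu T z / Zn E1 E2 S z /\ 0 < pmass nu T z.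
  move=> h; have [t tX tz] := pmass_adm nuX h; split; last first.
    by apply: lt_le_trans h _; apply: pmass_le; apply: fsubsetUr.
  rewrite /b (_ : adm E1 E2 S z) ?mul1r 1?mulrC //.
  rewrite -(adm_agree E1 E2 (x := t)); first by apply/admP.
    by move=> u uS; apply: tz; rewrite in_fsetU uS.
  by move=> u uS; apply: tz; rewrite in_fsetU (fsubsetP bT _ uS) orbT.
have gt z : pmass nu (S `|` T) z * (ln (b z) - ln (pmass nu (S `|` T) z)) <=
    b z - pmass nu (S `|` T) z ?= iff (pmass nu (S `|` T) z == b z).
  by apply: gibbs_term => // /pos[-> p]; rewrite divr_gt0.
have ST : [disjoint S & T] by rewrite fdisjoint_sym.
pose D z := b z - pmass nu (S `|` T) z - pmass nu (S `|` T) z * (ln (b z) - ln (pmass nu (S `|` T) z)).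
have D0 z : 0 <= D z by rewrite subr_ge0; exact: (gt z).1.
have sb y : wsum one (S `|` T) b y = 1.
  rewrite fsetUC wsumU // -(wsum_pmass nu T y); apply: eq_wsum => z _.
  rewrite -[RHS]mul1r -(divff (lt0r_neq0 (Z0 z))) {1}/Zn /Zc -!wsumZr.
  apply: eq_wsum => z' z'z; rewrite mulr1 /b.
  have zT : agree T z' z by move=> u uT; apply: z'z; apply: (fdisjointP TS).
  by rewrite (pmass_agree nu zT) (Zn_agree E1 E2 (y' := z)) // => u ub; apply/zT/(fsubsetP bT).
have sD : wsum one (S `|` T) D (fun=> a0) <= 0.
  rewrite /D !wsumB sb wsum_pmass subrr sub0r oppr_le0.
  have -> : wsum one (S `|` T) (fun z => pmass nu (S `|` T) z * (ln (b z) - ln (pmass nu (S `|` T) z))) (fun=> a0)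
    = - (ent nu T + avg nu T (fun z => ln (Zn E1 E2 S z)) - ent nu (S `|` T)).
    have TU : T `<=` S `|` T by apply: fsubsetUr.
    rewrite (entE nu TU) -(@avg_sub _ _ _ _ _ _ TU); last first.
      by move=> z z' zz'; apply: ln_Zn_local; apply: agree_sub zz'.
    rewrite /ent -!avgN -!avgD -avgN -(avg_base nu (fun=> a0)); last first.
      move=> z z' zz'; have zT := agree_sub TU zz'.
      rewrite (pmass_agree nu zT) (pmass_agree nu zz') (Zn_agree E1 E2 (y' := z')) //.
      exact: agree_sub zT.
    apply: eq_wsum => z _; have := m0 z; rewrite le_eqVlt => /orP[/eqP <-|h]; first by rewrite !mul0r.
    have [-> p] := pos z h; rewrite ln_div ?posrE //; ring.
  by rewrite oppr_ge0.
have sD0 : wsum one (S `|` T) D (fun=> a0) = 0.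
  by apply/eqP; rewrite eq_le sD; apply: wsum_ge0.
pose x' : Z2 -> A := glue (restr (S `|` T) x) (fun=> a0).
have xx' : agree (S `|` T) x x'.
  by move=> u uW; rewrite /x' -[u]/(val [` uW]) glueE ffunE.
have Dx : D x' = 0.
  apply/eqP; rewrite eq_le D0 andbT -sD0; apply: wsum_one_ge => // u uW.
  by rewrite /x' glue_off.
have /eqP : pmass nu (S `|` T) x' == b x' by rewrite -(gt x').2 eq_sym -subr_eq0 -/(D x') Dx.
rewrite -(pmass_agree nu xx') => ->; rewrite /b.
have xT : agree T x x' by apply: agree_sub xx'; apply: fsubsetUr.
have xS : agree S x x' by apply: agree_sub xx'; apply: fsubsetUl.
have xb : agree (boundary S) x x' by apply: agree_sub xT.
rewrite -(pmass_agree nu xT) -(Zn_agree E1 E2 xb) -(adm_agree E1 E2 xS xb).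
by rewrite mulrAC divfK // lt0r_neq0.
Qed.

End LanfordRuelle.

Lemma interior_rate (R : realType) (x y c d n : R) : 0 <= x -> 0 <= y -> 0 < d -> 0 <= c -> 8 * c <= d * (x + 2) ->
  8 * c <= d * (y + 2) -> - (d / 2 * (x * y)) + x * y * c <= n -> (c - d) * ((x + 2) * (y + 2)) <= n.
Proof.
move=> x0 y0 d0 c0 h1 h2; apply: le_trans.
have k1 : 8 * c * (y + 2) <= d * (x + 2) * (y + 2) by apply: ler_wpM2r => //; lra.
have k2 : 8 * c * (x + 2) <= d * (y + 2) * (x + 2) by apply: ler_wpM2r => //; lra.
have k3 : 0 <= d * x by rewrite mulr_ge0 // ltW.
have k4 : 0 <= d * y by rewrite mulr_ge0 // ltW.
have k5 : 0 <= d * x * y by rewrite mulr_ge0.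
have k6 : 0 <= c * x by rewrite mulr_ge0.
have k7 : 0 <= c * y by rewrite mulr_ge0.
lra.
Qed.

Section EntropyRate.
Context {R : realType} {A : alphabet}.
Implicit Types (nu : probability (borel_config A) R).

Definition ent_rate nu (j : nat * nat) : R := ent nu (box j.1 j.2) / (j.1 * j.2)%:R.

Lemma entropyE nu : entropy nu = lim (ent_rate nu @ filter_prod \oo \oo).
Proof.
rewrite /entropy; set f := (fun j : nat * nat => _); suff -> : f = ent_rate nu by [].
apply/funext => -[j1 j2]; rewrite /f /=.
rewrite /ent_rate /= mulNr mulrC -mulNr; congr (_ * _).
rewrite /ent /avg wsum_oneE -sumrN; apply: eq_bigr => w _.
by rewrite (mass_glue nu w (fun=> alphabet_inh A)) mulrN.
Qed.

Lemma entropy_not_cvg nu : ~ cvg (ent_rate nu @ filter_prod \oo \oo) -> entropy nu = 0.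
Proof.
move=> ncv; rewrite entropyE; exact: (dvgP ncv).
Qed.

End EntropyRate.

Section MaximalEntropy.
Context {R : realType} {A : alphabet} (E1 E2 : {set A * A}).
Context (A' : {set A}) (safeA' : forall a, a \in A' -> safe_symbol E1 E2 a).
Context (a0 : A) (a0A' : a0 \in A').
Context (p rho C : R) (p01 : 0 <= p <= 1) (qp : 1 - #|A'|%:R / #|A|%:R <= p).
Context (rho01 : 0 < rho < 1) (C1 : 1 <= C).
Context (decay : forall (V : {fset Z2}) u r, u \notin V ->
  perc p V (pred1 u) (far u r) <= C * rho ^+ r).
Context (h : R) (hP : forall m, `|- ln (pi_ E1 E2 a0 m) - h| <= #|A|%:R * C * rho ^+ m).
Implicit Types (mu nu : probability (borel_config A) R).
Local Notation Nf := (@Nf R A E1 E2 a0).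
Local Notation X := (sft E1 E2).

Let growth e := @ln_Nf_box R A E1 E2 A' safeA' a0 a0A' p rho C p01 qp rho01 C1 decay h hP e.

Lemma growth_ge0 : 0 <= h.
Proof.
apply/ler_addgt0Pr => e e0; have [L HL] := growth e0.
have := HL L.+1 L.+1 (leqnSn L) (leqnSn L); rewrite ler_norml => /andP[_].
have l0 : (0 : R) < (L.+1 * L.+1)%:R by rewrite ltr0n.
have : 0 <= ln (Nf (box L.+1 L.+1)) by rewrite ln_ge0 // (Nf_ge1 safeA' a0A').
move=> n0 n1; rewrite -(pmulr_rge0 _ l0); lra.
Qed.

Lemma near_pairs (P : nat * nat -> Prop) L : (forall j1 j2, (L <= j1)%N -> (L <= j2)%N -> P (j1, j2)) ->
  \forall j \near filter_prod \oo \oo, P j.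
Proof.
move=> HP; exists ([set n | (L <= n)%N], [set n | (L <= n)%N]) => /=.
  by split; exists L.
by move=> [j1 j2] /= [l1 l2]; apply: HP.
Qed.

Lemma ent_rate_upper nu e : supported_on X nu -> 0 < e ->
  exists L, forall j1 j2, (L <= j1)%N -> (L <= j2)%N -> ent_rate nu (j1, j2) <= h + e.
Proof.
move=> nuX e0; have [L HL] := growth e0; exists L.+1 => j1 j2 l1 l2.
have j0 : (0 : R) < (j1 * j2)%:R by rewrite ltr0n muln_gt0 (leq_trans _ l1) // (leq_trans _ l2).
rewrite /ent_rate /= ler_pdivrMr //; apply: le_trans (ent_upper safeA' a0A' nuX _) _.
by have := HL j1 j2 (ltnW l1) (ltnW l2); rewrite ler_norml; lra.
Qed.

Lemma entropy_le nu : supported_on X nu -> entropy nu <= h.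
Proof.
move=> nuX; have [cv|/entropy_not_cvg ->] := pselect (cvg (ent_rate nu @ filter_prod \oo \oo)); last exact: growth_ge0.
rewrite entropyE; apply/ler_addgt0Pr => e e0; apply: limr_le => //.
by have [L HL] := ent_rate_upper nuX e0; apply: (near_pairs (L := L)).
Qed.

Lemma ent_rate_dlr mu : dlr E1 E2 (pmass mu) -> ent_rate mu @ filter_prod \oo \oo --> h.
Proof.
move=> D; have muX := dlr_supported safeA' a0A' D.
apply/cvgrPdist_le => e e0.
have [L1 HL1] := ent_rate_upper muX e0.
have [|L2 HL2] := @growth (e / 2); first by rewrite divr_gt0.
pose L3 := (Num.truncn (8 * h / e)).+1.
apply: (near_pairs (L := (L1 + L2 + L3).+3)) => j1 j2 l1 l2.
rewrite distrC ler_distl; apply/andP; split; last by apply: HL1; lia.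
have [k1 j1E] : exists k, j1 = k.+2 by exists j1.-2; lia.
have [k2 j2E] : exists k, j2 = k.+2 by exists j2.-2; lia.
pose I := trans (1, 1) (box k1 k2).
have IV : I `<=` box j1 j2.
  apply/fsubsetP => u; rewrite in_trans !in_box j1E j2E; case: u => u1 u2 /= /andP[/andP[? ?] /andP[? ?]].
  by apply/andP; split; apply/andP; split; lia.
have bIV : boundary I `<=` box j1 j2.
  apply/fsubsetP => u /in_boundary[_ [w]]; rewrite in_trans !in_box j1E j2E /adj.
  case: u w => u1 u2 [w1 w2] /= /andP[/andP[? ?] /andP[? ?]] /eqP ?.
  by apply/andP; split; apply/andP; split; lia.
have := ent_lower safeA' a0A' D IV bIV; rewrite Nf_trans => low.
have l2k : (L2 <= k1)%N && (L2 <= k2)%N by clear -l1 l2 j1E j2E; apply/andP; split; lia.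
case/andP: l2k => lk1 lk2; have := HL2 k1 k2 lk1 lk2; rewrite ler_norml => /andP[low2 _].
have k10 : (0 : R) < k1.+2%:R by rewrite ltr0n.
have k20 : (0 : R) < k2.+2%:R by rewrite ltr0n.
have kk (k j : nat) : j = k.+2 -> (L3 <= j)%N -> 8 * h <= e * j%:R.
  move=> _ lj; rewrite [leRHS]mulrC -ler_pdivrMr //; apply: le_trans (ltW (truncnS_gt _)) _.
  by rewrite ler_nat.
have := kk _ _ j1E; have := kk _ _ j2E => h2 h1.
have {}h1 : 8 * h <= e * j1%:R by apply: h1; clear -l1; lia.
have {}h2 : 8 * h <= e * j2%:R by apply: h2; clear -l2; lia.
rewrite /ent_rate /= j1E j2E in h1 h2 low *.
have j12 : (0 : R) < (k1.+2 * k2.+2)%:R by rewrite ltr0n.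
rewrite ler_pdivlMr //; apply: le_trans low; move: low2 => low2.
have kE k : k.+2%:R = k%:R + 2 :> R by rewrite -addn2 natrD.
rewrite !natrM !(kE k1, kE k2) in h1 h2 *; rewrite natrM in low2.
have h0 := growth_ge0.
have n1 : (0 : R) <= k1%:R by []. have n2 : (0 : R) <= k2%:R by [].
apply: interior_rate h1 h2 _ => //.
by move: low2; rewrite lerBrDr.
Qed.

Lemma max_entropy_exists : exists mu : probability (borel_config A) R,
  [/\ dlr E1 E2 (pmass mu), shift_invariant mu &
      forall F x, pmass mu F x = Mf E1 E2 a0 F x :> R].
Proof.
have [mu muM] : exists mu : probability (borel_config A) R, forall F x, pmass mu F x = Mf E1 E2 a0 F x :> R.
  apply: kolmogorov.
  - by move=> F x; apply: (Mf_ge0 safeA' a0A' p01 qp rho01 C1 decay).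
  - by move=> x; apply: (Mf0 safeA' a0A').
  - by move=> F x y; apply: Mf_agree.
  - by move=> F v x vF; apply: (Mf_split safeA' a0A' p01 qp rho01 C1 decay).
exists mu; split => //.
- have := Mf_dlr safeA' a0A' p01 qp rho01 C1 decay.
  by move=> D S T x bT TS; rewrite !muM; apply: D.
- apply: pmass_invariant => v F x; rewrite !muM.
  exact: (Mf_trans safeA' a0A' p01 qp rho01 C1 decay).
Qed.

Lemma dlr_unique mu F x : dlr E1 E2 (pmass mu) -> pmass mu F x = Mf E1 E2 a0 F x :> R.
Proof.
move=> D; apply/eqP; rewrite -subr_eq0 -normr_le0; apply/ler_addgt0Pr => e e0; rewrite add0r.
have [r Hr] := Mf_deep safeA' a0A' p01 qp rho01 C1 decay F x e0.
have [N HN] := deep_ball F 0 r.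
pose V := ball 0 N.
have FV w : w \in F -> ball w r `<=` V by move=> wF; apply: HN.
have FsV : F `<=` V by apply/fsubsetP => w wF; apply: (fsubsetP (FV w wF)); apply: ball_center.
rewrite (dlr_average safeA' a0A' x x D FsV).
have K c : c = wsum one (boundary V) (fun z => pmass mu (boundary V) z * c) x.
  by rewrite wsumZr wsum_pmass mul1r.
have o0 (a : A) : 0 <= one a :> R by [].
rewrite ler_distl; apply/andP; split.
  rewrite [leLHS]K; apply: le_wsum => // z _; apply: ler_wpM2l; first exact: pmass_ge0.
  by have := Hr V z FV; rewrite ler_distl => /andP[].
rewrite [leRHS]K; apply: le_wsum => // z _; apply: ler_wpM2l; first exact: pmass_ge0.
by have := Hr V z FV; rewrite ler_distl => /andP[].
Qed.

Lemma entropy_dlr mu : dlr E1 E2 (pmass mu) -> entropy mu = h.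
Proof. by move=> /ent_rate_dlr D; rewrite entropyE; apply/cvg_lim. Qed.

Lemma topological_entropyE : topological_entropy R X = h.
Proof.
have [mu [D inv _]] := max_entropy_exists.
have muX := dlr_supported safeA' a0A' D.
apply/eqP; rewrite eq_le /topological_entropy; apply/andP; split.
  apply: ge_sup; first by exists (entropy mu), mu.
  by move=> _ [nu [_ nuX ->]]; apply: entropy_le.
apply: ub_le_sup; first by exists h => _ [nu [_ nuX ->]]; apply: entropy_le.
by exists mu; split => //; rewrite (entropy_dlr D).
Qed.

Lemma max_entropy_dlr nu : max_entropy X nu -> dlr E1 E2 (pmass nu).
Proof.
move=> [inv nuX]; rewrite topological_entropyE => nuh.
apply: (lanford_ruelle safeA' a0A' inv nuX) => e e0.
have [|L HL] := @growth (e / 2); first by rewrite divr_gt0.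
have up n : (L <= n)%N -> ln (Nf (box n n)) <= (h + e / 2) * (n * n)%:R.
  by move=> ln; have := HL n n ln ln; rewrite ler_norml; lra.
suff [L2 HL2] : exists L2, forall n, (L2 <= n)%N -> (h - e / 2) * (n * n)%:R <= ent nu (box n n).
  exists (maxn L L2) => n; rewrite geq_max => /andP[/up u /HL2 v]; lra.
have [cv|nc] := pselect (cvg (ent_rate nu @ filter_prod \oo \oo)); last first.
  move/entropy_not_cvg: nc; rewrite nuh => h0; exists 0%N => n _.
  apply: le_trans (ent_ge0 _ _) => //; rewrite h0 sub0r mulNr oppr_le0.
  by rewrite mulr_ge0 // ltW // divr_gt0.
move: cv; rewrite -entropyE nuh => /cvgrPdist_le /(_ (e / 2)) [|[P Q] /= [[N1 _ HP] [N2 _ HQ]] PQ].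
  by rewrite divr_gt0.
exists (maxn N1 N2).+1 => n Ln.
have n0 : (0 : R) < (n * n)%:R by rewrite ltr0n muln_gt0; lia.
have l1 : (N1 <= n)%N by lia.
have l2 : (N2 <= n)%N by lia.
have /= := PQ (n, n) (conj (HP n l1) (HQ n l2)).
rewrite ler_norml => /andP[_]; rewrite /ent_rate /= lerBlDr -lerBlDl ler_pdivlMr //.
Qed.

Lemma unique_max_entropy : 1 - p_c R < #|A'|%:R / #|A|%:R ->
  exists mu : probability (borel_config A) R,
   [/\ max_entropy (sft E1 E2) mu,
       (forall nu : probability (borel_config A) R,
          max_entropy (sft E1 E2) nu ->
          forall B : set (borel_config A), measurable B -> nu B = mu B),
       is_MRF mu
     & exists L : specification R A,
         [/\ associated mu L, spec_invariant L & spec_q L < p_c R]].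
Proof.
move=> ratioA'; have [mu [D inv muM]] := max_entropy_exists; exists mu; split.
- split => //; first exact: (dlr_supported safeA' a0A' D).
  by rewrite (entropy_dlr D) topological_entropyE.
- move=> nu /max_entropy_dlr Dn; apply: pmass_inj => F x.
  by rewrite muM (dlr_unique _ _ Dn).
- exact: (dlr_mrf safeA' a0A' D).
exists (uniform_spec safeA' a0A'); split.
- exact: dlr_associated.
- exact: uniform_spec_invariant.
- by apply: le_lt_trans (uniform_spec_q _ _) _; rewrite ltrBlDr addrC -ltrBlDr.
Qed.

End MaximalEntropy.

Lemma maximal_entropy_theorem (R : realType) (A : alphabet) (E1 E2 : {set A * A})
    (A' : {set A}) (safeA' : forall a : A, a \in A' -> safe_symbol E1 E2 a)
    (ratioA' : 1 - p_c R < #|A'|%:R / #|A|%:R) :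
  (exists mu : probability (borel_config A) R,
     [/\ max_entropy (sft E1 E2) mu,
         (forall nu : probability (borel_config A) R,
            max_entropy (sft E1 E2) nu ->
            forall B : set (borel_config A), measurable B -> nu B = mu B),
         is_MRF mu
       & exists L : specification R A,
           [/\ associated mu L, spec_invariant L & spec_q L < p_c R]]) /\
  exists a0 (rho C : R), [/\ a0 \in A', 0 < rho < 1, 0 <= C &
    forall m, `|- ln (pi_ E1 E2 a0 m) - topological_entropy R (sft E1 E2)| <= C * rho ^+ m].
Proof.
have A0 : (0 : R) < #|A|%:R by rewrite ltr0n ltnW // card_letter.
have s1 : #|A'|%:R / #|A|%:R <= 1 :> R by rewrite ler_pdivrMr // mul1r ler_nat max_card.
have [p [rho [C [p01 qp rho01 C1 decay]]]] := subcritical_decay s1 ratioA'.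
have [a0 a0A'] : exists a0, a0 \in A'.
  apply/set0Pn/negP => /eqP E; move: ratioA'; rewrite E cards0 mul0r ltNge => /negP; apply.
  by rewrite subr_ge0 p_c_le1.
have [h hP] := growth_exists safeA' a0A' p01 qp rho01 C1 decay.
split; first exact: (unique_max_entropy safeA' a0A' p01 qp rho01 C1 decay hP).
exists a0, rho, (#|A|%:R * C); split => //; first by rewrite mulr_ge0 // (le_trans ler01).
by rewrite (topological_entropyE safeA' a0A' p01 qp rho01 C1 decay hP).
Qed.

(** * A programming language for Turing machines *)

Section Programs.
Local Open Scope nat_scope.

Definition sym := tape_symbol unit.
Definition mark : sym := Some (inr tt).
Definition instr := (nat * (sym -> sym * move * nat))%type.

Inductive cmd :=
  | Act of nat & (sym -> sym * move)
  | Seq of cmd & cmd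
  | If of nat & (sym -> bool) & cmd & cmd
  | While of nat & (sym -> bool) & cmd.

Fixpoint csize (c : cmd) : nat := match c with
  | Act _ _ => 1
  | Seq a b => csize a + csize b
  | If _ _ a b => (csize a + csize b).+2
  | While _ _ a => (csize a).+2
  end.

Definition goto k (n : nat) : instr := (k, fun x => (x, Stay, n)).

Fixpoint comp (c : cmd) (pc : nat) : seq instr := match c with
  | Act k f => [:: (k, fun x => (f x, pc.+1))]
  | Seq a b => comp a pc ++ comp b (pc + csize a)
  | If k P a b =>
      (k, fun x => (x, Stay, if P x then pc.+1 else pc + (csize a).+2)) ::
      comp a pc.+1 ++ goto k (pc + (csize a + csize b).+2) :: comp b (pc + (csize a).+2)
  | While k P a =>
      (k, fun x => (x, Stay, if P x then pc.+1 else pc + (csize a).+2)) ::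
      rcons (comp a pc.+1) (goto k pc)
  end.

Lemma size_comp c pc : size (comp c pc) = csize c.
Proof.
elim: c pc => //= [a IHa b IHb|k P a IHa b IHb|k P a IHa] pc.
- by rewrite size_cat IHa IHb.
- by rewrite size_cat /= IHa IHb addnS.
- by rewrite size_rcons IHa.
Qed.

Definition tape := (int * (int -> sym))%type.
Definition rd (z : tape) : sym := z.2 z.1.
Definition do_tape (z : tape) (a : sym * move) : tape :=
  ((z.1 + displacement a.2)%R, fun x => if x == z.1 then a.1 else z.2 x).

Lemma do_tape_id z : do_tape z (rd z, Stay) = z.
Proof.
case: z => h f; rewrite /do_tape /rd /= addr0; congr pair.
by apply/funext => x; case: eqP => // ->.
Qed.

Definition setat T (s : nat -> T) (k : nat) (v : T) : nat -> T :=
  fun i => if i == k then v else s i.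

Lemma setat_id T (s : nat -> T) k : setat s k (s k) = s.
Proof. by apply/funext => i; rewrite /setat; case: eqP => // ->. Qed.

Definition state := (nat -> tape).

Definition rstep (P : seq instr) (c : nat * state) : nat * state :=
  if c.1 < size P then
    let i := nth (goto 0 0) P c.1 in
    let r := i.2 (rd (c.2 i.1)) in
    (r.2, setat c.2 i.1 (do_tape (c.2 i.1) r.1))
  else c.

Definition runs (c : cmd) (s : state) (T : nat) (s' : state) : Prop :=
  forall p1 p2, exists2 t, t <= T &
    iter t (rstep (p1 ++ comp c (size p1) ++ p2)) (size p1, s) = (size p1 + csize c, s').

Lemma rstep_at p1 i p2 s : rstep (p1 ++ i :: p2) (size p1, s) =
  let r := i.2 (rd (s i.1)) in (r.2, setat s i.1 (do_tape (s i.1) r.1)).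
Proof. by rewrite /rstep /= size_cat /= addnS ltnS leq_addr nth_cat ltnn subnn. Qed.

Lemma runs_weaken c s T T' s' : T <= T' -> runs c s T s' -> runs c s T' s'.
Proof. by move=> TT r p1 p2; have [t tT e] := r p1 p2; exists t => //; apply: leq_trans TT. Qed.

Lemma runs_act k f s : runs (Act k f) s 1 (setat s k (do_tape (s k) (f (rd (s k))))).
Proof. by move=> p1 p2; exists 1 => //=; rewrite rstep_at addn1. Qed.

Lemma runs_seq a b s1 T1 s2 T2 s3 :
  runs a s1 T1 s2 -> runs b s2 T2 s3 -> runs (Seq a b) s1 (T1 + T2) s3.
Proof.
move=> ra rb p1 p2 /=.
have [t1 l1 e1] := ra p1 (comp b (size p1 + csize a) ++ p2).
have := rb (p1 ++ comp a (size p1)) p2; rewrite size_cat size_comp => -[t2 l2 e2].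
exists (t2 + t1); first by rewrite addnC leq_add.
by rewrite iterD -catA e1; move: e2; rewrite -catA addnA.
Qed.

Lemma runs_if k P a b s T s' : runs (if P (rd (s k)) then a else b) s T s' ->
  runs (If k P a b) s T.+2 s'.
Proof.
move=> r p1 p2 /=.
set i0 : instr := (k, _); set g := goto k _.
have E0 := rstep_at p1 i0 (comp a (size p1).+1 ++ g :: comp b (size p1 + (csize a).+2) ++ p2) s.
rewrite /= do_tape_id setat_id in E0; rewrite -catA cat_cons.
case: (P (rd (s k))) r E0 => r E0.
  have := r (rcons p1 i0) (g :: comp b (size p1 + (csize a).+2) ++ p2).
  rewrite size_rcons cat_rcons => -[t tT e].
  exists (1 + (t + 1)); first by lia.
  rewrite iterD iterD /= E0 e.
  have -> : p1 ++ i0 :: comp a (size p1).+1 ++ g :: comp b (size p1 + (csize a).+2) ++ p2 =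
    (p1 ++ i0 :: comp a (size p1).+1) ++ g :: comp b (size p1 + (csize a).+2) ++ p2 by rewrite -catA.
  have sz : (size p1).+1 + csize a = size (p1 ++ i0 :: comp a (size p1).+1).
    by rewrite size_cat /= size_comp addnS.
  by rewrite sz rstep_at /= do_tape_id setat_id.
have := r (p1 ++ i0 :: rcons (comp a (size p1).+1) g) p2.
rewrite -!catA /= cat_rcons size_cat /= size_rcons size_comp => -[t tT e].
exists (t + 1); first by lia.
rewrite iterD /= E0; move: e; rewrite !addnS => ->.
by congr pair; lia.
Qed.

Lemma runs_while0 k (P : sym -> bool) a s : ~~ P (rd (s k)) -> runs (While k P a) s 1 s.
Proof.
move=> /negbTE P0 p1 p2; exists 1 => //=.
by rewrite rstep_at /= P0 do_tape_id setat_id.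
Qed.

Lemma runs_whileS k (P : sym -> bool) a s T1 s1 T2 s2 : P (rd (s k)) -> runs a s T1 s1 ->
  runs (While k P a) s1 T2 s2 -> runs (While k P a) s (T1 + T2).+2 s2.
Proof.
move=> P1 r1 r2 p1 p2; have [t2 l2 e2] := r2 p1 p2.
move: e2; rewrite /=; set i0 : instr := (k, _); rewrite cat_rcons => e2.
have E0 := rstep_at p1 i0 (comp a (size p1).+1 ++ goto k (size p1) :: p2) s.
rewrite /= P1 do_tape_id setat_id in E0.
have := r1 (rcons p1 i0) (goto k (size p1) :: p2).
rewrite size_rcons cat_rcons => -[t1 l1 e1].
exists (t2 + (1 + (t1 + 1))); first by lia.
rewrite 3!iterD /= E0 e1.
have -> : p1 ++ i0 :: comp a (size p1).+1 ++ goto k (size p1) :: p2 =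
    (p1 ++ i0 :: comp a (size p1).+1) ++ goto k (size p1) :: p2 by rewrite -catA.
have sz : (size p1).+1 + csize a = size (p1 ++ i0 :: comp a (size p1).+1).
  by rewrite size_cat /= size_comp addnS.
by rewrite sz rstep_at /= do_tape_id setat_id -catA e2.
Qed.

(** [tp v g] is a tape with the mark at cell [-1], [g] to the right of it, and
   the head at [v - 1]: it stores the number [v]. *)
Definition mtape (g : nat -> sym) (x : int) : sym :=
  match x with Posz i => g i | Negz 0 => mark | Negz _ => None end.
Definition tp (v : nat) (g : nat -> sym) : tape := ((v%:Z - 1)%R, mtape g).

Arguments tp : simpl never.
Arguments rd : simpl never.
Definition nomark (x : sym) : bool := if x is Some (inr _) then false else true.

Lemma headS (v : nat) : (v.+1%:Z - 1)%R = v%:Z. Proof. lia. Qed.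
Lemma rd_tp0 g : rd (tp 0 g) = mark. Proof. by []. Qed.
Lemma rd_tpS v g : rd (tp v.+1 g) = g v.
Proof. by rewrite /rd /tp /fst /snd headS. Qed.

Definition inc k := Act k (fun x => (x, Right)).
Definition dec k := Act k (fun x => (x, if nomark x then Left else Stay)).
Definition put k (b : sym) := Act k (fun x => (if nomark x then b else x, Stay)).

Lemma runs_inc k s v g : s k = tp v g -> runs (inc k) s 1 (setat s k (tp v.+1 g)).
Proof.
move=> sk; have := runs_act k (fun x => (x, Right)) s; rewrite sk /=.
suff -> : do_tape (tp v g) (rd (tp v g), Right) = tp v.+1 g by [].
rewrite /do_tape /tp /rd /fst /snd; congr pair; first by rewrite headS subrK.
by apply/funext => x; case: eqP => // ->.
Qed.

Lemma runs_dec k s v g : (forall i, nomark (g i)) -> s k = tp v g ->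
  runs (dec k) s 1 (setat s k (tp v.-1 g)).
Proof.
move=> gm sk; have := runs_act k (fun x => (x, if nomark x then Left else Stay)) s; rewrite sk /=.
set z := do_tape _ _; suff -> : z = tp v.-1 g by [].
rewrite /z; case: v {sk z} => [|v]; first exact: (do_tape_id (tp 0 g)).
rewrite rd_tpS gm /do_tape /tp /fst /snd headS; congr pair.
by apply/funext => x; case: eqP => // ->.
Qed.

Lemma runs_put k s v g b : (forall i, nomark (g i)) -> s k = tp v.+1 g ->
  runs (put k b) s 1 (setat s k (tp v.+1 (setat g v b))).
Proof.
move=> gm sk; have := runs_act k (fun x => (if nomark x then b else x, Stay)) s.
rewrite sk /= rd_tpS gm; set z := do_tape _ _; suff -> : z = tp v.+1 (setat g v b) by [].
rewrite /z /do_tape /tp /fst /snd headS; congr pair; first by rewrite addr0.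
apply/funext => x; case: x => [i|[|i]] //=.
Qed.

Definition clear k := While k nomark (dec k).

Lemma runs_clear k s v g : (forall i, nomark (g i)) -> s k = tp v g ->
  runs (clear k) s (3 * v).+1 (setat s k (tp 0 g)).
Proof.
move=> gm; elim: v s => [|v IH] s sk.
  by rewrite -sk setat_id; apply: runs_while0; rewrite sk.
have := @runs_dec k s v.+1 g gm sk; set s1 := setat _ _ _ => r1.
have -> : setat s k (tp 0 g) = setat s1 k (tp 0 g).
  by apply/funext => i; rewrite /s1 /setat; case: eqP.
apply: (@runs_weaken _ _ (1 + (3 * v).+1).+2); first by lia.
apply: runs_whileS r1 _; first by rewrite sk rd_tpS gm.
by apply: IH; rewrite /s1 /setat eqxx.
Qed.

Definition blank : nat -> sym := fun=> None.
Definition loop k c := While k nomark (Seq (dec k) c).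

Lemma runs_loop k c n (st : nat -> state) T :
  (forall i, i <= n -> st i k = tp (n - i) blank) ->
  (forall i, i < n -> runs c (setat (st i) k (tp (n - i.+1) blank)) T (st i.+1)) ->
  runs (loop k c) (st 0) (n * (T + 3)).+1 (st n).
Proof.
elim: n st => [|n IH] st sk rc.
  by apply: runs_while0; rewrite sk // rd_tp0.
have H := IH (fun i => st i.+1).
apply: (@runs_weaken _ _ ((1 + T) + (n * (T + 3)).+1).+2); first by lia.
apply: runs_whileS; first by rewrite sk // rd_tpS.
  apply: runs_seq (rc 0 _) => //.
  have s0 := sk 0 isT; rewrite subn0 in s0.
  have -> : n.+1 - 1 = (n.+1).-1 by lia.
  by apply: runs_dec.
by apply: H => i lin; [apply: (sk i.+1) | apply: (rc i.+1)].
Qed.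

End Programs.

Arguments tp : simpl never.
Arguments rd : simpl never.

(** * Polynomial time programs *)

Ltac regs := let i := fresh in move=> i; rewrite /setat; repeat (case: eqP => ? //); subst; try lia.
Section PolynomialPrograms.
Local Open Scope nat_scope.

Definition poly (B : nat -> nat) := exists d, forall X, 2 <= X -> B X <= X ^ d.

Lemma poly_const c : poly (fun=> c).
Proof.
exists c => X X2; apply: leq_trans (ltnW (ltn_expl c (isT : 1 < 2))) _.
by case: c => // c; rewrite leq_exp2r.
Qed.

Lemma poly_exp k : poly (fun X => X ^ k). Proof. by exists k. Qed.

Lemma poly_id : poly id. Proof. by exists 1. Qed.

Lemma poly_mul B1 B2 : poly B1 -> poly B2 -> poly (fun X => B1 X * B2 X).
Proof.
move=> [a Ha] [b Hb]; exists (a + b) => X X2.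
by rewrite expnD leq_mul // ?Ha ?Hb.
Qed.

Lemma poly_add B1 B2 : poly B1 -> poly B2 -> poly (fun X => B1 X + B2 X).
Proof.
move=> [a Ha] [b Hb]; exists (a + b).+1 => X X2.
have X0 : 0 < X by apply: leq_trans X2.
apply: leq_trans (_ : 2 * X ^ (a + b) <= _); last by rewrite expnS leq_mul.
rewrite mul2n -addnn leq_add //.
  by apply: leq_trans (Ha X X2) _; rewrite leq_pexp2l ?leq_addr.
by apply: leq_trans (Hb X X2) _; rewrite leq_pexp2l ?leq_addl.
Qed.

End PolynomialPrograms.

Ltac polyt := repeat first [apply: poly_add | apply: poly_mul | apply: poly_exp | apply: poly_id | apply: poly_const].

Section PolynomialPrograms.
Local Open Scope nat_scope.

Definition bit_sym (b : bool) : sym := if b then Some (inl (Bit true)) else None.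

(** Tape 0 is used for input and output, tape 1 for the bit array [m], and tape
   [k.+2] for the register [r k]. *)
Definition emb (z : tape) (p : nat) (m : nat -> bool) (r : nat -> nat) : state :=
  fun k => match k with
  | 0 => z
  | 1 => tp p (fun i => bit_sym (m i))
  | k'.+2 => tp (r k') blank
  end.

Lemma emb_reg z p m r k v : setat (emb z p m r) k.+2 (tp v blank) = emb z p m (setat r k v).
Proof. by apply/funext => -[|[|i]] //; rewrite /setat /= !eqSS; case: eqP. Qed.

Lemma emb_mem z p m r v : setat (emb z p m r) 1 (tp v (fun i => bit_sym (m i))) = emb z v m r.
Proof. by apply/funext => -[|[|i]]. Qed.

Lemma emb_inc z p m r k : runs (inc k.+2) (emb z p m r) 1 (emb z p m (setat r k (r k).+1)).
Proof. by rewrite -emb_reg; apply: runs_inc. Qed.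

Lemma emb_dec z p m r k : runs (dec k.+2) (emb z p m r) 1 (emb z p m (setat r k (r k).-1)).
Proof. by rewrite -emb_reg; apply: runs_dec. Qed.

Lemma emb_clear z p m r k :
  runs (clear k.+2) (emb z p m r) (3 * r k).+1 (emb z p m (setat r k 0)).
Proof. by rewrite -emb_reg; apply: runs_clear. Qed.

Lemma emb_loop k c n z p m r T :
  (forall i, i <= n -> r i k = n - i) ->
  (forall i, i < n -> runs c (emb (z i) (p i) (m i) (setat (r i) k (n - i.+1))) T
                             (emb (z i.+1) (p i.+1) (m i.+1) (r i.+1))) ->
  runs (loop k.+2 c) (emb (z 0) (p 0) (m 0) (r 0)) (n * (T + 3)).+1
    (emb (z n) (p n) (m n) (r n)).
Proof.
move=> rk rc; apply: (runs_loop (st := fun i => emb (z i) (p i) (m i) (r i))) => i lin /=.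
  by rewrite rk.
by rewrite emb_reg; apply: rc.
Qed.

Lemma emb_bits (m : nat -> bool) i : nomark (bit_sym (m i)). Proof. by case: (m i). Qed.

Lemma emb_eq z p m r r' : r =1 r' -> emb z p m r = emb z p m r'.
Proof. by move=> /funext ->. Qed.

Lemma emb_move k l z p m r : k != l ->
  runs (loop k.+2 (inc l.+2)) (emb z p m r) (r k * 4).+1
    (emb z p m (setat (setat r k 0) l (r l + r k))).
Proof.
move=> /eqP kl.
pose rr i := setat (setat r k (r k - i)) l (r l + i).
have -> : emb z p m r = emb z p m (rr 0) by apply: emb_eq; rewrite /rr; regs.
have -> : emb z p m (setat (setat r k 0) l (r l + r k)) = emb z p m (rr (r k)).
  by apply: emb_eq; rewrite /rr; regs.
apply: (@emb_loop _ _ (r k) (fun=> z) (fun=> p) (fun=> m) rr 1) => i lin.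
  by rewrite /rr /setat; repeat (case: eqP => ? //); subst; lia.
set r0 := setat _ _ _; have := emb_inc z p m r0 l.
suff -> : emb z p m (setat r0 l (r0 l).+1) = emb z p m (rr i.+1) by [].
by apply: emb_eq; rewrite /r0 /rr; regs.
Qed.

Definition scons T (a : T) (e : nat -> T) : nat -> T := fun i => if i is j.+1 then e j else a.
Definition stail T (e : nat -> T) : nat -> T := fun i => e i.+1.

Lemma scons_comp T U (f : T -> U) a e : f \o scons a e = scons (f a) (f \o e).
Proof. by apply/funext => -[]. Qed.

Definition pfun := ((nat -> bool) -> (nat -> nat) -> nat).

Definition pbound (f : pfun) := exists d, forall m e X, 2 <= X -> (forall i, e i <= X) -> f m e <= X ^ d.

(** [c] adds the value of [f] to the register [out], using the registers from
   [t] on, initially and finally [0], as workspace. *)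
Definition pcomp (f : pfun) := exists d, forall loc t out,
  (forall i, loc i < t) -> out < t -> (forall i, loc i != out) ->
  exists c, forall z m r X, 2 <= X -> (forall i, t <= i -> r i = 0) -> (forall i, r (loc i) <= X) ->
    runs c (emb z 0 m r) (X ^ d) (emb z 0 m (setat r out (r out + f m (r \o loc)))).

Definition PC f := pbound f /\ pcomp f.

Lemma PC_ext f g : (forall m e, f m e = g m e) -> PC f -> PC g.
Proof. by move=> fg; have -> // : f = g; apply/funext => m; apply/funext. Qed.

Lemma PC_var j : PC (fun m e => e j).
Proof.
split; first by exists 1 => m e X _ eX; rewrite expn1.
have [d Hd] : poly (fun X => (X * (2 + 3)).+1 + (X * 4).+1).
  have -> : (fun X => (X * (2 + 3)).+1 + (X * 4).+1) = (fun X => (X * 5 + 1) + (X * 4 + 1)).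
    by apply/funext => X; lia.
  by do 3 ?apply: poly_add; try apply: poly_mul; try apply: poly_const; apply: poly_id.
exists d => loc t out lt outt lout.
exists (Seq (loop (loc j).+2 (Seq (inc out.+2) (inc t.+2))) (loop t.+2 (inc (loc j).+2))).
move=> z m r X X2 r0 rX; apply: runs_weaken (Hd X X2) _ => /=.
have lj := lt j; have := lout j => /eqP lo; set k := loc j in lj lo *.
have rk : r k <= X by apply: rX.
have rt : r t = 0 by apply: r0.
apply: (@runs_weaken _ _ ((r k * (2 + 3)).+1 + (r k * 4).+1)).
  by rewrite leq_add // ltnS leq_mul2r rk ?orbT.
pose rr i := setat (setat (setat r k (r k - i)) out (r out + i)) t i.
apply: (@runs_seq _ _ _ _ (emb z 0 m (rr (r k)))).
  have -> : emb z 0 m r = emb z 0 m (rr 0) by apply: emb_eq; rewrite /rr; regs.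
  apply: (@emb_loop _ _ (r k) (fun=> z) (fun=> 0) (fun=> m) rr 2) => i lin.
    by rewrite /rr /setat; repeat (case: eqP => ? //); subst; lia.
  apply: (@runs_seq _ _ _ 1 _ 1); first exact: emb_inc.
  set r1 := setat _ out _; have := emb_inc z 0 m r1 t.
  suff -> : emb z 0 m (setat r1 t (r1 t).+1) = emb z 0 m (rr i.+1) by [].
  by apply: emb_eq; rewrite /r1 /rr; regs.
have tk : t != k by apply/eqP; lia.
have := @emb_move t k z 0 m (rr (r k)) tk.
have -> : rr (r k) t = r k by rewrite /rr /setat eqxx.
set r1 := setat _ k _.
suff -> : emb z 0 m r1 = emb z 0 m (setat r out (r out + r k)) by [].
apply: emb_eq; rewrite /r1 /rr; regs.
Qed.

Lemma PC_ren f (rho : nat -> nat) : PC f -> PC (fun m e => f m (e \o rho)).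
Proof.
case=> -[d Hd] [d' Hd']; split.
  by exists d => m e X X2 eX; apply: Hd => // i; apply: eX.
exists d' => loc t out lt outt lout.
have [|i|c Hc] := Hd' (loc \o rho) t out _ outt; [by move=> i; apply: lt | exact: lout |].
by exists c => z m r X X2 r0 rX; apply: Hc => // i; apply: rX.
Qed.

Lemma PC_one : PC (fun _ _ => 1).
Proof.
split; first by exists 0 => m e X X2 _.
exists 0 => loc t out _ _ _; exists (inc out.+2) => z m r X _ _ _.
by rewrite expn0 addn1; apply: emb_inc.
Qed.

Lemma comp_setat (r : nat -> nat) k v (loc : nat -> nat) : (forall i, loc i != k) -> setat r k v \o loc = r \o loc.
Proof. by move=> lk; apply/funext => i /=; rewrite /setat (negbTE (lk i)). Qed.

Lemma loc_setat (r : nat -> nat) k v (loc : nat -> nat) t X : (forall i, loc i < t) -> t <= k ->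
  (forall i, r (loc i) <= X) -> forall i, setat r k v (loc i) <= X.
Proof.
by move=> lt tk rX i; rewrite /setat ifN //; apply: contraTneq (lt i) => ->; rewrite -leqNgt.
Qed.

Lemma PC_add f g : PC f -> PC g -> PC (fun m e => f m e + g m e).
Proof.
case=> -[a Ha] [b Hb] [[a' Ha'] [b' Hb']]; split.
  have [d Hd] : poly (fun X => X ^ a + X ^ a') by polyt.
  by exists d => m e X X2 eX; apply: leq_trans (Hd X X2); rewrite leq_add // ?Ha ?Ha'.
have [d Hd] : poly (fun X => X ^ b + X ^ b') by polyt.
exists d => loc t out lt outt lout.
have [c1 H1] := Hb loc t out lt outt lout; have [c2 H2] := Hb' loc t out lt outt lout.
exists (Seq c1 c2) => z m r X X2 r0 rX; apply: runs_weaken (Hd X X2) _.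
apply: runs_seq (H1 z m r X X2 r0 rX) _.
set r1 := setat _ _ _; have e1 : r1 \o loc = r \o loc by apply: comp_setat.
have := H2 z m r1 X X2; rewrite e1.
set r2 := setat r1 _ _; have -> : emb z 0 m (setat r out (r out + (f m (r \o loc) + g m (r \o loc)))) = emb z 0 m r2.
  by apply: emb_eq; rewrite /r2 /r1; regs.
apply => i.
  by move=> ti; rewrite /r1 /setat ifN ?r0 //; lia.
by rewrite -/((r1 \o loc) i) e1 /=.
Qed.

Lemma scratch_setat (r : nat -> nat) k v t : (forall i, t <= i -> r i = 0) -> k < t ->
  forall i, t <= i -> setat r k v i = 0.
Proof. by move=> r0 kt i ti; rewrite /setat ifN ?r0 //; lia. Qed.

Lemma scratch_up (r : nat -> nat) t t' : (forall i, t <= i -> r i = 0) -> t <= t' ->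
  forall i, t' <= i -> r i = 0.
Proof. by move=> r0 tt i ti; apply: r0; apply: leq_trans ti. Qed.

Lemma loc_neq (loc : nat -> nat) t k : (forall i, loc i < t) -> t <= k -> forall i, loc i != k.
Proof. by move=> lt tk i; apply: contraTneq (lt i) => ->; rewrite -leqNgt. Qed.

Lemma pcomp_top f : pcomp f -> exists d, forall loc t, (forall i, loc i < t) ->
  exists c, forall z m r X, 2 <= X -> (forall i, t <= i -> r i = 0) -> (forall i, r (loc i) <= X) ->
    runs c (emb z 0 m r) (X ^ d) (emb z 0 m (setat r t (f m (r \o loc)))).
Proof.
case=> d Hd; exists d => loc t lt.
have [|//||c Hc] := Hd loc t.+1 t; [by move=> i; apply: ltnW (lt i) | exact: loc_neq lt _ |].
exists c => z m r X X2 r0 rX; have := Hc z m r X X2 _ rX; rewrite r0 // add0n; apply.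
exact: scratch_up r0 _.
Qed.

Lemma PC_sub f g : PC f -> PC g -> PC (fun m e => f m e - g m e).
Proof.
case=> -[a Ha] /pcomp_top[b Hb] [[a' Ha'] /pcomp_top[b' Hb']]; split.
  by exists a => m e X X2 eX; apply: leq_trans (leq_subr _ _) (Ha _ _ _ X2 eX).
have [d Hd] : poly (fun X => X ^ b + (X ^ b' + ((X ^ a' * 4 + 1) + (X ^ a * 4 + 1)))) by polyt.
exists d => loc t out lt outt lout.
have lt1 i : loc i < t.+1 by apply: ltnW (lt i).
have [c1 H1] := Hb loc t lt; have [c2 H2] := Hb' loc t.+1 lt1.
exists (Seq c1 (Seq c2 (Seq (loop t.+3 (dec t.+2)) (loop t.+2 (inc out.+2))))).
move=> z m r X X2 r0 rX; apply: runs_weaken (Hd X X2) _.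
have fX := Ha m _ X X2 rX; have gX := Ha' m _ X X2 rX.
apply: runs_seq (H1 z m r X X2 r0 rX) _.
set r1 := setat _ _ _; have e1 : r1 \o loc = r \o loc by apply: comp_setat; apply: loc_neq lt _.
apply: runs_seq (H2 z m r1 X X2 _ _) _.
- by apply: scratch_setat => //; apply: scratch_up r0 _.
- by apply: loc_setat lt _ rX.
rewrite e1; set u := f m _ in r1 e1 fX *; set v := g m _ in gX *.
apply: (@runs_seq _ _ _ _ (emb z 0 m (setat r t (u - v)))).
  apply: (@runs_weaken _ _ (v * (1 + 3)).+1); first by rewrite addn1 ltnS leq_mul.
  pose rr i := setat (setat r1 t.+1 (v - i)) t (u - i).
  have -> : emb z 0 m (setat r1 t.+1 v) = emb z 0 m (rr 0) by apply: emb_eq; rewrite /rr /r1; regs.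
  have -> : emb z 0 m (setat r t (u - v)) = emb z 0 m (rr v).
    by have rt := r0 t.+1 (leqnSn t); apply: emb_eq; rewrite /rr /r1; regs.
  apply: (@emb_loop _ _ v (fun=> z) (fun=> 0) (fun=> m) rr 1) => i lin.
    by rewrite /rr /setat; repeat (case: eqP => ? //); subst; lia.
  set r2 := setat (rr i) _ _; have := emb_dec z 0 m r2 t.
  suff -> : emb z 0 m (setat r2 t (r2 t).-1) = emb z 0 m (rr i.+1) by [].
  by apply: emb_eq; rewrite /r2 /rr; regs.
have tout : t != out by apply/eqP; lia.
have := emb_move z 0 m (setat r t (u - v)) tout.
have -> : setat r t (u - v) t = u - v by rewrite /setat eqxx.
move=> H; apply: runs_weaken (_ : (u - v) * 4 + 1 <= _) _; first by rewrite leq_add2r leq_mul2r (leq_trans (leq_subr _ _) fX) orbT.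
rewrite addn1; set r2 := setat _ out _ in H; suff -> : emb z 0 m (setat r out (r out + (u - v))) = emb z 0 m r2 by [].
by have rt := r0 t (leqnn t); apply: emb_eq; rewrite /r2; regs.
Qed.

End PolynomialPrograms.

Section Closure.
Local Open Scope nat_scope.

Lemma leq_exp1 X k : 2 <= X -> X <= X ^ k.+1.
Proof. by move=> X2; rewrite -{1}[X]expn1 leq_pexp2l //; apply: leq_trans X2. Qed.

Lemma leq_expS X j k : 2 <= X -> j <= k -> X ^ j <= X ^ k.
Proof. by move=> X2 jk; rewrite leq_pexp2l //; apply: leq_trans X2. Qed.

Lemma PC_iteri f g : PC f -> PC g ->
  (exists d, forall m e X, 2 <= X -> (forall i, e i <= X) -> forall k, k <= f m e ->
     iteri k (fun i x => g m (scons i (scons x e))) 0 <= X ^ d) ->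
  PC (fun m e => iteri (f m e) (fun i x => g m (scons i (scons x e))) 0).
Proof.
case=> -[a Ha] /pcomp_top[b Hb] [_ /pcomp_top[b' Hb']] [h Hh].
split; first by exists h => m e X X2 eX; apply: Hh.
pose D := (a + h).+1.
have leX X k : 2 <= X -> k <= D -> X ^ k <= X ^ D by apply: leq_expS.
have X1 X : 2 <= X -> 2 <= X ^ D by move=> X2; apply: leq_trans X2 (leq_exp1 _ X2).
have [d Hd] : poly (fun X => X ^ b + ((X ^ a * ((X ^ (D * b') + ((3 * X ^ h + 1) + ((X ^ h * 4 + 1) + 1))) + 3) + 1) +
   ((X ^ h * 4 + 1) + (3 * X ^ a + 1)))) by polyt.
exists d => loc t out lt outt lout.
pose loc' := scons t.+1 (scons t.+2 loc).
have lt1 i : loc' i < t.+3 by case: i => [|[|i]] //=; have := lt i; lia.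
have [c1 H1] := Hb loc t lt; have [c2 H2] := Hb' _ _ lt1.
pose body := Seq c2 (Seq (clear t.+4) (Seq (loop t.+3.+2 (inc t.+4)) (inc t.+3))).
exists (Seq c1 (Seq (loop t.+2 body) (Seq (loop t.+4 (inc out.+2)) (clear t.+3)))).
move=> z m r X X2 r0 rX; apply: runs_weaken (Hd X X2) _.
have fX := Ha m _ X X2 rX; have hX := Hh m _ X X2 rX.
apply: runs_seq (H1 z m r X X2 r0 rX) _.
set n := f m _ in fX hX *; set G := (fun i x => g m (scons i (scons x (r \o loc)))) in hX *.
have rt0 := r0 t (leqnn t). have rt1 := r0 t.+1 (leqnSn t).
have rt2 : r t.+2 = 0 by apply: r0; lia.
have rt3 : r t.+3 = 0 by apply: r0; lia.
pose rr i := setat (setat (setat r t (n - i)) t.+1 i) t.+2 (iteri i G 0).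
have le1 : (n * ((X ^ (D * b') + (3 * X ^ h + 1 + (X ^ h * 4 + 1 + 1))) + 3)).+1 <=
  X ^ a * (X ^ (D * b') + (3 * X ^ h + 1 + (X ^ h * 4 + 1 + 1)) + 3) + 1 by rewrite [leqRHS]addn1 ltnS leq_mul2r fX orbT.
apply: (@runs_seq _ _ _ _ (emb z 0 m (rr n))).
  apply: runs_weaken le1 _.
  have -> : emb z 0 m (setat r t n) = emb z 0 m (rr 0) by apply: emb_eq; rewrite /rr /=; regs.
  apply: (@emb_loop _ _ n (fun=> z) (fun=> 0) (fun=> m) rr) => i lin.
    by rewrite /rr /setat; repeat (case: eqP => ? //); subst; lia.
  set r1 := setat (rr i) _ _.
  have e1 : r1 \o loc' = scons i (scons (iteri i G 0) (r \o loc)).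
    rewrite !scons_comp; congr scons; [| congr scons].
    - by rewrite /r1 /rr /setat; repeat (case: eqP => ? //); lia.
    - by rewrite /r1 /rr /setat; repeat (case: eqP => ? //); lia.
    - by rewrite !comp_setat //; apply: loc_neq lt _; lia.
  have H := H2 z m r1 _ (X1 X X2) _ _; rewrite -expnM e1 in H.
  apply: runs_seq (H _ _) _.
  - move=> j tj; rewrite /r1 /rr /setat !ifN; [by apply: r0; lia | by apply/eqP; lia ..].
  - move=> j; rewrite -/((r1 \o loc') j) e1; case: j => [|[|j]] /=.
    + by apply: leq_trans (leX X a X2 _); [lia | rewrite /D; lia].
    + by apply: leq_trans (hX i (ltnW lin)) _; apply: leX => //; rewrite /D; lia.
    + by apply: leq_trans (rX j) _; apply: leq_exp1.
  rewrite -/(G i (iteri i G 0)) -iteriS; set r2 := setat r1 _ _.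
  have Bi := hX i (ltnW lin); have Bi1 := hX i.+1 lin.
  apply: (@runs_seq _ _ _ _ (emb z 0 m (setat r2 t.+2 0))).
    have := emb_clear z 0 m r2 t.+2; have -> : r2 t.+2 = iteri i G 0.
      by rewrite /r2 /r1 /rr /setat; repeat (case: eqP => ? //); lia.
    by move=> H3; apply: runs_weaken H3; rewrite addn1 ltnS leq_mul2l Bi.
  set r3 := setat r2 _ _.
  apply: (@runs_seq _ _ _ _ (emb z 0 m (setat (setat r3 t.+3 0) t.+2 (iteri i.+1 G 0)))).
    have t32 : t.+3 != t.+2 by apply/eqP; lia.
    have := emb_move z 0 m r3 t32; have -> : r3 t.+3 = iteri i.+1 G 0.
      by rewrite /r3 /r2 /setat; repeat (case: eqP => ? //); lia.
    have -> : r3 t.+2 = 0 by rewrite /r3 /setat eqxx.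
    by move=> H3; apply: runs_weaken H3; rewrite addn1 ltnS leq_mul2r Bi1.
  set r4 := setat _ t.+2 _; have := emb_inc z 0 m r4 t.+1.
  suff -> : emb z 0 m (setat r4 t.+1 (r4 t.+1).+1) = emb z 0 m (rr i.+1) by [].
  by apply: emb_eq; rewrite /r4 /r3 /r2 /r1 /rr; regs.
have Bn := hX n (leqnn n).
apply: (@runs_seq _ _ _ _ (emb z 0 m (setat (setat (rr n) t.+2 0) out (r out + iteri n G 0)))).
  have to : t.+2 != out by apply/eqP; lia.
  have := emb_move z 0 m (rr n) to; have -> : rr n t.+2 = iteri n G 0 by rewrite /rr /setat eqxx.
  have -> : rr n out = r out by rewrite /rr /setat; repeat (case: eqP => ? //); lia.
  by move=> H3; apply: runs_weaken H3; rewrite addn1 ltnS leq_mul2r Bn.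
set r1 := setat _ out _; have := emb_clear z 0 m r1 t.+1.
have -> : r1 t.+1 = n by rewrite /r1 /rr /setat; repeat (case: eqP => ? //); lia.
set r2 := setat r1 _ _ => H3.
have -> : emb z 0 m (setat r out (r out + iteri n G 0)) = emb z 0 m r2.
  by apply: emb_eq; rewrite /r2 /r1 /rr; regs.
by apply: runs_weaken H3; rewrite addn1 ltnS leq_mul2l fX.
Qed.

Lemma emb_walk z p m r k :
  runs (loop k.+2 (inc 1)) (emb z p m r) (r k * 4).+1 (emb z (p + r k) m (setat r k 0)).
Proof.
pose rr i := setat r k (r k - i).
have -> : emb z (p + r k) m (setat r k 0) = emb z (p + r k) m (rr (r k)) by apply: emb_eq; rewrite /rr; regs.
have -> : emb z p m r = emb z (p + 0) m (rr 0) by rewrite addn0; apply: emb_eq; rewrite /rr; regs.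
apply: (@emb_loop _ _ (r k) (fun=> z) (fun i => p + i) (fun=> m) rr 1) => i lin.
  by rewrite /rr /setat eqxx.
have -> : emb z (p + i) m (setat (rr i) k (r k - i.+1)) = emb z (p + i) m (rr i.+1).
  by apply: emb_eq; rewrite /rr; regs.
by rewrite -[emb z (p + i.+1) m _](emb_mem z (p + i) m) addnS; apply: runs_inc.
Qed.

(** The cell of tape 1 that stores [m i] is under the head when the position is
   [i.+1]. *)
Lemma PC_mem f : PC f -> PC (fun m e => m (f m e)).
Proof.
case=> -[a Ha] /pcomp_top[b Hb]; split; first by exists 0 => m e X _ _; apply: leq_b1.
have [d Hd] : poly (fun X => X ^ b + ((X ^ a * (1 + 3) + 1) + (1 + (1 + 2 + (3 * (X ^ a + 1) + 1))))) by polyt.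
exists d => loc t out lt outt lout; have [c1 H1] := Hb loc t lt.
exists (Seq c1 (Seq (loop t.+2 (inc 1)) (Seq (inc 1)
   (Seq (If 1 isSome (inc out.+2) (loop t.+2 (inc 1))) (clear 1))))).
move=> z m r X X2 r0 rX; apply: runs_weaken (Hd X X2) _.
have fX := Ha m _ X X2 rX.
apply: runs_seq (H1 z m r X X2 r0 rX) _; set n := f m _ in fX *.
have rt := r0 t (leqnn t).
apply: (@runs_seq _ _ _ _ (emb z n m r)).
  have := emb_walk z 0 m (setat r t n) t; have -> : setat r t n t = n by rewrite /setat eqxx.
  have -> : emb z (0 + n) m (setat (setat r t n) t 0) = emb z n m r by apply: emb_eq; regs.
  by apply: runs_weaken; rewrite addn1 ltnS leq_mul2r fX.
have := @runs_inc 1 (emb z n m r) n (fun i => bit_sym (m i)) (erefl _).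
rewrite emb_mem => H3; apply: runs_seq H3 _.
apply: (@runs_seq _ _ _ _ (emb z n.+1 m (setat r out (r out + m n)))).
  apply: (@runs_if _ _ _ _ _ 1).
  have -> : rd (emb z n.+1 m r 1) = bit_sym (m n) by rewrite /= rd_tpS.
  case: (m n) => /=; first by rewrite addn1; apply: emb_inc.
  rewrite addn0 setat_id; apply: runs_while0; rewrite /= rt.
  by [].
have := @runs_clear 1 (emb z n.+1 m (setat r out (r out + m n))) n.+1 _ (emb_bits m) (erefl _).
by rewrite emb_mem; apply: runs_weaken; rewrite [leqRHS]addn1 ltnS leq_mul2l addn1 ltnS fX.
Qed.

Lemma PC_const c : PC (fun _ _ => c).
Proof.
elim: c => [|c IH]; first exact: PC_sub PC_one PC_one.
by apply: PC_ext (PC_add IH PC_one) => m e; rewrite addn1.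
Qed.

Lemma PC_stail f : PC f -> PC (fun m e => f m (stail e)).
Proof. exact: (@PC_ren f succn). Qed.

Lemma PC_rec f (g : (nat -> bool) -> (nat -> nat) -> nat -> nat -> nat) : PC f ->
  PC (fun m e => g m (stail (stail e)) (e 0) (e 1)) ->
  (exists d, forall m e X, 2 <= X -> (forall i, e i <= X) -> forall k, k <= f m e ->
     iteri k (g m e) 0 <= X ^ d) ->
  PC (fun m e => iteri (f m e) (g m e) 0).
Proof. by move=> Hf Hg b; exact: (PC_iteri Hf Hg b). Qed.

Lemma PC_sum f (g : (nat -> bool) -> (nat -> nat) -> nat -> nat) : PC f ->
  PC (fun m e => g m (stail e) (e 0)) -> PC (fun m e => \sum_(i < f m e) g m e i).
Proof.
move=> Hf Hg.
have E m e k : iteri k (fun i x => x + g m e i) 0 = \sum_(i < k) g m e i.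
  by elim: k => [|k IH] /=; rewrite ?big_ord0 // big_ord_recr /= IH.
apply: (@PC_ext (fun m e => iteri (f m e) (fun i x => x + g m e i) 0)) => [m e|]; first exact: E.
apply: PC_rec => //.
  apply: PC_add; first exact: (PC_var 1).
  by apply: (PC_ext _ (@PC_ren _ (fun i => if i is j.+1 then j.+2 else 0) Hg)).
case: Hf => -[a Ha] _; case: Hg => -[b Hb] _; exists (a + a.+1 * b) => m e X X2 eX k kf.
rewrite E; apply: leq_trans (_ : \sum_(i < k) X ^ (a.+1 * b) <= _).
  apply: leq_sum => i _; rewrite expnM.
  apply: (Hb m (scons (i : nat) e)); first exact: leq_trans X2 (leq_exp1 a X2).
  case=> [|j] /=; last exact: leq_trans (eX j) (leq_exp1 _ X2).
  apply: leq_trans (ltnW (ltn_ord i)) (leq_trans kf _).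
  exact: leq_trans (Ha m e X X2 eX) (leq_expS X2 (leqnSn a)).
rewrite sum_nat_const card_ord expnD leq_mul2r; apply/orP; right.
exact: leq_trans kf (Ha m e X X2 eX).
Qed.

Lemma PC_mul f g : PC f -> PC g -> PC (fun m e => f m e * g m e).
Proof.
move=> Hf Hg; apply: (@PC_ext (fun m e => \sum_(i < f m e) g m e)) => [m e|].
  by rewrite sum_nat_const card_ord.
by apply: (@PC_sum _ (fun m e _ => g m e)) => //; apply: PC_stail.
Qed.

Lemma PC_leq f g : PC f -> PC g -> PC (fun m e => f m e <= g m e).
Proof.
move=> Hf Hg; apply: (@PC_ext (fun m e => 1 - (f m e - g m e))) => [m e|].
  by rewrite /leq; case: (f m e - g m e).
by apply: PC_sub (PC_sub _ _) => //; apply: PC_const.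
Qed.

Lemma PC_ltn f g : PC f -> PC g -> PC (fun m e => f m e < g m e).
Proof.
move=> Hf Hg; apply: (@PC_ext (fun m e => f m e + 1 <= g m e)) => [m e|]; first by rewrite addn1.
by apply: PC_leq => //; apply: PC_add => //; apply: PC_const.
Qed.

Lemma PC_and (f g : (nat -> bool) -> (nat -> nat) -> bool) :
  PC f -> PC g -> PC (fun m e => f m e && g m e).
Proof.
move=> Hf Hg; apply: (@PC_ext (fun m e => f m e * g m e)) => [m e|]; last exact: PC_mul.
by rewrite mulnb.
Qed.

Lemma PC_not (f : (nat -> bool) -> (nat -> nat) -> bool) : PC f -> PC (fun m e => ~~ f m e).
Proof.
move=> Hf; apply: (@PC_ext (fun m e => 1 - f m e)) => [m e|]; first by case: (f m e).
by apply: PC_sub => //; apply: PC_const.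
Qed.

Lemma PC_or (f g : (nat -> bool) -> (nat -> nat) -> bool) :
  PC f -> PC g -> PC (fun m e => f m e || g m e).
Proof.
move=> Hf Hg; apply: (@PC_ext (fun m e => ~~ (~~ f m e && ~~ g m e))) => [m e|].
  by rewrite negb_and !negbK.
by apply: PC_not; apply: PC_and; apply: PC_not.
Qed.

Lemma PC_eq f g : PC f -> PC g -> PC (fun m e => f m e == g m e).
Proof.
move=> Hf Hg; apply: (@PC_ext (fun m e => (f m e <= g m e) && (g m e <= f m e))) => [m e|].
  by rewrite eqn_leq.
by apply: PC_and; apply: PC_leq.
Qed.

Lemma PC_if (c : (nat -> bool) -> (nat -> nat) -> bool) f g : PC c -> PC f -> PC g ->
  PC (fun m e => if c m e then f m e else g m e).
Proof.
move=> Hc Hf Hg; apply: (@PC_ext (fun m e => c m e * f m e + ~~ c m e * g m e)) => [m e|].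
  by case: (c m e); rewrite /= !(mul1n, mul0n, addn0).
by apply: PC_add; apply: PC_mul => //; apply: PC_not.
Qed.

Lemma sum_leq_ord k a : \sum_(i < k) (i < a) = minn k a.
Proof.
elim: k => [|k IH]; first by rewrite big_ord0 min0n.
rewrite big_ord_recr /= IH; case: (ltnP k a) => h; rewrite /= ?addn1 ?addn0; lia.
Qed.

(** The junk value [m %/ 0 = 0] forces the case distinction. *)
Lemma PC_div f g : PC f -> PC g -> PC (fun m e => f m e %/ g m e).
Proof.
move=> Hf Hg.
apply: (@PC_ext (fun m e => (0 < g m e) * \sum_(i < f m e) ((i + 1) * g m e <= f m e))) => [m e|].
  case: (posnP (g m e)) => [->|g0]; first by rewrite divn0.
  rewrite mul1n; under eq_bigr do rewrite addn1 -leq_divRL //.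
  rewrite sum_leq_ord; apply/minn_idPr; exact: leq_div.
apply: PC_mul; first by apply: PC_ltn => //; apply: PC_const.
apply: (@PC_sum _ (fun m e i => (i + 1) * g m e <= f m e)) => //=; apply: PC_leq; last exact: PC_stail.
by apply: PC_mul; [apply: PC_add; [apply: PC_var | apply: PC_const] | apply: PC_stail].
Qed.

Lemma PC_mod f g : PC f -> PC g -> PC (fun m e => f m e %% g m e).
Proof.
move=> Hf Hg; apply: (@PC_ext (fun m e => f m e - f m e %/ g m e * g m e)) => [m e|].
  by rewrite {1}(divn_eq (f m e) (g m e)) addKn.
by apply: PC_sub => //; apply: PC_mul => //; apply: PC_div.
Qed.

Lemma PC_mem_seq (s : seq (nat * nat)) f g : PC f -> PC g -> PC (fun m e => (f m e, g m e) \in s).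
Proof.
move=> Hf Hg; elim: s => [|[a b] s IH].
  by apply: (PC_ext _ (PC_const 0)).
apply: (@PC_ext (fun m e => (f m e == a) && (g m e == b) || ((f m e, g m e) \in s))) => [m e|].
  by rewrite inE xpair_eqE.
by apply: PC_or => //; apply: PC_and; apply: PC_eq => //; apply: PC_const.
Qed.

End Closure.

Section Link.
Local Open Scope nat_scope.

Fixpoint ntapes (c : cmd) : nat := match c with
  | Act k _ => k
  | Seq a b => maxn (ntapes a) (ntapes b)
  | If k _ a b => maxn k (maxn (ntapes a) (ntapes b))
  | While k _ a => maxn k (ntapes a)
  end.

Definition within (K N : nat) (i : instr) := i.1 <= K /\ forall x, (i.2 x).2 <= N.

Lemma comp_within c pc K N : ntapes c <= K -> pc + csize c <= N ->
  List.Forall (within K N) (comp c pc).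
Proof.
elim: c pc => [k f|a IHa b IHb|k P a IHa b IHb|k P a IHa] pc /=; rewrite ?geq_max.
- by move=> kK cN; do !constructor => //=; rewrite -addn1.
- move=> /andP[aK bK] cN; apply/List.Forall_app; split; [apply: IHa | apply: IHb] => //; lia.
- move=> /and3P[kK aK bK] cN; constructor.
    by split => //= x; case: (P x); lia.
  apply/List.Forall_app; split; first by apply: IHa => //; lia.
  constructor; first by split.
  by apply: IHb => //; lia.
- move=> /andP[kK aK] cN; constructor.
    by split => //= x; case: (P x); lia.
  rewrite -cats1; apply/List.Forall_app; split; first by apply: IHa => //; lia.
  by do !constructor => //=; lia.
Qed.

Lemma nth_within K N s j : j < size s -> List.Forall (within K N) s ->
  within K N (nth (goto 0 0) s j).
Proof.
elim: s j => // i s IH [|j] /= js F; first by inversion F.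
by apply: IH => //; inversion F.
Qed.

Section Machine.
Context (c : cmd) (K : nat) (cK : ntapes c <= K).

Definition machine_trans (q : 'I_(csize c).+1) (x : 'I_K.+1 -> sym) :
    'I_(csize c).+1 * ('I_K.+1 -> sym * move) :=
  let i := nth (goto 0 0) (comp c 0) q in
  let r := i.2 (x (inord i.1)) in
  (inord r.2, fun k => if k == inord i.1 then r.1 else (x k, Stay)).

Definition machine : turing_machine :=
  @TuringMachine K 'I_(csize c).+1 unit ord0 (pred1 ord_max) machine_trans.

Definition of_raw (x : nat * state) : tm_config machine :=
  @TMConfig machine (inord x.1) (fun k => (x.2 k).1) (fun k => (x.2 k).2).

Lemma machine_step x : x.1 <= csize c ->
  tm_step (of_raw x) = of_raw (rstep (comp c 0) x) /\ (rstep (comp c 0) x).1 <= csize c.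
Proof.
case: x => pc s /= pcc; rewrite /rstep size_comp /=.
case: ltnP => [pcl|pcg]; last first.
  have -> : pc = csize c by lia.
  rewrite /tm_step /= ifT //; apply/eqP/val_inj; by rewrite /= inordK.
have szc : pc < size (comp c 0) by rewrite size_comp.
have [iK iN] := nth_within szc (@comp_within c 0 K (csize c) cK (leqnn _)).
rewrite /tm_step /= ifN; last first.
  by apply/eqP => /(congr1 val); rewrite /= inordK ?ltnS //; lia.
rewrite /machine_trans inordK ?ltnS //.
set i := nth _ _ pc in iK iN *; rewrite inordK ?ltnS //; split; last exact: iN.
rewrite /of_raw /=; congr (@TMConfig machine _ _ _).
- apply/funext => k; rewrite /setat -val_eqE /= inordK ?ltnS //.
  by case: eqP => [->|_] /=; rewrite ?addr0.
- apply/funext => k; apply/funext => z; rewrite /setat -val_eqE /= inordK ?ltnS //.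
  by case: (nat_of_ord k =P i.1) => [->|_] //=; case: eqP => // ->.
Qed.

Definition tm_init_raw (w : seq io_symbol) : state := fun k =>
  if k <= K then (0%R, if k == 0 then word_tape w else fun=> None) else tp 0 blank.

Lemma runs_outputs w T s' w' : runs c (tm_init_raw w) T s' -> (s' 0).2 =1 word_tape w' ->
  tm_outputs machine w T w'.
Proof.
move=> /(_ [::] [::]) [t tT]; rewrite cats0 /= add0n => e out.
have I0 : tm_init machine w = of_raw (0, tm_init_raw w).
  rewrite /tm_init /of_raw /=; congr (@TMConfig machine _ _ _).
  - by apply/val_inj; rewrite /= inordK.
  - by apply/funext => k; rewrite /tm_init_raw -ltnS ltn_ord.
  - by apply/funext => k; rewrite /tm_init_raw -ltnS ltn_ord -val_eqE.
have S k x : x.1 <= csize c -> iter k (@tm_step machine) (of_raw x) = of_raw (iter k (rstep (comp c 0)) x) /\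
    (iter k (rstep (comp c 0)) x).1 <= csize c.
  move=> xc; elim: k => [|k [IH1 IH2]] //=.
  by rewrite IH1; apply: machine_step.
have H : iter T (@tm_step machine) (tm_init machine w) = of_raw (csize c, s').
  rewrite I0 -(subnK tT) iterD; have [-> _] := S t (0, tm_init_raw w) isT.
  rewrite e; elim: (T - t) => [|k IH] //=; rewrite IH /tm_step /= ifT //.
  by apply/eqP/val_inj; rewrite /= inordK.
rewrite /tm_outputs H /=; split; last by move=> z; exact: out.
by apply/eqP/val_inj; rewrite /= inordK.
Qed.

End Machine.

Definition word_cell (w : seq io_symbol) (i : nat) : sym := nth None [seq Some (inl c) | c <- w] i.

Fixpoint markall (K : nat) : cmd :=
  let c := Seq (Act K (fun x => (x, Left))) (Act K (fun x => (mark, Stay))) in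
  if K is K'.+1 then Seq c (markall K') else c.

Lemma ntapes_markall K : ntapes (markall K) = K.
Proof. by elim: K => //= K ->; rewrite maxnn; lia. Qed.

Lemma runs_mark k g s : s k = (0%R, fun x => if x is Posz i then g i else None) ->
  runs (Seq (Act k (fun x => (x, Left))) (Act k (fun x => (mark, Stay)))) s 2 (setat s k (tp 0 g)).
Proof.
move=> sk.
have := runs_act k (fun x => (x, Left)) s; set s1 := setat _ _ _ => r1.
have := runs_act k (fun x => (mark, Stay)) s1; set s2 := setat _ _ _ => r2.
suff -> : setat s k (tp 0 g) = s2 by apply: (runs_seq r1 r2).
apply/funext => i; rewrite /s2 /setat; case: eqP => ik; last by rewrite /s1 /setat; case: eqP.
rewrite /s1 /setat eqxx sk /do_tape /tp /=; congr pair.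
by apply/funext => -[[|j]|[|j]].
Qed.

Lemma runs_markall K w : runs (markall K) (tm_init_raw K w) (2 * K.+1)
  (emb (tp 0 (word_cell w)) 0 (fun=> false) (fun=> 0)).
Proof.
set s' := emb _ _ _ _.
have E g k : k <= K -> (if k == 0 then word_cell w else blank) = g ->
   tm_init_raw K w k = (0%R, fun x => if x is Posz i then g i else None).
  move=> kK <-; rewrite /tm_init_raw kK; congr pair.
  by apply/funext => -[i|i]; case: eqP.
have S' k : k <= K -> s' k = tp 0 (if k == 0 then word_cell w else blank) by case: k => [|[|k]].
pose st j : state := fun k => if k < j then tm_init_raw K w k else s' k.
have st0 : st K.+1 = tm_init_raw K w.
  apply/funext => k; rewrite /st ltnS; case: ifP => // /negbT; rewrite -ltnNge => kK.
  by rewrite /tm_init_raw leqNgt kK /=; move: kK; rewrite /s'; case: k => [|[|k]].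
have step j : j <= K -> setat (st j.+1) j (tp 0 (if j == 0 then word_cell w else blank)) = st j.
  move=> jK; apply/funext => k; rewrite /setat /st; case: eqP => [->|kj].
    by rewrite ltnn S'.
  by rewrite ltnS leq_eqVlt; case: eqP kj.
suff H j : j <= K -> runs (markall j) (st j.+1) (2 * j.+1) (st 0) by rewrite -st0; apply: H.
have M i : i <= K -> runs (Seq (Act i (fun x => (x, Left))) (Act i (fun x => (mark, Stay)))) (st i.+1) 2 (st i).
  by move=> iK; rewrite -(step i iK); apply: runs_mark; rewrite /st ltnSn; apply: E.
elim: j => [|j IH] jK; first exact: M.
apply: (@runs_weaken _ _ (2 + 2 * j.+1)); first by lia.
by apply: runs_seq (M _ jK) (IH (ltnW jK)).
Qed.

End Link.

Section Phases.
Local Open Scope nat_scope.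

Definition nop := Act 1 (fun x => (x, Stay)).

Lemma runs_nop s : runs nop s 1 s.
Proof. by have := runs_act 1 (fun x => (x, Stay)) s; rewrite do_tape_id setat_id. Qed.

Lemma emb_io z p m r z' : setat (emb z p m r) 0 z' = emb z' p m r.
Proof. by apply/funext => -[|[|i]]. Qed.

Lemma runs_while k (P : sym -> bool) c n (st : nat -> state) T :
  (forall i, i < n -> P (rd (st i k))) -> ~~ P (rd (st n k)) ->
  (forall i, i < n -> runs c (st i) T (st i.+1)) ->
  runs (While k P c) (st 0) (n * (T + 2)).+1 (st n).
Proof.
elim: n st => [|n IH] st Pi Pn rc; first exact: runs_while0.
apply: (@runs_weaken _ _ (T + (n * (T + 2)).+1).+2); first by lia.
apply: runs_whileS (Pi 0 isT) (rc 0 isT) _.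
by apply: (IH (fun i => st i.+1)) => // i lin; [apply: (Pi i.+1) | apply: (rc i.+1)].
Qed.

Definition bit_cell (x : sym) : bool := if x is Some (inl (Bit _)) then true else false.
Definition one_cell (x : sym) : bool := if x is Some (inl (Bit true)) then true else false.

Lemma nomark_word w i : nomark (word_cell w i).
Proof.
rewrite /word_cell; case: (ltnP i (size w)) => h; last by rewrite nth_default // size_map.
by rewrite (nth_map Slash).
Qed.

Lemma size_nat_word n : size (nat_word n) = (trunc_log 2 n).+1.
Proof. by rewrite size_map size_rev size_iota. Qed.

Lemma word_cell_nat n i : i < (trunc_log 2 n).+1 ->
  word_cell (nat_word n) i = Some (inl (Bit (odd (n %/ 2 ^ (trunc_log 2 n - i))))).
Proof.
move=> iL; rewrite /word_cell (nth_map Slash) ?size_nat_word //.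
rewrite (nth_map 0) ?size_rev ?size_iota // nth_rev ?size_iota //.
by rewrite subSS nth_iota ?add0n //; lia.
Qed.

Lemma decode_phase : exists c d, forall n X, 2 <= X -> n <= X ->
  runs c (emb (tp 0 (word_cell (nat_word n))) 0 (fun=> false) (fun=> 0)) (X ^ d)
         (emb (tp 0 blank) 0 (fun=> false) (setat (fun=> 0) 0 n)).
Proof.
have [b Hb] := pcomp_top (PC_add (PC_var 0) (PC_var 0)).2.
have [c1 H1] := Hb (fun=> 0) 1 (fun=> isT).
pose body := Seq c1 (Seq (clear 2) (Seq (loop 3 (inc 2)) (Seq (If 0 one_cell (inc 2) nop) (Seq (put 0 None) (inc 0))))).
pose T X := X ^ b + ((3 * X + 1) + ((X * 4 + 1) + (3 + (1 + 1)))).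
have [d Hd] : poly (fun X => 1 + (((X + 1) * (T X + 2) + 1) + (3 * (X + 2) + 1))).
  by polyt.
exists (Seq (inc 0) (Seq (While 0 bit_cell body) (clear 0))), d => n X X2 nX.
apply: runs_weaken (Hd X X2) _.
set L := (trunc_log 2 n).+1.
have nL : n < 2 ^ L by apply: trunc_log_ltn.
have LX : L <= X + 1.
  rewrite addn1 ltnS; apply: leq_trans nX; case: (n) => // k.
  by apply: leq_trans (ltnW (ltn_expl _ (isT : 1 < 2))) _; apply: trunc_logP.
pose g i x := if x < i then None else word_cell (nat_word n) x.
pose st i := emb (tp i.+1 (g i)) 0 (fun=> false) (setat (fun=> 0) 0 (n %/ 2 ^ (L - i))).
have gm i j : nomark (g i j) by rewrite /g; case: ifP => // _; apply: nomark_word.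
apply: (@runs_seq _ _ _ _ (st 0)).
  have -> : st 0 = setat (emb (tp 0 (word_cell (nat_word n))) 0 (fun=> false) (fun=> 0)) 0 (tp 1 (g 0)).
    rewrite emb_io /st subn0 divn_small //; apply: emb_eq; by case.
  by apply: (@runs_inc 0 (emb (tp 0 (g 0)) _ _ _) 0).
have gL : g L = blank.
  apply/funext => x; rewrite /g; case: ltnP => // Lx.
  by rewrite /word_cell nth_default // size_map size_nat_word.
apply: (@runs_seq _ _ _ _ (st L)).
  apply: (@runs_weaken _ _ (L * (T X + 2)).+1); first by rewrite [leqRHS]addn1 ltnS leq_mul2r LX orbT.
  apply: runs_while => [i iL||i iL].
  - by rewrite /st /= rd_tpS /g ltnn word_cell_nat.
  - by rewrite /st /= rd_tpS gL.
  set v := n %/ 2 ^ (L - i).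
  have v2 : n %/ 2 ^ (L - i.+1) = v + v + odd (n %/ 2 ^ (L - i.+1)).
    rewrite {1}(divn_eq (n %/ 2 ^ (L - i.+1)) 2) modn2; congr (_ + _).
    rewrite -divnMA -expnSr /v; have -> : (L - i.+1).+1 = L - i by lia.
    by rewrite muln2 addnn.
  have vX : v + v <= X.
    apply: leq_trans (leq_trans (leq_div n (2 ^ (L - i.+1))) nX); rewrite v2; lia.
  rewrite /st -/v; set z := tp i.+1 (g i); set r0 := setat (fun=> 0) 0 v.
  have A : runs c1 (emb z 0 (fun=> false) r0) (X ^ b) (emb z 0 (fun=> false) (setat r0 1 (v + v))).
    apply: H1 => //; first by case.
    by move=> j; rewrite /r0 /setat /=; lia.
  apply: runs_seq A _.
  apply: (@runs_seq _ _ _ _ (emb z 0 (fun=> false) (setat (fun=> 0) 1 (v + v)))).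
    have := emb_clear z 0 (fun=> false) (setat r0 1 (v + v)) 0.
    set r1 := setat _ 0 0; have -> : emb z 0 (fun=> false) r1 = emb z 0 (fun=> false) (setat (fun=> 0) 1 (v + v)).
      by apply: emb_eq; case=> [|[|k]].
    by apply: runs_weaken; rewrite [leqRHS]addn1 ltnS leq_mul2l /= /r0 /setat /=; lia.
  apply: (@runs_seq _ _ _ _ (emb z 0 (fun=> false) (setat (fun=> 0) 0 (v + v)))).
    have := @emb_move 1 0 z 0 (fun=> false) (setat (fun=> 0) 1 (v + v)) isT.
    set r1 := setat _ 0 _; have -> : emb z 0 (fun=> false) r1 = emb z 0 (fun=> false) (setat (fun=> 0) 0 (v + v)).
      by apply: emb_eq; case=> [|[|k]].
    by apply: runs_weaken; rewrite [leqRHS]addn1 ltnS leq_mul2r /= /setat /=; lia.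
  apply: (@runs_seq _ _ _ _ (emb z 0 (fun=> false) (setat (fun=> 0) 0 (n %/ 2 ^ (L - i.+1))))).
    apply: (@runs_if _ _ _ _ _ 1); rewrite /= /z rd_tpS /g ltnn word_cell_nat //.
    have -> : trunc_log 2 n - i = L - i.+1 by [].
    move: (n %/ 2 ^ (L - i.+1)) v2 => o; case: (odd o) => /= ->; last by rewrite addn0; apply: runs_nop.
    have := emb_inc (tp i.+1 (g i)) 0 (fun=> false) (setat (fun=> 0) 0 (v + v)) 0.
    set r1 := setat _ 0 _.+1; have -> : emb (tp i.+1 (g i)) 0 (fun=> false) r1 =
       emb (tp i.+1 (g i)) 0 (fun=> false) (setat (fun=> 0) 0 (v + v + 1)).
      by apply: emb_eq; case=> [|k] //; rewrite addn1.
    by [].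
  set r1 := setat _ 0 _.
  have R1 := @runs_put 0 (emb z 0 (fun=> false) r1) i (g i) None (gm i) (erefl _).
  apply: runs_seq R1 _; rewrite emb_io.
  have -> : setat (g i) i None = g i.+1.
    by apply/funext => x; rewrite /setat /g; case: eqP => [->|xi]; rewrite ?ltnSn // [x < i.+1]ltnS [x <= i]leq_eqVlt (introF eqP xi).
  have := @runs_inc 0 (emb (tp i.+1 (g i.+1)) 0 (fun=> false) r1) i.+1 (g i.+1) (erefl _).
  by rewrite emb_io.
have := @runs_clear 0 (st L) L.+1 (g L) (gm L) (erefl _).
rewrite /st emb_io gL subnn divn1; apply: runs_weaken.
by rewrite [leqRHS]addn1 ltnS leq_mul2l; lia.
Qed.

End Phases.

Section MainProgram.
Local Open Scope nat_scope.

Definition regs3 (a b c : nat) : nat -> nat := fun i => match i with 0 => a | 1 => b | 2 => c | _ => 0 end.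
Definition env2 (w y : nat) : nat -> nat := fun i => if i == 0 then w else y.

Lemma power_phase (fw : nat -> nat) (beta : nat) : PC (fun _ e => fw (e 0)) -> 0 < beta ->
  exists c d, forall z m n X, 2 <= X -> n <= X -> fw n <= X -> beta ^ fw n <= X ->
    runs c (emb z 0 m (setat (fun=> 0) 0 n)) (X ^ d) (emb z 0 m (regs3 n (fw n) (beta ^ fw n))).
Proof.
move=> /proj2/pcomp_top[b Hb] beta0.
have [c1 H1] := Hb (fun=> 0) 1 (fun=> isT).
have [b2 Hb2] := pcomp_top (PC_var 0).2.
have [c2 H2] := Hb2 (fun=> 1) 3 (fun=> isT).
have [b3 Hb3] := pcomp_top (PC_mul (PC_const beta) (PC_var 0)).2.
have [c3 H3] := Hb3 (fun=> 2) 4 (fun=> isT).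
pose T X := X ^ b3 + ((3 * X + 1) + (X * 4 + 1)).
have [d Hd] : poly (fun X => X ^ b + (X ^ b2 + (1 + (X * (T X + 3) + 1)))) by polyt.
exists (Seq c1 (Seq c2 (Seq (inc 4) (loop 5 (Seq c3 (Seq (clear 4) (loop 6 (inc 4)))))))), d.
move=> z m n X X2 nX wX yX; apply: runs_weaken (Hd X X2) _.
set w := fw n in wX yX *.
apply: (@runs_seq _ _ _ _ (emb z 0 m (setat (setat (fun=> 0) 0 n) 1 w))).
  by apply: H1 => //; case.
apply: (@runs_seq _ _ _ _ (emb z 0 m (setat (regs3 n w 0) 3 w))).
  have -> : emb z 0 m (setat (setat (fun=> 0) 0 n) 1 w) = emb z 0 m (regs3 n w 0).
    by apply: emb_eq => -[|[|[|i]]].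
  by apply: H2 => //; case=> [|[|[|i]]].
apply: (@runs_seq _ _ _ _ (emb z 0 m (setat (regs3 n w 1) 3 w))).
  have := emb_inc z 0 m (setat (regs3 n w 0) 3 w) 2; set r1 := setat _ 2 _.
  by have -> : emb z 0 m r1 = emb z 0 m (setat (regs3 n w 1) 3 w) by apply: emb_eq => -[|[|[|[|i]]]].
pose rr i := setat (regs3 n w (beta ^ i)) 3 (w - i).
have -> : emb z 0 m (setat (regs3 n w 1) 3 w) = emb z 0 m (rr 0).
  by apply: emb_eq => -[|[|[|[|i]]]]; rewrite // /rr /setat /= subn0.
have -> : emb z 0 m (regs3 n w (beta ^ w)) = emb z 0 m (rr w).
  by apply: emb_eq => -[|[|[|[|i]]]]; rewrite // /rr /setat /= subnn.
apply: (@runs_weaken _ _ (w * (T X + 3)).+1); first by rewrite [leqRHS]addn1 ltnS leq_mul2r wX orbT.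
apply: (@emb_loop _ _ w (fun=> z) (fun=> 0) (fun=> m) rr) => i iw //.
have pX j : j <= w -> beta ^ j <= X by move=> jw; apply: leq_trans yX; rewrite leq_pexp2l.
set r0 := setat (rr i) _ _.
have A : runs c3 (emb z 0 m r0) (X ^ b3) (emb z 0 m (setat r0 4 (beta * beta ^ i))).
  apply: H3 => //; first by case=> [|[|[|[|k]]]].
  by move=> k; rewrite /r0 /rr /setat /= pX // ltnW.
apply: runs_seq A _; rewrite -expnS.
have pi := pX i (ltnW iw); have pi1 := pX i.+1 iw.
apply: (@runs_seq _ _ _ _ (emb z 0 m (setat (setat r0 4 (beta ^ i.+1)) 2 0))).
  have := emb_clear z 0 m (setat r0 4 (beta ^ i.+1)) 2; rewrite {2}/setat /=.
  have -> : r0 2 = beta ^ i by [].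
  by apply: runs_weaken; rewrite [leqRHS]addn1 ltnS leq_mul2l pi.
set r1 := setat _ 2 0; have := @emb_move 4 2 z 0 m r1 isT; set r2 := setat _ 2 _.
have -> : emb z 0 m (rr i.+1) = emb z 0 m r2.
  by apply: emb_eq => -[|[|[|[|[|k]]]]].
have -> : r1 4 = beta ^ i.+1 by [].
by apply: runs_weaken; rewrite [leqRHS]addn1 ltnS leq_mul2r pi1.
Qed.

Lemma memory_phase (N f : pfun) : PC N -> PC f -> exists c d, forall z n w y X (mem : nat -> bool),
  2 <= X -> w <= X -> y <= X ->
  (forall i, i < N (fun=> false) (env2 w y) ->
     f (fun k => (k < i) && mem k) (scons i (env2 w y)) = mem i) ->
  runs c (emb z 0 (fun=> false) (regs3 n w y)) (X ^ d)
     (emb z 0 (fun k => (k < N (fun=> false) (env2 w y)) && mem k) (regs3 n w y)).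
Proof.
move=> [[a Ha] /pcomp_top[b Hb]] [_ /pcomp_top[b2 Hb2]].
pose loc i := if i == 0 then 1 else 2.
have l3 i : loc i < 3 by rewrite /loc; case: ifP.
have l5 i : scons 4 loc i < 5 by case: i => [|i] //=; rewrite /loc; case: ifP.
have [c1 H1] := Hb loc 3 l3; have [c2 H2] := Hb2 _ 5 l5.
have [b3 Hb3] := pcomp_top (PC_var 0).2.
have [c3 H3] := Hb3 (fun=> 4) 6 (fun=> isT).
pose W := Seq c3 (Seq (loop 8 (inc 1)) (Seq (inc 1) (Seq (put 1 (bit_sym true)) (Seq (clear 1) (clear 7))))).
pose body := Seq c2 (Seq (If 7 nomark W nop) (inc 6)).
pose T X := X ^ (a.+1 * b2) + ((X ^ (a.+1 * b3) + (((X ^ a * 4) + 1) + (1 + (1 + ((3 * (X ^ a + 1) + 1) + (3 * 1 + 1))))) + 2) + 1).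
have [d Hd] : poly (fun X => X ^ b + (X ^ a * (T X + 3) + 1 + (3 * X ^ a + 1))).
  by polyt.
exists (Seq c1 (Seq (loop 5 body) (clear 6))), d => z n w y X mem X2 wX yX fE.
apply: runs_weaken (Hd X X2) _.
set m0 : nat -> bool := fun=> false; set M := N m0 (env2 w y) in fE *.
have eX i : env2 w y i <= X by rewrite /env2; case: ifP.
have MX : M <= X ^ a by apply: Ha.
have locE : regs3 n w y \o loc = env2 w y by apply/funext => i /=; rewrite /loc /env2; case: ifP.
pose mm i : nat -> bool := fun k => (k < i) && mem k.
pose rr i := setat (setat (regs3 n w y) 3 (M - i)) 4 i.
have X1 : 2 <= X ^ a.+1 := leq_trans X2 (leq_exp1 a X2).
apply: (@runs_seq _ _ _ _ (emb z 0 (mm 0) (rr 0))).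
  have := H1 z m0 (regs3 n w y) X X2; rewrite locE -/M.
  have -> : emb z 0 m0 (setat (regs3 n w y) 3 M) = emb z 0 m0 (rr 0).
    by apply: emb_eq => -[|[|[|[|[|i]]]]]; rewrite // /rr /setat /= subn0.
  apply; first by case=> [|[|[|i]]].
  by move=> i; rewrite /loc; case: ifP.
apply: (@runs_seq _ _ _ _ (emb z 0 (mm M) (rr M))); last first.
  have := emb_clear z 0 (mm M) (rr M) 4; have -> : rr M 4 = M by [].
  have -> : emb z 0 (mm M) (setat (rr M) 4 0) = emb z 0 (mm M) (regs3 n w y).
    by apply: emb_eq => -[|[|[|[|[|i]]]]]; rewrite // /rr /setat /= subnn.
  by apply: runs_weaken; rewrite [leqRHS]addn1 ltnS leq_mul2l MX.
apply: (@runs_weaken _ _ (M * (T X + 3)).+1); first by rewrite [leqRHS]addn1 ltnS leq_mul2r MX orbT.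
apply: (@emb_loop _ _ M (fun=> z) (fun=> 0) mm rr) => i iM //.
set r0 := setat (rr i) _ _.
have iX : i <= X ^ a by apply: leq_trans (ltnW iM) MX.
have iX1 : i <= X ^ a.+1 by apply: leq_trans iX (leq_expS X2 _).
have r0E : r0 \o scons 4 loc = scons i (env2 w y).
  by apply/funext => -[|k] //=; rewrite /loc /env2; case: ifP.
have A := H2 z (mm i) r0 _ X1; rewrite r0E fE // -expnM in A.
apply: runs_seq (A _ _) _.
- by case=> [|[|[|[|[|k]]]]].
- move=> k; rewrite -/((r0 \o scons 4 loc) k) r0E; case: k => [|k] //=.
  exact: leq_trans (eX k) (leq_exp1 _ X2).
set r1 := setat r0 5 _; apply: (@runs_seq _ _ _ _ (emb z 0 (mm i.+1) r0)); last first.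
  have := emb_inc z 0 (mm i.+1) r0 4; set r2 := setat r0 4 _.
  by have -> : emb z 0 (mm i.+1) r2 = emb z 0 (mm i.+1) (rr i.+1) by apply: emb_eq => -[|[|[|[|[|k]]]]].
rewrite addn2; apply: runs_if => /=; have -> : r1 5 = mem i by [].
have mS : mm i.+1 = setat (mm i) i (mem i).
  apply/funext => k; rewrite /mm /setat ltnS leq_eqVlt; case: eqP => [->|_] //.
case mi: (mem i); last first.
  rewrite rd_tp0 /=; have -> : emb z 0 (mm i) r1 = emb z 0 (mm i.+1) r0.
    rewrite mS mi; have -> : setat (mm i) i false = mm i.
      by apply/funext => k; rewrite /setat /mm; case: eqP => // ->; rewrite ltnn.
    by apply: emb_eq => -[|[|[|[|[|[|k]]]]]]; rewrite // /r1 mi.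
  by apply: runs_weaken (runs_nop _); lia.
rewrite rd_tpS /=.
have A3 := H3 z (mm i) r1 _ X1; rewrite -expnM in A3; apply: runs_seq (A3 _ _) _ => //.
  by case=> [|[|[|[|[|[|k]]]]]].
set r2 := setat r1 6 _; have r26 : r2 6 = i by [].
apply: (@runs_seq _ _ _ _ (emb z i (mm i) r1)).
  have := emb_walk z 0 (mm i) r2 6; rewrite r26 add0n.
  have -> : emb z i (mm i) (setat r2 6 0) = emb z i (mm i) r1 by apply: emb_eq => -[|[|[|[|[|[|[|k]]]]]]].
  by apply: runs_weaken; rewrite [leqRHS]addn1 ltnS leq_mul2r iX.
have := @runs_inc 1 (emb z i (mm i) r1) i _ (erefl _); rewrite emb_mem => A4.
apply: runs_seq A4 _.
have := @runs_put 1 (emb z i.+1 (mm i) r1) i _ (bit_sym true) (emb_bits (mm i)) (erefl _).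
have -> : setat (emb z i.+1 (mm i) r1) 1 (tp i.+1 (setat (fun k => bit_sym (mm i k)) i (bit_sym true))) =
    emb z i.+1 (mm i.+1) r1.
  have -> : setat (fun k => bit_sym (mm i k)) i (bit_sym true) = (fun k => bit_sym (mm i.+1 k)).
    by apply/funext => k; rewrite mS mi /setat; case: eqP.
  by apply/funext => -[|[|k]].
move=> A5; apply: runs_seq A5 _.
have := @runs_clear 1 (emb z i.+1 (mm i.+1) r1) i.+1 _ (emb_bits (mm i.+1)) (erefl _); rewrite emb_mem => A6.
apply: (@runs_seq _ _ _ _ (emb z 0 (mm i.+1) r1)).
  by apply: runs_weaken A6; rewrite [leqRHS]addn1 ltnS leq_mul2l addn1 ltnS iX.
have := emb_clear z 0 (mm i.+1) r1 5; have -> : r1 5 = 1 by rewrite /r1 /setat /= mi.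
by have -> : emb z 0 (mm i.+1) (setat r1 5 0) = emb z 0 (mm i.+1) r0 by apply: emb_eq => -[|[|[|[|[|[|k]]]]]].
Qed.

Definition out_symbol (v : nat) : io_symbol :=
  match v with 0 => Bit false | 1 => Bit true | _ => Slash end.

Lemma output_phase (len f : pfun) : PC len -> PC f -> exists c d, forall m n w y X,
  2 <= X -> w <= X -> y <= X ->
  exists s, runs c (emb (tp 0 blank) 0 m (regs3 n w y)) (X ^ d) s /\
     (s 0).2 =1 word_tape (mkseq (fun i => out_symbol (f m (scons i (env2 w y)))) (len m (env2 w y))).
Proof.
move=> [[a Ha] /pcomp_top[b Hb]] [[a2 Ha2] /pcomp_top[b2 Hb2]].
pose loc i := if i == 0 then 1 else 2.
have l3 i : loc i < 3 by rewrite /loc; case: ifP.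
have l5 i : scons 4 loc i < 5 by case: i => [|i] //=; rewrite /loc; case: ifP.
have [c1 H1] := Hb loc 3 l3; have [c2 H2] := Hb2 _ 5 l5.
pose W := If 7 nomark (Seq (dec 7) (If 7 nomark (put 0 (Some (inl Slash))) (put 0 (Some (inl (Bit true)))))) (put 0 (Some (inl (Bit false)))).
pose body := Seq c2 (Seq W (Seq (clear 7) (Seq (inc 0) (inc 6)))).
pose T X := X ^ (a.+1 * b2) + (6 + ((3 * X ^ (a.+1 * a2) + 1) + (1 + 1))).
have [d Hd] : poly (fun X => X ^ b + (1 + (X ^ a * (T X + 3) + 1 + ((3 * (X ^ a + 1) + 1) + 1)))).
  by polyt.
exists (Seq c1 (Seq (inc 0) (Seq (loop 5 body) (Seq (clear 0) (Act 0 (fun=> (None, Stay))))))), d => m n w y X X2 wX yX.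
set M := len m _; set out := fun i => out_symbol _.
pose g i x : sym := if x < i then Some (inl (out x)) else None.
have gm i j : nomark (g i j) by rewrite /g; case: ifP.
pose rr i := setat (setat (regs3 n w y) 3 (M - i)) 4 i.
have eX i : env2 w y i <= X by rewrite /env2; case: ifP.
have MX : M <= X ^ a by apply: Ha.
have locE : regs3 n w y \o loc = env2 w y by apply/funext => i /=; rewrite /loc /env2; case: ifP.
have X1 : 2 <= X ^ a.+1 := leq_trans X2 (leq_exp1 a X2).
have R1 : runs c1 (emb (tp 0 blank) 0 m (regs3 n w y)) (X ^ b) (emb (tp 0 blank) 0 m (rr 0)).
  have := H1 (tp 0 blank) m (regs3 n w y) X X2; rewrite locE -/M.
  have -> : emb (tp 0 blank) 0 m (setat (regs3 n w y) 3 M) = emb (tp 0 blank) 0 m (rr 0).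
    by apply: emb_eq => -[|[|[|[|[|i]]]]]; rewrite // /rr /setat /= subn0.
  apply; first by case=> [|[|[|i]]].
  by move=> i; rewrite /loc; case: ifP.
have R2 : runs (inc 0) (emb (tp 0 blank) 0 m (rr 0)) 1 (emb (tp 1 (g 0)) 0 m (rr 0)).
  have -> : blank = g 0 by apply/funext.
  by have := @runs_inc 0 (emb (tp 0 (g 0)) 0 m (rr 0)) 0 (g 0) (erefl _); rewrite emb_io.
have R3 : runs (loop 5 body) (emb (tp 1 (g 0)) 0 m (rr 0)) (M * (T X + 3)).+1 (emb (tp M.+1 (g M)) 0 m (rr M)).
  apply: (@emb_loop _ _ M (fun i => tp i.+1 (g i)) (fun=> 0) (fun=> m) rr) => i iM //.
  set r0 := setat (rr i) _ _; set z := tp i.+1 (g i).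
  have iX : i <= X ^ a by apply: leq_trans (ltnW iM) MX.
  have iX1 : i <= X ^ a.+1 by apply: leq_trans iX (leq_expS X2 _).
  have r0E : r0 \o scons 4 loc = scons i (env2 w y).
    by apply/funext => -[|k] //=; rewrite /loc /env2; case: ifP.
  have eX1 k : scons i (env2 w y) k <= X ^ a.+1.
    by case: k => [|k] //=; apply: leq_trans (eX k) (leq_exp1 _ X2).
  have A := H2 z m r0 _ X1; rewrite r0E -expnM in A.
  have vX := Ha2 m _ _ X1 eX1; rewrite -expnM in vX.
  move: A (erefl (out i)); rewrite {2}/out; set v := f m _ in vX * => A outE.
  apply: runs_seq (A _ _) _.
  - by case=> [|[|[|[|[|k]]]]].
  - by move=> k; rewrite -/((r0 \o scons 4 loc) k) r0E.
  have gS : setat (g i) i (Some (inl (out i))) = g i.+1.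
    by apply/funext => x; rewrite /setat /g; case: eqP => [->|xi]; rewrite ?ltnSn // [x < i.+1]ltnS [x <= i]leq_eqVlt (introF eqP xi).
  have R4 r : runs (put 0 (Some (inl (out i)))) (emb z 0 m r) 1 (emb (tp i.+1 (g i.+1)) 0 m r).
    by have := @runs_put 0 (emb z 0 m r) i (g i) (Some (inl (out i))) (gm i) (erefl _); rewrite emb_io gS.
  apply: (@runs_seq _ _ _ _ (emb (tp i.+1 (g i.+1)) 0 m (setat r0 5 v.-1))).
    apply: (@runs_if _ _ _ _ _ 4) => /=; have -> : setat r0 5 v 5 = v by [].
    case: v A outE vX => [|v] _ outE _.
      rewrite rd_tp0 /=; apply: (runs_weaken (isT : 1 <= 4)); rewrite outE in R4; exact: R4.
    rewrite rd_tpS /=; apply: (@runs_seq _ _ _ 1 (emb z 0 m (setat r0 5 v)) 3).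
      have := emb_dec z 0 m (setat r0 5 v.+1) 5; set r1 := setat (setat r0 5 v.+1) 5 _.
      by have -> : emb z 0 m r1 = emb z 0 m (setat r0 5 v) by apply: emb_eq => -[|[|[|[|[|[|k]]]]]].
    apply: (@runs_if _ _ _ _ _ 1) => /=; have -> : setat r0 5 v 5 = v by [].
    by case: v outE => [|v] outE; rewrite ?rd_tp0 ?rd_tpS /=; rewrite outE in R4; apply: R4.
  apply: (@runs_seq _ _ _ _ (emb (tp i.+1 (g i.+1)) 0 m r0)).
    have := emb_clear (tp i.+1 (g i.+1)) 0 m (setat r0 5 v.-1) 5; set r1 := setat _ 5 0.
    have -> : emb (tp i.+1 (g i.+1)) 0 m r1 = emb (tp i.+1 (g i.+1)) 0 m r0.
      by apply: emb_eq => -[|[|[|[|[|[|k]]]]]].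
    have -> : setat r0 5 v.-1 5 = v.-1 by [].
    by apply: runs_weaken; rewrite [leqRHS]addn1 ltnS leq_mul2l (leq_trans (leq_pred _) vX).
  apply: (@runs_seq _ _ _ _ (emb (tp i.+2 (g i.+1)) 0 m r0)).
    by have := @runs_inc 0 (emb (tp i.+1 (g i.+1)) 0 m r0) i.+1 (g i.+1) (erefl _); rewrite emb_io.
  have := emb_inc (tp i.+2 (g i.+1)) 0 m r0 4; set r2 := setat r0 4 _.
  by have -> : emb (tp i.+2 (g i.+1)) 0 m r2 = emb (tp i.+2 (g i.+1)) 0 m (rr i.+1)
    by apply: emb_eq => -[|[|[|[|[|k]]]]].
have R5 : runs (clear 0) (emb (tp M.+1 (g M)) 0 m (rr M)) (3 * M.+1).+1 (emb (tp 0 (g M)) 0 m (rr M)).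
  by have := @runs_clear 0 (emb (tp M.+1 (g M)) 0 m (rr M)) M.+1 (g M) (gm M) (erefl _); rewrite emb_io.
have R6 := runs_act 0 (fun=> (None, Stay)) (emb (tp 0 (g M)) 0 m (rr M)).
eexists; split.
  apply: runs_weaken (Hd X X2) _; apply: runs_seq R1 (runs_seq R2 _).
  apply: runs_seq (runs_weaken _ R3) (runs_seq (runs_weaken _ R5) R6).
    by rewrite [leqRHS]addn1 ltnS leq_mul2r MX orbT.
  by rewrite [leqRHS]addn1 ltnS leq_mul2l addn1 ltnS MX.
move=> [x|[|x]] //=; rewrite /setat /=.
rewrite /g; case: ltnP => xM.
  by rewrite (nth_map Slash) ?size_mkseq // nth_mkseq.
by rewrite nth_default // size_map size_mkseq.
Qed.

Lemma main_program (fw : nat -> nat) (beta : nat) (N f len g : pfun) (mem : nat -> nat -> bool) :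
  PC (fun _ e => fw (e 0)) -> PC N -> PC f -> PC len -> PC g -> 2 <= beta ->
  (forall n, 0 < fw n) -> (forall n, n <= beta ^ fw n) ->
  (forall n i, i < N (fun=> false) (env2 (fw n) (beta ^ fw n)) ->
     f (fun k => (k < i) && mem n k) (scons i (env2 (fw n) (beta ^ fw n))) = mem n i) ->
  exists M d, forall n,
    let e := env2 (fw n) (beta ^ fw n) in
    let m := fun k => (k < N (fun=> false) e) && mem n k in
    tm_outputs M (nat_word n) ((beta ^ fw n) ^ d) (mkseq (fun i => out_symbol (g m (scons i e))) (len m e)).
Proof.
move=> Pw PN Pf Pl Pg beta2 fw0 fwn memE.
have [c1 [d1 H1]] := decode_phase.
have [c2 [d2 H2]] := power_phase Pw (ltnW beta2).
have [c3 [d3 H3]] := memory_phase PN Pf.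
have [c4 [d4 H4]] := output_phase Pl Pg.
pose c := Seq c1 (Seq c2 (Seq c3 c4)); pose K := ntapes c.
have cK : ntapes (Seq (markall K) c) <= K by rewrite /= ntapes_markall -/(ntapes c) maxnn.
have [d Hd] : poly (fun X => 2 * K.+1 + (X ^ d1 + (X ^ d2 + (X ^ d3 + X ^ d4)))) by polyt.
exists (machine (Seq (markall K) c) K), d => n /=.
set w := fw n; set y := beta ^ w; pose m k := (k < N (fun=> false) (env2 w y)) && mem n k.
have y2 : 2 <= y by have := fw0 n; rewrite /y /w; case: (fw n) => // k _; apply: leq_trans beta2 (leq_exp1 _ beta2).
have wy : w <= y by apply: ltnW; apply: ltn_expl.
have [s [R4 out]] := H4 m n w y y y2 wy (leqnn y).
apply: (runs_outputs cK _ out); apply: runs_weaken (Hd y y2) _.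
apply: runs_seq (runs_markall K (nat_word n)) _.
apply: runs_seq (H1 n y y2 (fwn n)) _.
apply: runs_seq (H2 _ _ n y y2 (fwn n) wy (leqnn y)) _.
by apply: runs_seq (H3 _ n w y y (mem n) y2 wy (leqnn y) (memE n)) R4.
Qed.

End MainProgram.

(** * Rounded transfer matrix iteration *)

Section Transfer.
Local Open Scope nat_scope.
Context (beta q w : nat) (fb1 fb2 : seq (nat * nat)).
Context (beta2 : 1 < beta) (qb : q <= beta) (q0 : 0 < q) (w0 : 0 < w).
Local Notation y := (beta ^ w).
Context (fb1l : forall d, (0, d) \notin fb1) (fb1r : forall d, (d, 0) \notin fb1).
Context (fb2l : forall d, (0, d) \notin fb2) (fb2r : forall d, (d, 0) \notin fb2).

Definition push (j d : nat) : nat := (j * beta + d) %% y.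

Lemma pushE j d : push j d = (j * beta + d) %% y. Proof. by []. Qed.

(** The last [w] letters before the site number [t] are the base [beta] digits
   of [j], the last one being the least significant. *)
Definition okn (t j d : nat) : bool :=
  ((j %/ (y %/ beta), d) \notin fb2) && ((t %% w == 0) || ((j %% beta, d) \notin fb1)).

Fixpoint V (r t j : nat) : nat :=
  if r is r'.+1 then \sum_(d < q) okn t j d * V r' t.+1 (push j d) else 1.

Let y0 : 0 < y. Proof. by rewrite expn_gt0 ltnW. Qed.

Lemma push_lt j d : push j d < y. Proof. exact: ltn_pmod. Qed.

Lemma okn0 t j : okn t j 0. Proof. by rewrite /okn fb1r fb2r orbT. Qed.

Lemma divn_top : y %/ beta = beta ^ w.-1.
Proof. by case: w w0 => // k _; rewrite expnS mulKn // ltnW. Qed.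

Lemma trunc_digit j d b : 0 < b -> d < q -> j %% b * beta + d < b * beta.
Proof.
move=> b0 dq; have h := ltn_pmod j b0.
apply: leq_trans (_ : (j %% b).+1 * beta <= _); last by rewrite leq_mul2r h orbT.
by rewrite mulSn addnC ltn_add2r (leq_trans dq).
Qed.

Lemma V_trunc r t j i : j < y -> i <= w -> V r t j <= V r t (j %% beta ^ i).
Proof.
elim: r t j i => // r IH t j i jy iw.
have [->|iltw] : i = w \/ i < w by lia.
  by rewrite (modn_small jy).
have bi : 0 < beta ^ i by rewrite expn_gt0 ltnW.
apply: leq_sum => -[d dq] _ /=; apply: leq_mul.
  rewrite /okn; case: (_ && _) / andP => // -[h2 h1]; rewrite lt0b; apply/andP; split.
    rewrite divn_small ?fb2l // divn_top; apply: leq_trans (ltn_pmod _ bi) _.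
    by rewrite leq_pexp2l ?(ltnW beta2) // -ltnS prednK.
  case/orP: h1 => [->//|h1]; apply/orP; right.
  case: i iltw {iw bi} => [|i] iw; first by rewrite expn0 modn1 mod0n.
  by rewrite modn_dvdm // expnS dvdn_mulr.
apply: leq_trans (IH t.+1 _ i.+1 (push_lt _ _) iltw) _.
suff -> : push j d %% beta ^ i.+1 = push (j %% beta ^ i) d by [].
have dv : beta ^ i.+1 %| y by rewrite dvdn_exp2l.
rewrite /push modn_dvdm // [RHS]modn_small.
  rewrite {1}(divn_eq j (beta ^ i)) mulnDl -mulnA -expnSr -addnA modnMDl modn_small //.
  by rewrite expnSr; apply: trunc_digit.
apply: leq_trans (_ : beta ^ i.+1 <= _); last by rewrite leq_pexp2l ?(ltnW beta2).
by rewrite expnSr; apply: trunc_digit.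
Qed.

Lemma V_max r t j : j < y -> V r t j <= V r t 0.
Proof. by move=> jy; have := @V_trunc r t j 0 jy isT; rewrite expn0 modn1. Qed.

Lemma V_min i r t j : j < y -> (j * beta ^ i) %% y = 0 -> V r t 0 <= q ^ i * V r t j.
Proof.
elim: r t j i => [|r IH] t j i jy; first by rewrite /= muln1 expn_gt0 q0.
case: i => [|i] ji.
  by move: ji; rewrite expn0 muln1 modn_small // => ->; rewrite mul1n.
have p0 : push j 0 = (j * beta) %% y by rewrite /push addn0.
have IH' : V r t.+1 0 <= q ^ i * V r t.+1 (push j 0).
  by apply: IH; rewrite ?push_lt // p0 modnMml -mulnA -expnS.
apply: leq_trans (_ : \sum_(d < q) V r t.+1 0 <= _).
  apply: leq_sum => d _; rewrite -[leqRHS]mul1n leq_mul ?leq_b1 //.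
  exact: V_max (push_lt _ _).
rewrite sum_nat_const card_ord expnS -mulnA leq_mul2l; apply/orP; right.
apply: leq_trans IH' _; rewrite leq_mul2l; apply/orP; right.
by rewrite /= (bigD1 (Ordinal q0)) //= okn0 mul1n leq_addr.
Qed.

Lemma V_gt0 r t j : 0 < V r t j.
Proof.
elim: r t j => // r IH t j; rewrite /= (bigD1 (Ordinal q0)) //= okn0 mul1n.
exact: leq_trans (IH _ _) (leq_addr _ _).
Qed.

Lemma V1_le t j : V 1 t j <= q.
Proof.
have -> : q = \sum_(d < q) 1 by rewrite sum_nat_const card_ord muln1.
by apply: leq_sum => d _; rewrite muln1 leq_b1.
Qed.

Context (Q : nat).

Definition spread (t : nat) (x : nat -> nat) (j' : nat) : nat :=
  \sum_(j < y) \sum_(d < q) (push j d == j') * (okn t j d * x j).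

Definition rescale (x : nat -> nat) : nat := if Q < \sum_(j < y) x j then q else 1.

Fixpoint F (t : nat) : nat -> nat :=
  if t is t'.+1 then fun j => spread t' (F t') j %/ rescale (spread t' (F t'))
  else fun j => (j == 0) * Q.

Definition pairing t r := \sum_(j < y) F t j * V r t j.

Lemma pairingE t r : pairing t r = \sum_(j < y) F t j * V r t j. Proof. by []. Qed.

Lemma spread_pairing t (x : nat -> nat) r :
  \sum_(j < y) spread t x j * V r t.+1 j = \sum_(j < y) x j * V r.+1 t j.
Proof.
under eq_bigr do rewrite /spread big_distrl /=.
rewrite exchange_big; apply: eq_bigr => j _ /=.
under eq_bigr do rewrite big_distrl /=.
rewrite exchange_big big_distrr; apply: eq_bigr => d _ /=.
rewrite (bigD1 (Ordinal (push_lt j d))) //= eqxx mul1n big1 ?addn0; first by lia.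
by move=> i; rewrite -val_eqE /= eq_sym => /negbTE ->.
Qed.

Lemma spread_total t (x : nat -> nat) : \sum_(j < y) x j <= \sum_(j < y) spread t x j <= q * \sum_(j < y) x j.
Proof.
have := spread_pairing t x 0; under eq_bigr do rewrite muln1; move=> ->.
rewrite big_distrr /=; apply/andP; split; apply: leq_sum => j _.
  by rewrite leq_pmulr // (V_gt0 1).
by rewrite mulnC leq_mul2r V1_le orbT.
Qed.

Lemma rescale_gt0 x : 0 < rescale x. Proof. by rewrite /rescale; case: ifP. Qed.

Lemma F_total_le t : \sum_(j < y) F t j <= Q.
Proof.
elim: t => [|t IH].
  rewrite (bigD1 (Ordinal y0)) //= mul1n big1 ?addn0 // => j; rewrite -val_eqE /=.
  by move=> /negbTE ->.
have /andP[_ s2] := spread_total t (F t).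
rewrite /= /rescale; case: ltnP => h; last by under eq_bigr do rewrite divn1.
rewrite -(leq_pmul2l q0); apply: leq_trans (leq_trans s2 _); last by rewrite leq_mul2l IH orbT.
by rewrite big_distrr /=; apply: leq_sum => j _; rewrite mulnC leq_divM.
Qed.

Lemma F_total_ge t : Q <= q * (\sum_(j < y) F t j + y).
Proof.
elim: t => [|t IH].
  rewrite (bigD1 (Ordinal y0)) //= mul1n; nia.
have /andP[s1 _] := spread_total t (F t).
rewrite /= /rescale; case: ltnP => h; last first.
  under eq_bigr do rewrite divn1; apply: leq_trans IH _.
  by rewrite leq_mul2l leq_add2r s1 orbT.
apply: leq_trans (ltnW h) _.
have -> : \sum_(j < y) spread t (F t) j %/ q + y = \sum_(j < y) (spread t (F t) j %/ q + 1).
  by rewrite big_split sum_nat_const card_ord muln1.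
rewrite big_distrr /=.
by apply: leq_sum => j _; rewrite addn1 mulnC; apply: ltnW; apply: ltn_ceil.
Qed.

Lemma pairing_upper t r :
  pairing t.+1 r * rescale (spread t (F t)) <= pairing t r.+1.
Proof.
rewrite /pairing -spread_pairing big_distrl /=; apply: leq_sum => j _.
by rewrite mulnAC leq_mul2r leq_divM orbT.
Qed.

Lemma pairing_lower t r : Q * pairing t r.+1 <=
  Q * (pairing t.+1 r * rescale (spread t (F t))) + q * y * q ^ w * pairing t r.+1.
Proof.
have E := spread_pairing t (F t) r; rewrite -/(pairing t r.+1) in E.
rewrite -E /pairing /= /rescale; case: ltnP => h; last first.
  apply: leq_trans (leq_addr _ _); rewrite muln1 leq_mul2l; apply/orP; right.
  by apply: leq_sum => j _; rewrite divn1.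
set x := spread t (F t) in h *; set v := V r t.+1.
have B : \sum_(j < y) x j * v j <= (\sum_(j < y) x j %/ q * v j) * q + q * y * v 0.
  have -> : q * y * v 0 = \sum_(j < y) q * v 0 by rewrite sum_nat_const card_ord; lia.
  rewrite big_distrl -big_split /=; apply: leq_sum => j _.
  have vj : v j <= v 0 by apply: V_max.
  have := ltnW (ltn_ceil (x j) q0); nia.
have D : Q * v 0 <= q ^ w * \sum_(j < y) x j * v j.
  apply: leq_trans (_ : (\sum_(j < y) x j) * v 0 <= _); first by rewrite leq_mul2r ltnW ?orbT.
  rewrite big_distrl big_distrr /=; apply: leq_sum => j _.
  have : v 0 <= q ^ w * v j by apply: V_min => //; rewrite modnMl.
  by move=> vj; rewrite mulnCA leq_mul2l vj orbT.
have := leq_mul (leqnn Q) B; rewrite mulnDr => B1; apply: leq_trans B1 _.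
rewrite leq_add2l; have := leq_mul (leqnn (q * y)) D.
by rewrite mulnCA mulnA => D1; rewrite mulnCA -!mulnA in D1 *.
Qed.

End Transfer.

Section Accuracy.
Context {R : realType} (beta q w : nat) (fb1 fb2 : seq (nat * nat)).
Context (beta2 : (1 < beta)%N) (qb : (q <= beta)%N) (q0 : (0 < q)%N) (w0 : (0 < w)%N).
Local Notation y := (beta ^ w)%N.
Context (fb1l : forall d, (0%N, d) \notin fb1) (fb1r : forall d, (d, 0%N) \notin fb1).
Context (fb2l : forall d, (0%N, d) \notin fb2) (fb2r : forall d, (d, 0%N) \notin fb2).
Context (Q : nat) (Q0 : (0 < Q)%N).
Local Notation V := (V beta q w fb1 fb2).
Local Notation F := (F beta q w fb1 fb2 Q).
Local Notation pairing := (pairing beta q w fb1 fb2 Q).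
Local Notation sc t := (rescale beta q w Q (spread beta q w fb1 fb2 t (F t))).

Let eta : R := (q * y * q ^ w)%:R / Q%:R.
Context (eta1 : eta <= 1).

Fixpoint scale t : R := if t is t'.+1 then scale t' / (sc t')%:R else Q%:R.

Lemma sc_gt0 t : (0 : R) < (sc t)%:R. Proof. by rewrite ltr0n rescale_gt0. Qed.

Lemma scale_gt0 t : 0 < scale t.
Proof. by elim: t => [|t IH] /=; rewrite ?ltr0n // divr_gt0 // sc_gt0. Qed.

Lemma pairing_bounds t r :
  (1 - t%:R * eta) * (scale t * (V (t + r) 0 0)%:R) <= (pairing t r)%:R <=
  scale t * (V (t + r) 0 0)%:R.
Proof.
have e0 : 0 <= eta by rewrite divr_ge0.
elim: t r => [|t IH] r.
  have -> : pairing 0 r = (Q * V r 0 0)%N.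
    have y0 : (0 < y)%N by rewrite expn_gt0 ltnW.
    rewrite pairingE (bigD1 (Ordinal y0)) //= mul1n big1 ?addn0 // => j; rewrite -val_eqE /=.
    by move=> /negbTE ->.
  by rewrite mul0r subr0 mul1r add0n /= natrM lexx.
have /andP[l u] := IH r.+1; rewrite addSnnS; set N := (V _ 0 0)%:R in l u *.
have s0 := sc_gt0 t.
have U : (pairing t.+1 r)%:R * (sc t)%:R <= (pairing t r.+1)%:R :> R.
  by rewrite -natrM ler_nat pairing_upper.
have L : (1 - eta) * (pairing t r.+1)%:R <= (pairing t.+1 r)%:R * (sc t)%:R.
  have := @pairing_lower beta q w fb1 fb2 beta2 qb q0 w0 fb1l fb1r fb2l fb2r Q t r.
  have Q0r : (0 : R) < Q%:R by rewrite ltr0n.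
  have eQ : Q%:R * eta = (q * y * q ^ w)%:R by rewrite mulrC divfK // gt_eqF.
  rewrite -(ler_nat R) natrD [in X in X -> _](natrM _ Q) [in X in X -> _](natrM _ Q) [in X in X -> _](natrM _ (_ * _)) -eQ natrM => low.
  by rewrite -(ler_pM2l Q0r); lra.
have -> : scale t.+1 * N = scale t * N / (sc t)%:R by rewrite /= mulrAC.
apply/andP; split; last by rewrite ler_pdivlMr //; apply: le_trans U u.
rewrite mulrA ler_pdivrMr //; apply: le_trans L.
have cN : 0 <= scale t * N by rewrite mulr_ge0 // ltW // scale_gt0.
apply: le_trans (_ : (1 - eta) * ((1 - t%:R * eta) * (scale t * N)) <= _); last first.
  by rewrite ler_wpM2l // subr_ge0.
rewrite mulrA; apply: ler_wpM2r => //; rewrite -natr1.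
have : 0 <= t%:R * eta * eta by rewrite !mulr_ge0.
lra.
Qed.

End Accuracy.

Section Logarithm.
Context {R : realType}.

Lemma ln_sandwich (a b e : R) : 0 < b -> 0 <= e -> e <= 1 / 2 -> (1 - e) * b <= a <= b ->
  - (2 * e) <= ln a - ln b <= 0.
Proof.
move=> b0 e0 e2 /andP[l u]; have e1 : 0 < 1 - e by lra.
have a0 : 0 < a by apply: lt_le_trans l; rewrite mulr_gt0.
apply/andP; split; last by rewrite subr_le0 ler_ln.
have : ln ((1 - e) * b) <= ln a by rewrite ler_ln // posrE mulr_gt0.
rewrite lnM ?posrE // => h.
have : ln (1 + e / (1 - e)) <= e / (1 - e).
  by apply: le_ln1Dx; apply: lt_le_trans (_ : 0 <= _); rewrite ?ltrN10 // divr_ge0 // ltW.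
have -> : 1 + e / (1 - e) = (1 - e)^-1 by field; lra.
rewrite lnV ?posrE // => k.
have : e / (1 - e) <= 2 * e by rewrite ler_pdivrMr //; nra.
lra.
Qed.

Lemma ln_step k : (0 < k)%N -> k.+1%:R^-1 <= ln (k.+1%:R : R) - ln k%:R <= k%:R^-1.
Proof.
move=> k0; have kr : (0 : R) < k%:R by rewrite ltr0n.
have k1 : (0 : R) < k.+1%:R by rewrite ltr0n.
have up (x y : R) : 0 < x -> 0 < y -> ln y - ln x <= y / x - 1.
  move=> x0 y0; rewrite -ln_div ?posrE //.
  have := @le_ln1Dx R (y / x - 1); rewrite addrCA subrr addr0; apply.
  have h : 0 < y / x by rewrite divr_gt0.
  lra.
apply/andP; split.
  have := up _ _ k1 kr; have -> : k%:R / k.+1%:R - 1 = - k.+1%:R^-1 :> R.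
    by rewrite -[k.+1%:R]natr1; field; rewrite natr1 gt_eqF.
  by rewrite lerNr opprB.
have := up _ _ kr k1; have -> // : k.+1%:R / k%:R - 1 = k%:R^-1 :> R.
by rewrite -[k.+1%:R]natr1; field; rewrite gt_eqF.
Qed.

Lemma harmonic_ln a n : (0 < a)%N ->
  0 <= (\sum_(i < n) (a + i)%:R^-1 - (ln (a + n)%:R - ln a%:R) : R) <= a%:R^-1 - (a + n)%:R^-1.
Proof.
move=> a0; elim: n => [|n IH]; first by rewrite big_ord0 addn0 !subrr lexx.
rewrite big_ord_recr /= addnS; have := ln_step (_ : (0 < a + n)%N); rewrite addn_gt0 a0 => /(_ isT).
move: IH; set S := \sum_(i < n) _; set u := (a + n)%:R^-1; set v := (a + n).+1%:R^-1; set b := a%:R^-1.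
set l := ln (a + n)%:R; set l1 := ln (a + n).+1%:R; set l0 := ln a%:R; clearbody S u v b l l1 l0.
move=> /andP[? ?] /andP[? ?]; apply/andP; split; lra.
Qed.

Lemma harmonic_floor a b D : (0 < a)%N -> (a <= b)%N -> (0 < D)%N ->
  `|(\sum_(i < b - a) D %/ (a + i))%N%:R / D%:R - (ln b%:R - ln a%:R)| <=
    a%:R^-1 + (b - a)%:R / D%:R :> R.
Proof.
move=> a0 ab D0; have Dr : (0 : R) < D%:R by rewrite ltr0n.
have := harmonic_ln (b - a) a0; rewrite subnKC //.
set S : R := \sum_(i < _) _; set f : R := _ / D%:R => H.
have b0 : (0 : R) <= b%:R^-1 by rewrite invr_ge0.
have : S - (b - a)%:R / D%:R <= f <= S.
  rewrite /f natr_sum mulr_suml /S; apply/andP; split.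
    have -> : (b - a)%:R / D%:R = \sum_(i < b - a) D%:R^-1 :> R.
      by rewrite sumr_const card_ord -[RHS]mulr_natl.
    rewrite -sumrB; apply: ler_sum => i _; rewrite lerBlDr -[X in _ + X]mul1r -mulrDl.
    have ai : (0 : R) < (a + i)%:R by rewrite ltr0n addn_gt0 a0.
    rewrite ler_pdivlMr // mulrC ler_pdivrMr //.
    by rewrite natr1 -natrM ler_nat ltnW // ltn_ceil // addn_gt0 a0.
  apply: ler_sum => i _; have ai : (0 : R) < (a + i)%:R by rewrite ltr0n addn_gt0 a0.
  by rewrite ler_pdivrMr // mulrC ler_pdivlMr // -natrM ler_nat leq_divM.
set t := (b - a)%:R / D%:R; have t0 : 0 <= t by rewrite divr_ge0.
move: H; move: (ln _ - ln _) (a%:R^-1) (b%:R^-1) b0 => l u v b0 /andP[? ?] /andP[? ?].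
by rewrite ler_norml; apply/andP; split; lra.
Qed.

End Logarithm.

Lemma eta_small (R : realType) (q Y p w T : nat) : (2 <= Y)%N -> (q <= Y)%N -> (p <= Y)%N ->
  (w <= Y)%N -> (T <= w ^ 2)%N -> let eta : R := (q * Y * p)%:R / (Y ^ 6)%:R in
  [/\ 0 <= eta, eta <= 1 & T%:R * eta <= Y%:R^-1].
Proof.
move=> Y2 qY pY wY Tw eta.
have Y6 : (0 < Y ^ 6)%N by rewrite expn_gt0; lia.
have qYp : (q * Y * p <= Y ^ 3)%N.
  by rewrite (_ : Y ^ 3 = Y * Y * Y)%N; [rewrite !leq_mul | lia].
split; first by rewrite divr_ge0.
  rewrite ler_pdivrMr ?ltr0n // mul1r ler_nat (leq_trans qYp) // leq_pexp2l //; lia.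
rewrite mulrA -natrM ler_pdivrMr ?ltr0n // mulrC ler_pdivlMr ?ltr0n; last by lia.
rewrite -natrM ler_nat; apply: leq_trans (_ : Y ^ 2 * Y ^ 3 * Y <= _)%N; last by lia.
apply: leq_mul (leq_mul _ qYp) (leqnn Y); apply: leq_trans Tw _; by rewrite leq_sqr.
Qed.

Section Algorithm.
Context {R : realType} (beta q w : nat) (fb1 fb2 : seq (nat * nat)).
Context (beta2 : (1 < beta)%N) (qb : (q <= beta)%N) (q0 : (0 < q)%N) (w0 : (0 < w)%N).
Local Notation y := (beta ^ w)%N.
Context (fb1l : forall d, (0%N, d) \notin fb1) (fb1r : forall d, (d, 0%N) \notin fb1).
Context (fb2l : forall d, (0%N, d) \notin fb2) (fb2r : forall d, (d, 0%N) \notin fb2).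
Local Notation Q := (y ^ 6)%N.
Local Notation V := (V beta q w fb1 fb2).
Local Notation F := (F beta q w fb1 fb2 Q).

Definition low T : nat := \sum_(j < y) F T j.
Definition high T : nat := \sum_(j < y) spread beta q w fb1 fb2 T (F T) j.
Definition numerator T : nat := \sum_(i < high T - low T) y ^ 8 %/ (low T + i).

Lemma algorithm_accuracy T : (T <= w ^ 2)%N ->
  `|(numerator T)%:R / (y ^ 8)%:R - (ln (V T.+1 0 0)%:R - ln (V T 0 0)%:R)| <= 4 / y%:R :> R.
Proof.
move=> Tw; have by_ : (beta <= y)%N by rewrite -{1}[beta]expn1 leq_pexp2l // ltnW.
have y2 : (2 <= y)%N := leq_trans beta2 by_.
have wy : (w <= y)%N by apply: ltnW; apply: ltn_expl.
have qy : (q <= y)%N := leq_trans qb by_.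
have qwy : (q ^ w <= y)%N by rewrite leq_exp2r.
have yr : (0 : R) < y%:R by rewrite ltr0n (ltnW y2).
have Q0 : (0 < Q)%N by rewrite expn_gt0 (ltnW y2).
have [e0 e1 eT] := eta_small R y2 qy qwy wy Tw.
set eta : R := (q * y * q ^ w)%:R / Q%:R in e0 e1 eT.
have F1 := F_total_le beta2 qb q0 w0 fb1r fb2r Q T; have F2 := F_total_ge beta2 qb q0 w0 fb1r fb2r Q T.
rewrite -/(low T) in F1 F2.
have /andP[s1 s2] := spread_total beta2 qb q0 w0 fb1r fb2r T (F T).
rewrite -/(low T) -/(high T) in s1 s2.
have l0 : (y <= low T)%N.
  have : (y * y ^ 5 <= y * (low T + y))%N.
    by rewrite -expnS; apply: leq_trans F2 _; rewrite leq_mul2r qy orbT.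
  have : (2 * y <= y ^ 5)%N by rewrite [leqRHS]expnS mulnC leq_mul2l (leq_trans y2) ?orbT // -{1}[y]expn1 leq_pexp2l //; lia.
  by rewrite leq_pmul2l; lia.
have Pr : pairing beta q w fb1 fb2 Q T 1 = high T.
  by rewrite /pairing -spread_pairing // /high; apply: eq_bigr => j _; rewrite muln1.
have Sr : pairing beta q w fb1 fb2 Q T 0 = low T.
  by apply: eq_bigr => j _; rewrite muln1.
have HP := pairing_bounds beta2 qb q0 w0 fb1l fb1r fb2l fb2r Q0 e1 T 1.
have HS := pairing_bounds beta2 qb q0 w0 fb1l fb1r fb2l fb2r Q0 e1 T 0.
rewrite Pr addn1 in HP; rewrite Sr addn0 in HS.
set c := scale _ _ _ _ _ _ T in HP HS.
have c0 : 0 < c by apply: scale_gt0.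
have v0 t : (0 : R) < (V t 0 0)%:R by rewrite ltr0n V_gt0.
have hf : T%:R * eta <= 1 / 2.
  by apply: le_trans eT _; rewrite div1r lef_pV2 ?posrE ?ltr0n ?ler_nat // (ltnW y2).
have te0 : 0 <= T%:R * eta by rewrite mulr_ge0.
have /andP[p1 p2] := ln_sandwich (mulr_gt0 c0 (v0 T.+1)) te0 hf HP.
have /andP[t1 t2] := ln_sandwich (mulr_gt0 c0 (v0 T)) te0 hf HS.
rewrite !lnM ?posrE // in p1 p2 t1 t2.
have D0 : (0 < y ^ 8)%N by rewrite expn_gt0 (ltnW y2).
have := @harmonic_floor R _ _ _ (leq_trans (ltnW y2) l0) s1 D0; rewrite -/(numerator T).
have i1 : (low T)%:R^-1 <= y%:R^-1 :> R.
  by rewrite lef_pV2 ?posrE ?ler_nat ?ltr0n // (leq_trans (ltnW y2)).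
have i2 : (high T - low T)%:R / (y ^ 8)%:R <= y%:R^-1 :> R.
  rewrite ler_pdivrMr ?ltr0n // [leRHS]mulrC ler_pdivlMr // -natrM ler_nat.
  rewrite [leqRHS]expnS mulnC leq_mul2l; apply/orP; right.
  apply: leq_trans (leq_subr _ _) (leq_trans s2 _).
  by rewrite expnS leq_mul.
move: eT i1 i2 p1 p2 t1 t2; rewrite !ler_norml.
move: (ln (V T.+1 0 0)%:R) (ln (V T 0 0)%:R) (ln (high T)%:R) (ln (low T)%:R) (ln c) => a b a' b' lc.
move: (y%:R^-1) ((low T)%:R^-1) (_ / _) (_ / _) (T%:R * eta) te0 hf => u v f g e e00 eh.
move=> ? ? ? ? ? ? ? /andP[? ?]; have -> : 4 * u = u * 4 by rewrite mulrC.
by apply/andP; split; lra.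
Qed.

End Algorithm.

Section WordCount.
Context {R : realType} {A : finType} (E1 E2 : {set A * A}).
Context (a0 : A) (safe0 : safe_symbol E1 E2 a0).
Context (beta w : nat) (beta2 : (1 < beta)%N) (qb : (#|A| <= beta)%N) (w0 : (0 < w)%N).
Context (dig : A -> nat) (letter_of : nat -> A).
Context (digK : cancel dig letter_of) (dig_lt : forall a, (dig a < #|A|)%N) (dig0 : dig a0 = 0%N).

Definition forbidden (E : {set A * A}) : seq (nat * nat) := [seq (dig p.1, dig p.2) | p <- enum (~: E)].

Lemma mem_forbidden E a b : ((dig a, dig b) \in forbidden E) = ((a, b) \notin E).
Proof.
apply/mapP/idP => [[[c d]]|abE]; last by exists (a, b); rewrite // mem_enum inE.
by rewrite mem_enum inE => cd [/(can_inj digK) -> /(can_inj digK) ->].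
Qed.

Lemma forbidden0l d : ((0%N, d) \notin forbidden E1) && ((0%N, d) \notin forbidden E2).
Proof.
apply/andP; split; apply/mapP => -[[b c]]; rewrite mem_enum inE => /= /negP bc [e0 _]; apply: bc;
  move: e0; rewrite -dig0 => /(can_inj digK) <-; by case: (safe0 c).
Qed.

Lemma forbidden0r d : ((d, 0%N) \notin forbidden E1) && ((d, 0%N) \notin forbidden E2).
Proof.
apply/andP; split; apply/mapP => -[[b c]]; rewrite mem_enum inE => /= /negP bc [_ e0]; apply: bc;
  move: e0; rewrite -dig0 => /(can_inj digK) <-; by case: (safe0 b).
Qed.

Definition okl (x : Z2 -> A) (s : nat) : bool :=
  ((s < w)%N || ((x (site w (s - w)), x (site w s)) \in E2)) &&
  ((s %% w == 0)%N || ((x (site w s.-1), x (site w s)) \in E1)).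

Lemma site_inj s s' : site w s = site w s' -> s = s'.
Proof. by case=> e1 e2; rewrite (divn_eq s w) (divn_eq s' w) e1 e2. Qed.

Lemma okl_adm T x : agree_off (reg w T) x (free a0) ->
  adm E1 E2 (reg w T) x = all (okl x) (iota 0 T).
Proof.
move=> xoff; have out u : u \notin reg w T -> x u = a0 by apply: xoff.
apply/admP/allP => [H s|H u /regP[s sT us]].
  rewrite mem_iota /= => sT; have /and4P[_ h1 _ h2] : okat E1 E2 x (site w s) by apply: H; apply/regP; exists s.
  apply/andP; split.
    case: ltnP => //= ws; suff -> : site w (s - w) = site w s - e2 by [].
    rewrite -{2}(subnK ws) /site modnDr divnDr ?dvdnn // divnn w0 /e2.
    by congr pair => /=; lia.
  case: eqP => //= sw; suff -> : site w s.-1 = site w s - e1 by [].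
  have := divn_eq s w; set r := (s %% w)%N in sw *; set d := (s %/ w)%N => sE.
  have rw : (r < w)%N by rewrite ltn_mod.
  have -> : s.-1 = (d * w + r.-1)%N by lia.
  have r1 : (r.-1 < w)%N by lia.
  rewrite /site modnMDl divnMDl // modn_small // divn_small // addn0 -/r -/d.
  by clearbody r d; congr pair => /=; lia.
have hor v : (x v, x (v + e1)) \in E1.
  have [v1|/out ->] := boolP (v \in reg w T); last by case: (safe0 (x (v + e1))).
  have [v2|/out ->] := boolP (v + e1 \in reg w T); last by case: (safe0 (x v)).
  have /regP[s1 s1T vs1] := v1; have /regP[s2 s2T vs2] := v2.
  have : okl x s2 by apply: H; rewrite mem_iota.
  move: vs2; rewrite vs1 => -[/= h1 h2].
  have d1 := divn_eq s1 w; have d2 := divn_eq s2 w.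
  have h3 : (s2 %/ w = s1 %/ w)%N by lia.
  have h4 : (s2 %% w = (s1 %% w).+1)%N by lia.
  have e21 : s2.-1 = s1 by rewrite d2 h3 h4 addnS -d1.
  have m2 : (s2 %% w != 0)%N by rewrite h4.
  rewrite /okl (negbTE m2) /= e21 => /andP[_]; rewrite -vs1.
  suff -> : site w s2 = v + e1 by [].
  by rewrite vs1 /site /e1; congr pair => /=; lia.
have ver v : (x v, x (v + e2)) \in E2.
  have [v1|/out ->] := boolP (v \in reg w T); last by case: (safe0 (x (v + e2))).
  have [v2|/out ->] := boolP (v + e2 \in reg w T); last by case: (safe0 (x v)).
  have /regP[s1 s1T vs1] := v1; have /regP[s2 s2T vs2] := v2.
  have : okl x s2 by apply: H; rewrite mem_iota.
  move: vs2; rewrite vs1 => -[/= h1 h2].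
  have d1 := divn_eq s1 w; have d2 := divn_eq s2 w.
  have h3 : (s2 %/ w = (s1 %/ w).+1)%N by lia.
  have h4 : (s2 %% w = s1 %% w)%N by lia.
  have e21 : s2 = (s1 + w)%N by rewrite d2 h3 h4 mulSn -addnA -d1 addnC.
  rewrite /okl ltnNge {1 2}e21 leq_addl addnK /= => /andP[+ _]; rewrite -vs1.
  suff -> : site w s2 = v + e2 by [].
  by rewrite vs1 /site /e2; congr pair => /=; lia.
apply/and4P; split=> //.
  by have := hor (u - e1); rewrite subrK.
by have := ver (u - e2); rewrite subrK.
Qed.

Local Notation push := (push beta w).

Fixpoint wd (t : nat) (x : Z2 -> A) : nat :=
  if t is t'.+1 then push (wd t' x) (dig (x (site w t'))) else 0%N.

Lemma wd_lt t x : (wd t x < beta ^ w)%N.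
Proof. by case: t => [|t] /=; rewrite ?push_lt // expn_gt0 ltnW. Qed.

Lemma digit_mod a k : (k < w)%N -> ((a %% beta ^ w) %/ beta ^ k %% beta = a %/ beta ^ k %% beta)%N.
Proof.
by move=> kw; rewrite !modn_divl -expnS modn_dvdm // dvdn_exp2l.
Qed.

Lemma wd_digit t x i : (i < w)%N ->
  (wd t x %/ beta ^ i %% beta = if (i < t)%N then dig (x (site w (t - i.+1))) else 0)%N.
Proof.
elim: t i => [|t IH] i iw /=; first by rewrite div0n mod0n.
have db a : (dig a < beta)%N := leq_trans (dig_lt a) qb.
rewrite pushE digit_mod //; case: i iw => [|i] iw.
  by rewrite expn0 divn1 modnMDl modn_small // subn1.
rewrite expnS divnMA divnMDl ?(ltnW beta2) // (divn_small (db _)) addn0.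
by rewrite ltnS subSS IH // ltnW.
Qed.

Lemma wd_agree t x x' : (forall s, (s < t)%N -> x (site w s) = x' (site w s)) -> wd t x = wd t x'.
Proof.
elim: t => //= t IH H; rewrite H // IH // => s st; apply: H; exact: ltnW.
Qed.

Lemma okn_word t x : okn beta w (forbidden E1) (forbidden E2) t (wd t x) (dig (x (site w t))) = okl x t.
Proof.
have w1 : (w.-1 < w)%N by rewrite prednK.
have hi : (wd t x %/ (beta ^ w %/ beta) = if w <= t then dig (x (site w (t - w))) else 0)%N.
  rewrite divn_top // -(modn_small (_ : _ %/ _ < beta)%N).
    by rewrite wd_digit // prednK.
  rewrite ltn_divLR ?expn_gt0 ?(ltnW beta2) // -expnS prednK //; exact: wd_lt.
have lo : (wd t x %% beta = if 0 < t then dig (x (site w t.-1)) else 0)%N.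
  by have := @wd_digit t x 0 w0; rewrite expn0 divn1 subn1.
rewrite /okn /okl hi [(t < w)%N]ltnNge lo; congr andb.
  case: leqP => wt; last by case/andP: (forbidden0l (dig (x (site w t)))).
  by rewrite mem_forbidden negbK.
case: eqP => //= tw; case: (posnP t) => [t0|t0]; first by case: tw; rewrite t0 mod0n.
by rewrite mem_forbidden negbK.
Qed.

Definition sites t r : {fset Z2} := [fset site w s | s in iota t r].

Lemma sitesP t r u : reflect (exists2 s, (t <= s < t + r)%N & u = site w s) (u \in sites t r).
Proof.
apply: (iffP (imfsetP _ _ _ _)) => -[s /= st ->]; exists s => //;
  by move: st; rewrite mem_iota.
Qed.

Lemma sitesS t r : sites t r.+1 = site w t |` sites t.+1 r.
Proof.
apply/fsetP => u; rewrite in_fset1U; apply/sitesP/orP => [[s /andP[]]|].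
  rewrite leq_eqVlt => /orP[/eqP <- _ ->|ts st ->]; first by left.
  by right; apply/sitesP; exists s => //; rewrite ts addSnnS.
case=> [/eqP ->|/sitesP[s /andP[ts st] ->]]; first by exists t => //; rewrite leqnn addnS ltnS leq_addr.
by exists s => //; rewrite (ltnW ts) addnS -addSn.
Qed.

Local Notation V := (V beta #|A| w (forbidden E1) (forbidden E2)).

Lemma sum_letters (f : nat -> nat) : (\sum_(d < #|A|) f d = \sum_(a : A) f (dig a))%N.
Proof.
pose h a := Ordinal (dig_lt a); have hi : injective h by move=> a b [/(can_inj digK)].
have hb : bijective h by apply: inj_card_bij; rewrite ?card_ord.
by rewrite (reindex h) //; apply: onW_bij.
Qed.

Lemma wsum_word r t x :
  wsum (@one R A) (sites t r) (fun z => (all (okl z) (iota t r))%:R) x = (V r t (wd t x))%:R.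
Proof.
elim: r t x => [|r IH] t x.
  have -> : sites t 0 = fset0 by apply/fsetP => u; rewrite inE; apply/imfsetP => -[].
  by rewrite wsum0.
have tn : site w t \notin sites t.+1 r.
  by apply/sitesP => -[s /andP[ts _] /site_inj st]; rewrite st ltnn in ts.
rewrite sitesS wsum_step //= (sum_letters (fun d => okn beta w (forbidden E1) (forbidden E2) t (wd t x) d * V r t.+1 (push (wd t x) d))%N) natr_sum; apply: eq_bigr => a _; rewrite mul1r.
set z := upd x (site w t) a.
have zE s : (s < t)%N -> z (site w s) = x (site w s).
  by move=> st; rewrite /z upd_neq //; apply/eqP => /site_inj ss; rewrite ss ltnn in st.
have zt : z (site w t) = a by rewrite /z /upd eqxx.
have -> : wsum one (sites t.+1 r) (fun z' => (okl z' t && all (okl z') (iota t.+1 r))%:R) z =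
    wsum one (sites t.+1 r) (fun z' => (okl z t)%:R * (all (okl z') (iota t.+1 r))%:R) z :> R.
  apply: eq_wsum => z' z'z; rewrite -natrM mulnb; suff -> : okl z' t = okl z t by [].
  have out s : (s <= t)%N -> z' (site w s) = z (site w s).
    by move=> st; apply: z'z; apply/sitesP => -[s' /andP[ts' _] /site_inj ss]; rewrite -ss ltnNge st in ts'.
  by rewrite /okl !out ?leq_subr ?leq_pred.
by rewrite wsumZ IH -natrM -okn_word /= zt (wd_agree zE).
Qed.

Lemma Nf_word t : Nf E1 E2 a0 (reg w t) = (V t 0 0)%:R :> R.
Proof.
have := wsum_word t 0 (free a0); rewrite /= => <-.
apply: eq_wsum => z zf; rewrite mulr1 okl_adm //.
Qed.

End WordCount.

(** * Running the iteration on a machine *)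

Section Extra.
Local Open Scope nat_scope.

Lemma PC_ifb (c f g : (nat -> bool) -> (nat -> nat) -> bool) : PC c -> PC f -> PC g ->
  PC (fun m e => if c m e then f m e else g m e).
Proof.
move=> Hc Hf Hg; apply: (PC_ext _ (PC_if Hc Hf Hg)) => m e.
by case: (c m e).
Qed.

Lemma PC_exp f k : PC f -> PC (fun m e => f m e ^ k).
Proof.
move=> Hf; elim: k => [|k IH]; first exact: PC_const.
by apply: (PC_ext _ (PC_mul Hf IH)) => m e; rewrite expnS.
Qed.

End Extra.

Ltac pc_leaf := first
  [ match goal with H : PC _ |- _ => first [exact H | exact (@PC_ren _ succn H)
      | exact (@PC_ren _ (fun i => i.+2) H) | exact (@PC_ren _ (fun i => i.+3) H)] end
  | exact (PC_const _) | exact (PC_var _) ].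

Ltac pc := lazymatch goal with
  | |- PC (fun m e => addn (@?f m e) (@?g m e)) => apply (@PC_add f g); pc
  | |- PC (fun m e => muln (@?f m e) (@?g m e)) => apply (@PC_mul f g); pc
  | |- PC (fun m e => subn (@?f m e) (@?g m e)) => apply (@PC_sub f g); pc
  | |- PC (fun m e => divn (@?f m e) (@?g m e)) => apply (@PC_div f g); pc
  | |- PC (fun m e => modn (@?f m e) (@?g m e)) => apply (@PC_mod f g); pc
  | |- PC (fun m e => nat_of_bool (~~ @?f m e)) => apply (@PC_not f); pc
  | |- PC (fun m e => nat_of_bool (@?f m e && @?g m e)) => apply (@PC_and f g); pc
  | |- PC (fun m e => nat_of_bool (@?f m e || @?g m e)) => apply (@PC_or f g); pc
  | |- PC (fun m e => nat_of_bool (@?f m e == @?g m e)) => apply (@PC_eq f g); pc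
  | |- PC (fun m e => nat_of_bool (leq (S (@?f m e)) (@?g m e))) => apply (@PC_ltn f g); pc
  | |- PC (fun m e => nat_of_bool (leq (@?f m e) (@?g m e))) => apply (@PC_leq f g); pc
  | |- PC (fun m e => nat_of_bool ((@?f m e, @?g m e) \in ?s)) => apply (@PC_mem_seq s f g); pc
  | |- PC (fun m e => nat_of_bool (m (@?f m e))) => apply (@PC_mem f); pc
  | |- _ => pc_leaf
  end.

Section Digits.
Local Open Scope nat_scope.

Lemma PC_shift f g : PC f -> PC g -> PC (fun m e => f m e %/ 2 ^ g m e).
Proof.
move=> Hf Hg.
pose G m e i x := (if i == 0 then f m e else x) %/ 2.
have E m e k : iteri k.+1 (G m e) 0 = f m e %/ 2 ^ k.+1.
  by elim: k => [|k IH]; rewrite iteriS {1}/G ?IH //= -divnMA -expnSr.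
apply: (@PC_ext (fun m e => (g m e == 0) * f m e + iteri (g m e) (G m e) 0)) => [m e|].
  case: (g m e) => [|k]; first by rewrite mul1n addn0 divn1.
  by rewrite E mul0n.
apply: PC_add; first by pc.
apply: (@PC_rec g G) => //; first by apply: PC_div; [apply: PC_if; pc | pc].
case: Hf => -[a Ha] _; exists a => m e X X2 eX [|k] _; first by [].
by rewrite E; apply: leq_trans (leq_div _ _) (Ha m e X X2 eX).
Qed.

Definition bits a := (trunc_log 2 a).+1.

Lemma PC_bits f : PC f -> PC (fun m e => bits (f m e)).
Proof.
move=> Hf.
apply: (@PC_ext (fun m e => 1 + \sum_(k < f m e) (0 < f m e %/ 2 ^ (k + 1)))) => [m e|].
  rewrite /bits add1n; congr _.+1; case: (posnP (f m e)) => [->|a0]; first by rewrite big_ord0.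
  set a := f m e in a0 *.
  have E k : (0 < a %/ 2 ^ (k + 1)) = (k < trunc_log 2 a).
    rewrite divn_gt0 ?expn_gt0 // addn1; apply/idP/idP; first exact: trunc_log_max.
    by move=> kt; apply: leq_trans (trunc_logP (isT : 1 < 2) a0); rewrite leq_exp2l.
  under eq_bigr do rewrite E; rewrite sum_leq_ord; apply/minn_idPr.
  apply: ltnW; apply: leq_trans (ltn_expl _ (isT : 1 < 2)) _; exact: trunc_logP.
apply: PC_add; first by pc.
apply: (@PC_sum f (fun m e k => 0 < f m e %/ 2 ^ (k + 1))) => //.
by apply: PC_ltn; [pc | apply: PC_shift; pc].
Qed.

Definition frac_symbol a b i :=
  if i < bits a then a %/ 2 ^ (bits a - 1 - i) %% 2
  else if i == bits a then 2 else b %/ 2 ^ (bits b - 1 - (i - (bits a + 1))) %% 2.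

Lemma nat_word_mkseq a : nat_word a = mkseq (fun i => out_symbol (a %/ 2 ^ (bits a - 1 - i) %% 2)) (bits a).
Proof.
apply: (@eq_from_nth _ Slash); first by rewrite size_nat_word size_mkseq.
move=> i; rewrite size_nat_word => iL; rewrite nth_mkseq // /nat_word.
rewrite (nth_map 0) ?size_rev ?size_iota // nth_rev ?size_iota // nth_iota ?add0n; last by lia.
have -> : (trunc_log 2 a).+1 - i.+1 = bits a - 1 - i by rewrite /bits; lia.
by rewrite modn2; case: (odd _).
Qed.

Lemma frac_word_mkseq (a b : nat) :
  frac_word a b = mkseq (fun i => out_symbol (frac_symbol a b i)) (bits a + 1 + bits b).
Proof.
rewrite /frac_word /= !nat_word_mkseq /mkseq !iotaD !map_cat -catA add0n; congr cat.
  by apply/eq_in_map => i; rewrite mem_iota /= /frac_symbol => ->.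
rewrite /frac_symbol; move: (bits b) => L; rewrite /= ltnn eqxx; congr cons.
have -> : iota (0 + (bits a + 1)) L = iota (bits a + 1 + 0) L by rewrite addn0.
rewrite iotaDl -map_comp; apply/eq_in_map => i _ /=; rewrite ifN ?ifN; last 2 first.
- by apply/eqP; lia.
- by lia.
by rewrite addKn.
Qed.

End Digits.

Section Implementation.
Local Open Scope nat_scope.
Context (beta q : nat) (fb1 fb2 : seq (nat * nat)).

Definition okm w y t j d : bool :=
  ((j %/ (y %/ beta), d) \notin fb2) && ((t %% w == 0) || ((j %% beta, d) \notin fb1)).

(** Entry [j] of the vector number [t] is stored in unary in the [y ^ 6] cells
   from [(t * y + j) * y ^ 6] on. *)
Definition entry (m : nat -> bool) y t j : nat := \sum_(v < y ^ 6) m ((t * y + j) * y ^ 6 + v).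

Definition spreadm m w y t j' : nat :=
  \sum_(j < y) \sum_(d < q) ((j * beta + d) %% y == j') * (okm w y t j d * entry m y t j).

Definition totalm m w y t : nat := \sum_(j < y) spreadm m w y t j.

Definition cell m w y i : bool :=
  let t := i %/ (y * y ^ 6) in let j := (i %/ y ^ 6) %% y in let v := i %% y ^ 6 in
  if t == 0 then v < (j == 0) * y ^ 6
  else v < spreadm m w y (t - 1) j %/ (if y ^ 6 < totalm m w y (t - 1) then q else 1).

Definition last_site w := ((w - 1) %/ 2) * w + (w - 1) %/ 2.

Definition lowm m w y : nat := \sum_(j < y) entry m y (last_site w) j.
Definition highm m w y : nat := totalm m w y (last_site w).
Definition numm m w y : nat :=
  \sum_(i < highm m w y - lowm m w y) y ^ 8 %/ (lowm m w y + i).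

Lemma PC_entry fy ft fj : PC fy -> PC ft -> PC fj -> PC (fun m e => entry m (fy m e) (ft m e) (fj m e)).
Proof.
move=> Hy Ht Hj; have Hy6 := PC_exp 6 Hy.
apply: (@PC_sum (fun m e => fy m e ^ 6)
  (fun m e v => m ((ft m e * fy m e + fj m e) * fy m e ^ 6 + v))) => //; pc.
Qed.

Section PolynomialTime.
Context (fw fy ft fj : pfun) (Hw : PC fw) (Hy : PC fy) (Ht : PC ft) (Hj : PC fj).

Lemma PC_spread : PC (fun m e => spreadm m (fw m e) (fy m e) (ft m e) (fj m e)).
Proof.
apply: (@PC_sum fy (fun m e j => \sum_(d < q) ((j * beta + d) %% fy m e == fj m e) *
   (okm (fw m e) (fy m e) (ft m e) j d * entry m (fy m e) (ft m e) j))) => //.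
apply: (@PC_sum (fun=> fun=> q) (fun m e d => ((e 0 * beta + d) %% fy m (stail e) == fj m (stail e)) *
   (okm (fw m (stail e)) (fy m (stail e)) (ft m (stail e)) (e 0) d * entry m (fy m (stail e)) (ft m (stail e)) (e 0)))).
  exact: PC_const.
apply: PC_mul; first by pc.
apply: PC_mul; first by rewrite /okm; pc.
by apply: (@PC_entry (fun m e => fy m (stail (stail e))) (fun m e => ft m (stail (stail e))) (fun m e => e 1)); pc.
Qed.

End PolynomialTime.

Lemma PC_total fw fy ft : PC fw -> PC fy -> PC ft ->
  PC (fun m e => totalm m (fw m e) (fy m e) (ft m e)).
Proof.
move=> Hw Hy Ht.
apply: (@PC_sum fy (fun m e j => spreadm m (fw m e) (fy m e) (ft m e) j)) => //.
by apply: (@PC_spread (fun m e => fw m (stail e)) (fun m e => fy m (stail e)) (fun m e => ft m (stail e)) (fun m e => e 0)); pc.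
Qed.

Lemma PC_cell fw fy fi : PC fw -> PC fy -> PC fi ->
  PC (fun m e => cell m (fw m e) (fy m e) (fi m e)).
Proof.
move=> Hw Hy Hi; have Hy6 := PC_exp 6 Hy; rewrite /cell.
have Ht : PC (fun m e => fi m e %/ (fy m e * fy m e ^ 6)) by pc.
have Ht1 : PC (fun m e => fi m e %/ (fy m e * fy m e ^ 6) - 1) by pc.
have Hj : PC (fun m e => (fi m e %/ fy m e ^ 6) %% fy m e) by pc.
have Hs := PC_spread Hw Hy Ht1 Hj; have Htot := PC_total Hw Hy Ht1.
apply: PC_ifb; first by pc.
  by pc.
apply: PC_ltn; first by pc.
by apply: PC_div => //; apply: PC_if; pc.
Qed.

Lemma PC_last fw : PC fw -> PC (fun m e => last_site (fw m e)).
Proof. by move=> Hw; rewrite /last_site; pc. Qed.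

Lemma PC_low fw fy : PC fw -> PC fy -> PC (fun m e => lowm m (fw m e) (fy m e)).
Proof.
move=> Hw Hy; have HT := PC_last Hw.
apply: (@PC_sum fy (fun m e j => entry m (fy m e) (last_site (fw m e)) j)) => //.
by apply: (@PC_entry (fun m e => fy m (stail e)) (fun m e => last_site (fw m (stail e))) (fun m e => e 0)); pc.
Qed.

Lemma PC_num fw fy : PC fw -> PC fy -> PC (fun m e => numm m (fw m e) (fy m e)).
Proof.
move=> Hw Hy; have HT := PC_last Hw; have Hl := PC_low Hw Hy; have Hy8 := PC_exp 8 Hy.
have Hh : PC (fun m e => highm m (fw m e) (fy m e)) by apply: PC_total.
apply: (@PC_sum (fun m e => highm m (fw m e) (fy m e) - lowm m (fw m e) (fy m e))
  (fun m e i => fy m e ^ 8 %/ (lowm m (fw m e) (fy m e) + i))); pc.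
Qed.

Lemma PC_frac f g h : PC f -> PC g -> PC h -> PC (fun m e => frac_symbol (f m e) (g m e) (h m e)).
Proof.
move=> Hf Hg Hh; have Bf := PC_bits Hf; have Bg := PC_bits Hg; rewrite /frac_symbol.
apply: PC_if; [by pc | | apply: PC_if; [by pc | by pc |]].
  by apply: PC_mod; [apply: PC_shift; pc | pc].
by apply: PC_mod; [apply: PC_shift; pc | pc].
Qed.

End Implementation.

Section Correctness.
Local Open Scope nat_scope.
Context (beta q w : nat) (fb1 fb2 : seq (nat * nat)).
Context (beta2 : 1 < beta) (qb : q <= beta) (q0 : 0 < q) (w0 : 0 < w).
Context (fb1r : forall d, (d, 0) \notin fb1) (fb2r : forall d, (d, 0) \notin fb2).
Local Notation y := (beta ^ w).
Local Notation F := (F beta q w fb1 fb2 (y ^ 6)).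

Definition memory (i : nat) : bool :=
  i %% y ^ 6 < F (i %/ (y * y ^ 6)) ((i %/ y ^ 6) %% y).

Let y0 : 0 < y. Proof. by rewrite expn_gt0 ltnW. Qed.
Let Y0 : 0 < y ^ 6. Proof. by rewrite expn_gt0 y0. Qed.

Lemma F_le t j : j < y -> F t j <= y ^ 6.
Proof.
move=> jy; apply: leq_trans (F_total_le beta2 qb q0 w0 fb1r fb2r (y ^ 6) t).
by rewrite (bigD1 (Ordinal jy)) //= leq_addr.
Qed.

Lemma entryE m t j : j < y -> (forall i, i < t.+1 * (y * y ^ 6) -> m i = memory i) ->
  entry m y t j = F t j.
Proof.
move=> jy mE; rewrite -[RHS](minn_idPr (F_le t jy)) -sum_leq_ord; apply: eq_bigr => v _.
have vY := ltn_ord v.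
have s1 : (t * y + j) * y ^ 6 + v < t.+1 * (y * y ^ 6).
  apply: leq_trans (_ : (t * y + j).+1 * y ^ 6 <= _); first by rewrite mulSn addnC ltn_add2r.
  by rewrite mulnA leq_mul2r mulSn [y + _]addnC ltn_add2l jy orbT.
rewrite mE //; set I := _ + v.
have d1 : I %/ y ^ 6 = t * y + j by rewrite divnMDl // divn_small // addn0.
have d2 : I %/ (y * y ^ 6) = t by rewrite [y * _]mulnC divnMA d1 divnMDl // divn_small // addn0.
have d3 : I %% y ^ 6 = v by rewrite modnMDl modn_small.
by rewrite /memory d1 d2 d3 modnMDl modn_small.
Qed.

Lemma spreadmE m t j : (forall i, i < t.+1 * (y * y ^ 6) -> m i = memory i) ->
  spreadm beta q fb1 fb2 m w y t j = spread beta q w fb1 fb2 t (F t) j.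
Proof.
by move=> mE; apply: eq_bigr => -[i iy] _; apply: eq_bigr => d _; rewrite /= entryE.
Qed.

Lemma totalmE m t : (forall i, i < t.+1 * (y * y ^ 6) -> m i = memory i) ->
  totalm beta q fb1 fb2 m w y t = \sum_(j < y) spread beta q w fb1 fb2 t (F t) j.
Proof. by move=> mE; apply: eq_bigr => j _; apply: spreadmE. Qed.

Lemma cellE i : cell beta q fb1 fb2 (fun k => (k < i) && memory k) w y i = memory i.
Proof.
rewrite /cell /memory; case E: (i %/ (y * y ^ 6)) => [|t] //=; rewrite subn1 /=.
have mE k : k < t.+1 * (y * y ^ 6) -> (k < i) && memory k = memory k.
  move=> kt; rewrite (leq_trans kt) // (divn_eq i (y * y ^ 6)) E leq_addr //.
by rewrite spreadmE // totalmE.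
Qed.

Lemma numm_E m : (forall i, i < (last_site w).+1 * (y * y ^ 6) -> m i = memory i) ->
  numm beta q fb1 fb2 m w y = numerator beta q w fb1 fb2 (last_site w).
Proof.
move=> mE; have hE : highm beta q fb1 fb2 m w y = high beta q w fb1 fb2 (last_site w) by apply: totalmE.
have lE : lowm m w y = low beta q w fb1 fb2 (last_site w).
  by apply: eq_bigr => -[j jy] _ /=; apply: entryE.
by rewrite /numm hE lE.
Qed.

End Correctness.

Lemma letter_numbering (A : finType) (a0 : A) : exists dig : A -> nat, exists letter_of : nat -> A,
  [/\ cancel dig letter_of, forall a, (dig a < #|A|)%N & dig a0 = 0%N].
Proof.
pose s := a0 :: rem a0 (enum A).
have sA : perm_eq (enum A) s by apply: perm_to_rem; rewrite mem_enum.
have ms a : a \in s by rewrite -(perm_mem sA) mem_enum.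
exists (index^~ s), (nth a0 s); split; last by rewrite /s /= eqxx.
  by move=> a; rewrite nth_index.
by move=> a; rewrite cardE (perm_size sA) index_mem.
Qed.

Lemma exponent_choice (R : realType) (rho C : R) : 0 < rho < 1 -> 0 <= C ->
  exists2 c, (2 <= c)%N & forall n, C * rho ^+ (c * n.+1).-1 <= 2 ^- n.+1.
Proof.
move=> /andP[r0 r1] C0; pose K := 1 + C / rho.
have Cr : 0 <= C / rho by rewrite divr_ge0 // ltW.
have K1 : 1 <= K by rewrite lerDl.
have K0 : 0 < K by apply: lt_le_trans K1.
have r01 : 0 <= rho < 1 by rewrite (ltW r0).
have e0 : 0 < (2 * K)^-1 by rewrite invr_gt0 mulr_gt0.
have [c0 Hc] := geometric_small r01 e0.
exists c0.+2 => // n; have c1 : (0 < c0.+2 * n.+1)%N by [].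
have -> : C * rho ^+ (c0.+2 * n.+1).-1 = C / rho * (rho ^+ c0.+2) ^+ n.+1.
  rewrite -exprM -{2}(prednK c1) exprS mulrA divfK // gt_eqF //.
apply: le_trans (_ : K ^+ n.+1 * ((2 * K)^-1) ^+ n.+1 <= _).
  apply: ler_pM => //; first by rewrite exprn_ge0 // exprn_ge0 // ltW.
    apply: le_trans (_ : K <= _); first by rewrite lerDr.
    by apply: ler_eXnr.
  by rewrite lerXn2r ?nnegrE ?exprn_ge0 ?(ltW r0) ?invr_ge0 ?mulr_ge0 ?(ltW K0) // Hc //; lia.
by rewrite -exprMn invfM mulrCA mulfV ?gt_eqF // mulr1 exprVn.
Qed.

Section Computation.
Context {R : realType} {A : alphabet} (E1 E2 : {set A * A}) (a0 : A) (safe0 : safe_symbol E1 E2 a0).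
Context (h rho C : R) (rho01 : 0 < rho < 1) (C0 : 0 <= C).
Context (hP : forall m, `|- ln (pi_ E1 E2 a0 m) - h| <= C * rho ^+ m).

Lemma computable_growth : exists J : R, computable_in_time (fun n : nat => J ^+ n) h.
Proof.
have [c c2 cP] := exponent_choice rho01 C0.
have [dig [letter_of [digK dig_lt dig0]]] := letter_numbering a0.
pose beta := #|A|; pose q := #|A|.
have beta2 : (1 < beta)%N := card_letter A.
pose fb1 := forbidden dig E1; pose fb2 := forbidden dig E2.
have fl d : ((0%N, d) \notin fb1) && ((0%N, d) \notin fb2) := forbidden0l safe0 digK dig0 d.
have fr d : ((d, 0%N) \notin fb1) && ((d, 0%N) \notin fb2) := forbidden0r safe0 digK dig0 d.
have fb1l d : (0%N, d) \notin fb1 by case/andP: (fl d).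
have fb2l d : (0%N, d) \notin fb2 by case/andP: (fl d).
have fb1r d : (d, 0%N) \notin fb1 by case/andP: (fr d).
have fb2r d : (d, 0%N) \notin fb2 by case/andP: (fr d).
pose fw n := (2 * c * (n + 1) + 1)%N.
have Pw : PC (fun _ e => fw (e 0%N)) by rewrite /fw; pc.
pose N : pfun := fun _ e => ((last_site (e 0%N) + 1) * (e 1%N * e 1%N ^ 6))%N.
pose f : pfun := fun m e => cell beta q fb1 fb2 m (e 1%N) (e 2) (e 0%N).
pose num : pfun := fun m e => numm beta q fb1 fb2 m (e 0%N) (e 1%N).
pose len : pfun := fun m e => (bits (num m e) + 1 + bits (e 1%N ^ 8))%N.
pose g : pfun := fun m e => frac_symbol (num m (stail e)) (e 2 ^ 8)%N (e 0%N).
have PN : PC N.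
  have H1 := PC_last (PC_var 0); have H6 := PC_exp 6 (PC_var 1); rewrite /N; pc.
have Pf : PC f by apply: PC_cell; exact: PC_var.
have Pnum : PC num by apply: PC_num; exact: PC_var.
have Plen : PC len.
  have H1 := PC_bits Pnum; have H2 := PC_bits (PC_exp 8 (PC_var 1)); rewrite /len; pc.
have Pg : PC g by apply: PC_frac; [exact: PC_stail Pnum | apply: PC_exp; exact: PC_var | exact: PC_var].
have fw0 n : (0 < fw n)%N by rewrite /fw addn1.
have fwn n : (n <= beta ^ fw n)%N.
  apply: leq_trans (ltnW (ltn_expl n beta2)) _; rewrite leq_pexp2l ?(ltnW beta2) // /fw; nia.
pose mem n := memory beta q (fw n) fb1 fb2.
have [n i _|M [d out]] := main_program (mem := mem) Pw PN Pf Plen Pg beta2 fw0 fwn.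
  by congr nat_of_bool; apply: cellE => //; apply: ltnW.
pose y n := (beta ^ fw n)%N.
pose J := ((beta ^ (5 * c * d)).+1)%N.
exists J%:R, M, (fun n => y n ^ d)%N; split; last first.
  exists 1%N => // n /= n1; rewrite -natrX ltr_nat /y -expnM.
  apply: leq_ltn_trans (_ : (beta ^ (5 * c * d)) ^ n < _)%N; last by rewrite ltn_exp2r.
  rewrite -expnM leq_pexp2l ?(ltnW beta2) // -[(5 * c * d * n)%N]mulnAC leq_mul2r; apply/orP; right.
  rewrite /fw; nia.
move=> n; have w0 := fw0 n; have y0 : (0 < y n)%N by rewrite expn_gt0 ltnW.
pose T := last_site (fw n).
exists (numerator beta q (fw n) fb1 fb2 T : int), (y n ^ 8)%N; split; first by rewrite expn_gt0 y0.
  pose e := env2 (fw n) (y n); pose m k := (k < N (fun=> false) e)%N && mem n k.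
  have numE : num m e = numerator beta q (fw n) fb1 fb2 T.
    apply: numm_E => //; first exact: ltnW.
    by move=> i iT; rewrite /m /N /= addn1 iT.
  suff <- : mkseq (fun i => out_symbol (g m (scons i e))) (len m e) =
      frac_word (numerator beta q (fw n) fb1 fb2 T) (y n ^ 8) by exact: out n.
  rewrite frac_word_mkseq /len /g numE; apply: eq_mkseq => i.
  by rewrite /= -numE.
rewrite -pmulrn.
pose M0 := (c * n.+1)%N; have M0p : (0 < M0)%N by rewrite /M0; lia.
have wM : fw n = (2 * M0).+1 by rewrite /fw /M0; lia.
have TM : T = (M0 * (2 * M0).+1 + M0)%N.
  rewrite /T /last_site wM subn1 /= mulKn //.
have TY : (T <= fw n ^ 2)%N by rewrite TM wM; nia.
have acc := @algorithm_accuracy R _ _ _ _ _ beta2 (leqnn _) (ltnW beta2) w0 fb1l fb1r fb2l fb2r _ TY.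
have := hP M0.-1; rewrite /pi_ (prednK M0p) -TM -wM /ratio.
rewrite !(Nf_word safe0 beta2 (leqnn _) w0 digK dig_lt dig0).
set V1 := V _ _ _ _ _ T 0 0 in acc *; set V2 := V _ _ _ _ _ T.+1 0 0 in acc *.
have v1 : (0 : R) < V1%:R by rewrite ltr0n; apply: V_gt0 => //; apply: ltnW.
have v2 : (0 : R) < V2%:R by rewrite ltr0n; apply: V_gt0 => //; apply: ltnW.
rewrite ln_div ?posrE // => H.
have H2 := le_trans H (cP n).
have Y : 4 / (y n)%:R <= 2 ^- n.+1 :> R.
  rewrite ler_pdivrMr ?ltr0n // ler_pdivlMl ?exprn_gt0 // -natrX -natrM ler_nat.
  apply: leq_trans (_ : 2 ^ (n.+1 + 2) <= _)%N; first by rewrite expnD.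
  apply: leq_trans (_ : beta ^ (n.+1 + 2) <= _)%N; first by rewrite leq_exp2r // addn2.
  by rewrite /y leq_pexp2l ?(ltnW beta2) // /fw; nia.
have P2 : 2 ^- n = 2 ^- n.+1 + 2 ^- n.+1 :> R.
  by rewrite [in RHS]exprS invfM; field; rewrite expf_neq0.
rewrite P2; move: (le_trans acc Y) H2; rewrite !ler_norml -/beta -/q.
move: (_ / _) (ln V1%:R) (ln V2%:R) (2 ^- n.+1) => F l1 l2 e /andP[? ?] /andP[? ?].
by apply/andP; split; lra.
Qed.

End Computation.

Theorem proposition9p2 (R : realType) (A : alphabet) (E1 E2 : {set A * A})
    (A' : {set A})
    (safeA' : forall a : A, a \in A' -> safe_symbol E1 E2 a)
    (ratioA' : 1 - p_c R < #|A'|%:R / #|A|%:R) :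
  (exists mu : probability (borel_config A) R,
     [/\ max_entropy (sft E1 E2) mu,
         (forall nu : probability (borel_config A) R,
            max_entropy (sft E1 E2) nu ->
            forall B : set (borel_config A), measurable B -> nu B = mu B),
         is_MRF mu
       & exists L : specification R A,
           [/\ associated mu L, spec_invariant L & spec_q L < p_c R]]) /\
  (exists J : R,
     computable_in_time (fun n : nat => J ^+ n)
       (topological_entropy R (sft E1 E2))).
Proof.
have [H [a0 [rho [C [a0A' rho01 C0 hP]]]]] := maximal_entropy_theorem safeA' ratioA'.
split=> //; have safe0 := safeA' a0 a0A'.
exact: (computable_growth safe0 rho01 C0 hP).
Qed.
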